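(* Let $K\subset\mathbb{R}^n$ be a convex body with $\dim K=k\geq 1$ and let $p\geq 1$ be real. Then for every $\lambda\in[0,1]$, $$\int_{(1-\lambda)K+\lambda(-K)}|x|^p\,d\mathcal{H}^k(x)\;\geq\;|2\lambda-1|^p\int_K|x|^p\,d\mathcal{H}^k(x).$$ Equality holds if and only if either $\lambda\in\{0,1\}$, or ($p=1$ and there exists $u\in\mathbb{S}^{n-1}$ such that $K\subset\mathrm{lin}\{u\}$ and the origin is not in the relative interior of the segment $(1-\lambda)K+\lambda(-K)$).
   Context: A convex body in $\mathbb{R}^n$ is a non-empty convex compact subset of $\mathbb{R}^n$ (not necessarily with interior points); its dimension is the dimension of its affine hull. $\mathcal{H}^k$ is the $k$-dimensional Hausdorff measure, $|\cdot|$ the Euclidean norm, $\mathbb{S}^{n-1}$ the Euclidean unit sphere, and $\mathrm{lin}$ denotes the linear hull. The Minkowski combination is $\alpha A+\beta B=\{\alpha a+\beta b:a\in A,\,b\in B\}$, and $-K=\{-x:x\in K\}$. *)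

(* Defs.v *)
From HB Require Import structures.
From mathcomp Require Import all_boot all_order all_algebra.
From mathcomp Require Import all_classical all_reals all_analysis.

Set Implicit Arguments.
Unset Strict Implicit.
Unset Printing Implicit Defensive.
Import Order.TTheory GRing.Theory Num.Theory.
Import numFieldNormedType.Exports.
Local Open Scope classical_set_scope.
Local Open Scope ring_scope.

(* The library norm on 'rV[R]_n is the sup norm; the topology is the same. *)
Definition enorm (R : realType) (n : nat) (x : 'rV[R]_n) : R :=
  Num.sqrt (\sum_(i < n) x ord0 i ^+ 2).

Definition opp_set (R : realType) (n : nat) (A : set 'rV[R]_n) :
    set 'rV[R]_n :=
  [set - x | x in A].

Definition minkowski_comb (R : realType) (n : nat) (a : R) (A : set 'rV[R]_n)
    (b : R) (B : set 'rV[R]_n) : set 'rV[R]_n :=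
  [set a *: x + b *: y | x in A & y in B].

Definition convex_body (R : realType) (n : nat) (K : set 'rV[R]_n) : Prop :=
  [/\ K !=set0, convex_set K & compact K].

Definition affine_hull (R : realType) (n : nat) (A : set 'rV[R]_n) :
    set 'rV[R]_n :=
  [set y | exists (m : nat) (a : 'I_m -> R) (x : 'I_m -> 'rV[R]_n),
    [/\ \sum_(i < m) a i = 1, forall i, A (x i) &
        y = \sum_(i < m) a i *: x i]].

(* The affine hull of A is a translate of a k-dimensional linear subspace. *)
Definition affine_dim (R : realType) (n : nat) (A : set 'rV[R]_n) (k : nat) :
    Prop :=
  exists (x : 'rV[R]_n) (V : {vspace 'rV[R]_n}),
    \dim V = k /\ affine_hull A = [set x + v | v in [set` V]].

Definition relint (R : realType) (n : nat) (A : set 'rV[R]_n) :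
    set 'rV[R]_n :=
  [set x | A x /\ \forall y \near within (affine_hull A) (nbhs x), A y].

Section Hausdorff.
Local Open Scope ereal_scope.
Variables (R : realType) (n : nat).
Implicit Types (A : set 'rV[R]_n) (k : nat) (d : R).

(* diam set0 = -oo; see hausdorff_gauge. *)
Definition diam A : \bar R :=
  ereal_sup [set (enorm (x - y))%:E | x in A & y in A].

(* Lebesgue measure of the Euclidean unit ball of R^k, through the recursion
   omega_k = (2 pi / k) omega_(k-2). *)
Fixpoint unit_ball_volume k : R :=
  match k with
  | 0%N => 1
  | 1%N => 2
  | k'.+2 => 2 * pi / k%:R * unit_ball_volume k'
  end%R.

(* Normalised so that the k-dimensional Hausdorff measure is Lebesgue measure
   on R^k. *)
Definition hausdorff_gauge k A : \bar R :=
  if A == set0 then 0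
  else (unit_ball_volume k / 2 ^+ k)%:E * diam A ^+ k.

Definition hausdorff_content k d A : \bar R :=
  ereal_inf [set \sum_(i <oo) hausdorff_gauge k (F i) |
    F in [set F : (set 'rV[R]_n)^nat |
      A `<=` \bigcup_i F i /\ forall i, diam (F i) <= d%:E]].

Definition hausdorff_outer k A : \bar R :=
  ereal_sup [set hausdorff_content k d A | d in [set d : R | (0 < d)%R]].

Lemma unit_ball_volume_ge0 k : (0 <= unit_ball_volume k)%R.
Proof.
have [m] := ubnP k; elim: m k => // m IH [|[|k]]//= km.
by rewrite mulr_ge0 ?divr_ge0 ?mulr_ge0 ?pi_ge0 ?IH// -ltnS ltnW.
Qed.

Lemma diam_ge0 A : A != set0 -> 0 <= diam A.
Proof.
move=> /set0P[x Ax]; apply: ereal_sup_ubound; exists x => //; exists x => //.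
congr EFin; rewrite /enorm subrr big1 ?sqrtr0// => i _.
by rewrite mxE expr0n.
Qed.

Lemma hausdorff_gauge_ge0 k A : 0 <= hausdorff_gauge k A.
Proof.
rewrite /hausdorff_gauge; case: ifPn => // A0.
rewrite mule_ge0 ?expe_ge0 ?diam_ge0//.
by rewrite lee_fin divr_ge0// unit_ball_volume_ge0.
Qed.

Lemma hausdorff_content_ge0 k d A : 0 <= hausdorff_content k d A.
Proof.
apply: le_ereal_inf_tmp => _ [F _ <-].
by apply: nneseries_ge0 => i _ _; exact: hausdorff_gauge_ge0.
Qed.

Lemma hausdorff_content0 k d : hausdorff_content k d set0 = 0.
Proof.
apply/eqP; rewrite eq_le hausdorff_content_ge0 andbT.
apply: ereal_inf_lbound; exists (fun=> set0).
  by split=> // i; apply: ge_ereal_sup => _ [x []].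
by apply: eseries0 => i _ _; rewrite /hausdorff_gauge eqxx.
Qed.

Lemma le_hausdorff_content k d : {homo hausdorff_content k d :
  A B / A `<=` B >-> A <= B}.
Proof.
move=> A B AB; apply: ereal_inf_le_tmp => _ [F [BF Fd] <-].
by exists F => //; split => //; exact: subset_trans BF.
Qed.

Lemma hausdorff_content_sigma_subadditive k d :
  sigma_subadditive (hausdorff_content k d).
Proof.
move=> A; have [[i ioo]|] :=
    pselect (exists i, hausdorff_content k d (A i) = +oo).
  rewrite (eseries_pinfty _ _ ioo) ?leey// => m _.
  by rewrite -ltNye (lt_le_trans _ (hausdorff_content_ge0 _ _ _)).
rewrite -forallNE => Aoo.
apply/lee_addgt0Pr => e e0.
rewrite (le_trans _ (epsilon_trick _ _ (ltW e0)))//; last first.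
  by move=> m; exact: hausdorff_content_ge0.
pose P m (B : (set 'rV[R]_n)^nat) :=
  (A m `<=` \bigcup_i B i /\ forall i, diam (B i) <= d%:E) /\
  \sum_(i <oo) hausdorff_gauge k (B i) <=
    hausdorff_content k d (A m) + (e / (2 ^ m.+1)%:R)%:E.
have [G PG] : {G : nat -> (set 'rV[R]_n)^nat & forall m, P m (G m)}.
  apply: (@choice _ _ P) => m; rewrite /P /hausdorff_content.
  set S := (X in ereal_inf X).
  have en1 : (0 < e / (2 ^ m.+1)%:R)%R by rewrite divr_gt0// ltr0n expn_gt0.
  have Sfin : ereal_inf S \is a fin_num.
    rewrite ge0_fin_numE ?ltey; last exact: hausdorff_content_ge0.
    by apply/eqP; exact: Aoo.
  have [x [B BA <-] xS] := lb_ereal_inf_adherent en1 Sfin.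
  by exists B; split => //; exact/ltW.
have G_ge0 x : 0 <= (hausdorff_gauge k \o uncurry G) x.
  exact: hausdorff_gauge_ge0.
apply: (@le_trans _ _
  (\esum_(i in setT) (hausdorff_gauge k \o uncurry G) i)).
  apply: ereal_inf_lbound => /=.
  have /card_esym/ppcard_eqP[f] := card_nat2.
  exists (uncurry G \o f).
    split => [t [i _]|i] /=; last by case: (f i) => a b; exact: (PG a).1.2.
    move/(PG i).1.1 => [j _ Gt]; exists (f^-1%FUN (i, j)) => //=.
    by rewrite invK ?inE.
  rewrite -(esum_pred_image (hausdorff_gauge k \o uncurry G) _ xpredT)
    ?[fun=> _]set_true//.
  by rewrite image_eq.
rewrite (_ : esum _ _ =
    \sum_(i <oo) \sum_(j <oo) hausdorff_gauge k (G i j)); last first.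
  pose J : nat -> set (nat * nat) := fun i => [set (i, j) | j in setT].
  rewrite (_ : setT = \bigcup_k J k); last first.
    by rewrite predeqE => -[a b]; split => // _; exists a => //; exists b.
  rewrite esum_bigcupT /=; last 2 first.
  - apply/trivIsetP => i j _ _ ij.
    rewrite predeqE => -[n1 n2] /=; split => //=.
    by move=> [] [_] _ [<-{n1} _] [m' _] [] /esym/eqP; rewrite (negbTE ij).
  - by move=> [a b]; exact: (G_ge0 (a, b)).
  rewrite nneseries_esumT; last first.
    by move=> i; apply: nneseries_ge0 => j _ _; exact: hausdorff_gauge_ge0.
  apply: eq_esum => i _.
  rewrite -(esum_pred_image (hausdorff_gauge k \o uncurry G) (pair i) xpredT).
  - by congr esum; apply/seteqP; split => _ [j _ <-]; exists j.
  - by move=> m _; exact: hausdorff_gauge_ge0.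
  - by move=> ? ? _ _ [].
apply: lee_nneseries => [i _ _|i _]; last exact: (PG i).2.
by apply: nneseries_ge0 => *; exact: hausdorff_gauge_ge0.
Qed.

Lemma hausdorff_outer0 k : hausdorff_outer k set0 = 0.
Proof.
rewrite /hausdorff_outer (_ : [set _ | _ in _] = [set 0]) ?ereal_sup1//.
apply/seteqP; split => [_ [d _ <-]|_ ->] /=; first exact: hausdorff_content0.
by exists 1%R; rewrite //= hausdorff_content0.
Qed.

Lemma hausdorff_outer_ge0 k A : 0 <= hausdorff_outer k A.
Proof.
apply: le_trans (hausdorff_content_ge0 k 1 A) _.
by apply: ereal_sup_ubound; exists 1%R => //=.
Qed.

Lemma le_hausdorff_outer k : {homo hausdorff_outer k :
  A B / A `<=` B >-> A <= B}.
Proof.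
move=> A B AB; apply: ge_ereal_sup => _ [d d0 <-].
apply: le_trans (le_hausdorff_content k d AB) _.
by apply: ereal_sup_ubound; exists d.
Qed.

Lemma hausdorff_outer_sigma_subadditive k :
  sigma_subadditive (hausdorff_outer k).
Proof.
move=> A; apply: ge_ereal_sup => _ [d d0 <-].
apply: le_trans (hausdorff_content_sigma_subadditive k d A) _.
apply: lee_nneseries => [i _ _|i _]; first exact: hausdorff_content_ge0.
by apply: ereal_sup_ubound; exists d.
Qed.

HB.instance Definition _ k := isOuterMeasure.Build R 'rV[R]_n
  (hausdorff_outer k) (hausdorff_outer0 k) (hausdorff_outer_ge0 k)
  (@le_hausdorff_outer k) (@hausdorff_outer_sigma_subadditive k).

(* The restriction of the outer measure to its Caratheodory-measurable sets,
   among which are all Borel sets. *)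
Definition hausdorff_measure k :
    {measure set (caratheodory_type (hausdorff_outer k)) -> \bar R} :=
  (hausdorff_outer k : {outer_measure set 'rV[R]_n -> \bar R}).

End Hausdorff.

(* Main.v *)
(* The case lambda = 0 being trivial, one may assume 0 < lambda <= 1/2 by the
   symmetry K -> -K; let mu = 1 - 2 lambda and L = (1 - lambda) K + lambda (-K).
   Convexity of the norm and of t^p gives
     mu^(p-1) ((1 - lambda) |x|^p - lambda |y|^p) <= |(1 - lambda) x - lambda y|^p.
   Approximate K from inside by a grid of boxes of a linear chart of its affine
   hull.  As in the Hadwiger-Ohmann proof of the Brunn-Minkowski inequality, cut
   the boxes of K and of -K by parallel hyperplanes into pairs of boxes of equal
   volume whose Minkowski combinations are pairwise disjoint boxes in L; by AM-GM
   each combination is at least as large as its members.  Integrating the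
   pointwise inequality over the pairs yields the integral inequality, the factor
   mu being (1 - lambda) - lambda.

   If the pointwise inequality has a positive defect for all x in a cap of K and
   all y in an opposite cap, the cuts can be made to match a fixed volume of the
   first cap with the second one, so that the integral inequality is strict.
   This covers p > 1, bodies not contained in a line through the origin, and
   segments on such a line for which the origin is in the relative interior of L.
   In the remaining case K and L are congruent segments on one side of the origin,
   and the mean of |x| over such a segment is its value at the midpoint. *)

From HB Require Import structures.
Require Import Defs.
From mathcomp Require Import all_boot all_order all_algebra.
From mathcomp Require Import all_classical all_reals all_analysis.
From mathcomp Require Import measurable_realfun.
From mathcomp Require Import ring lra.

Set Implicit Arguments.
Unset Strict Implicit.
Unset Printing Implicit Defensive.
Import Order.TTheory GRing.Theory Num.Theory.
Import numFieldNormedType.Exports.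
Local Open Scope classical_set_scope.
Local Open Scope ring_scope.

(** * Euclidean norm *)

(** Hausdorff measure on the affine hull is never identified with Lebesgue measure. One fact
    suffices: in a linear chart the measure of a box is its volume times a constant that is finite,
    positive and determined by the linear part of the chart. As [L] is charted over the same linear
    part as [K], the same constant occurs on both sides. [L] is only bounded from below by disjoint
    boxes inside it, so it needs no grid of its own. Approximation destroys strict inequalities.
    Strictness is therefore carried by a term [d * eta], where [d] is a uniform defect obtained by
    compactness and [eta] depends on two fixed boxes in the caps but not on the grid. A pair of
    boxes may have a combination of negative weight, for which a larger volume would hurt; since the
    integrand is nonnegative, weights can be truncated at 0 before volumes are compared. *)

Lemma rV_norm_le (R : realType) n (x : 'rV[R]_n) r :
  0 <= r -> (forall i, `|x ord0 i| <= r) -> `|x| <= r.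
Proof.
move=> r0 xr; rewrite /Num.Def.normr/= mx_normrE bigmax_le// => -[i j] _ /=.
by rewrite (ord1 i).
Qed.

Lemma coord_le_norm (R : realType) n (x : 'rV[R]_n) i : `|x ord0 i| <= `|x|.
Proof.
rewrite [leRHS]/Num.Def.normr/= mx_normrE.
by apply/bigmax_geP; right => /=; exists (ord0, i).
Qed.

Section Euclidean.
Variables (R : realType) (n : nat).
Implicit Types (x y z : 'rV[R]_n) (a b : R).

Definition dot x y : R := \sum_(i < n) x ord0 i * y ord0 i.

Lemma dotC x y : dot x y = dot y x.
Proof. by apply: eq_bigr => i _; rewrite mulrC. Qed.

Lemma dotDr x y z : dot x (y + z) = dot x y + dot x z.
Proof. by rewrite -big_split; apply: eq_bigr => i _; rewrite mxE mulrDr. Qed.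

Lemma dotZr a x y : dot x (a *: y) = a * dot x y.
Proof. by rewrite mulr_sumr; apply: eq_bigr => i _; rewrite mxE mulrCA. Qed.

Lemma dotNr x y : dot x (- y) = - dot x y.
Proof. by rewrite -scaleN1r dotZr mulN1r. Qed.

Lemma dotDl x y z : dot (y + z) x = dot y x + dot z x.
Proof. by rewrite dotC dotDr !(dotC x). Qed.

Lemma dotZl a x y : dot (a *: y) x = a * dot y x.
Proof. by rewrite dotC dotZr dotC. Qed.

Lemma dotNl x y : dot (- y) x = - dot y x.
Proof. by rewrite dotC dotNr dotC. Qed.

Lemma dotE x y : dot x y = (x *m y^T) ord0 ord0.
Proof. by rewrite mxE; apply: eq_bigr => i _; rewrite mxE. Qed.

Lemma dot_ge0 x : 0 <= dot x x.
Proof. by apply: sumr_ge0 => i _; rewrite -expr2 sqr_ge0. Qed.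

Lemma enormE x : enorm x = Num.sqrt (dot x x).
Proof. by congr Num.sqrt; apply: eq_bigr => i _; rewrite expr2. Qed.

Lemma enorm_ge0 x : 0 <= enorm x.
Proof. exact: sqrtr_ge0. Qed.

Lemma sqr_enorm x : enorm x ^+ 2 = dot x x.
Proof. by rewrite enormE sqr_sqrtr ?dot_ge0. Qed.

Lemma enormZ a x : enorm (a *: x) = `|a| * enorm x.
Proof.
rewrite !enormE dotZl dotZr mulrA -expr2 sqrtrM ?sqr_ge0//.
by rewrite sqrtr_sqr.
Qed.

Lemma enormN x : enorm (- x) = enorm x.
Proof. by rewrite -scaleN1r enormZ normrN1 mul1r. Qed.

Lemma enorm0 : enorm (0 : 'rV[R]_n) = 0.
Proof. by rewrite -(scale0r (0 : 'rV[R]_n)) enormZ normr0 mul0r. Qed.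

Lemma coord_le_enorm x i : `|x ord0 i| <= enorm x.
Proof.
rewrite -(@ler_pXn2r _ 2) ?nnegrE ?enorm_ge0//.
rewrite real_normK ?num_real// sqr_enorm /dot (bigD1 i)//= expr2 lerDl.
by apply: sumr_ge0 => j _; rewrite -expr2 sqr_ge0.
Qed.

Lemma mxnorm_le_enorm x : `|x| <= enorm x.
Proof.
exact: rV_norm_le (enorm_ge0 x) (coord_le_enorm x).
Qed.

Lemma enorm_eq0 x : (enorm x == 0) = (x == 0).
Proof.
apply/eqP/eqP => [x0|->]; last exact: enorm0.
apply/rowP => i; rewrite !mxE; apply/eqP; rewrite -normr_le0.
by rewrite -x0 coord_le_enorm.
Qed.

Lemma sqr_enormD x y :
  enorm (x + y) ^+ 2 = enorm x ^+ 2 + 2 * dot x y + enorm y ^+ 2.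
Proof. rewrite !sqr_enorm dotDl !dotDr (dotC y x); ring. Qed.

(** An exact identity, so that both the Cauchy-Schwarz inequality and its equality case can be read
    off from one square. *)
Lemma cauchy_schwarz_defect x y :
  enorm (enorm y *: x - enorm x *: y) ^+ 2 =
  2 * (enorm x * enorm y) * (enorm x * enorm y - dot x y).
Proof.
rewrite sqr_enormD enormN !enormZ dotNr dotZl dotZr.
rewrite !ger0_norm ?enorm_ge0//; ring.
Qed.

Lemma dot_le x y : dot x y <= enorm x * enorm y.
Proof.
have [x0|x0] := eqVneq (enorm x) 0.
  move/eqP: x0; rewrite enorm_eq0 => /eqP ->.
  by rewrite enorm0 mul0r -(scale0r (0 : 'rV[R]_n)) dotZl mul0r.
have [y0|y0] := eqVneq (enorm y) 0.
  move/eqP: y0; rewrite enorm_eq0 => /eqP ->.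
  by rewrite enorm0 mulr0 -(scale0r (0 : 'rV[R]_n)) dotZr mul0r.
have xy : 0 < 2 * (enorm x * enorm y).
  by rewrite !mulr_gt0// lt_def ?x0 ?y0 enorm_ge0.
by rewrite -subr_ge0 -(pmulr_rge0 _ xy) -cauchy_schwarz_defect sqr_ge0.
Qed.

Lemma ler_enormD x y : enorm (x + y) <= enorm x + enorm y.
Proof.
rewrite -(@ler_pXn2r _ 2) ?nnegrE ?addr_ge0 ?enorm_ge0//.
rewrite sqr_enormD; have := dot_le x y; nra.
Qed.

(** Equality in the triangle inequality annihilates the Cauchy-Schwarz defect. The cross-multiplied
    form also covers zero vectors, so no direction has to be normalised. *)
Lemma enormD_eq x y :
  enorm (x + y) = enorm x + enorm y -> enorm y *: x = enorm x *: y.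
Proof.
move=> xy; apply/eqP; rewrite -subr_eq0 -enorm_eq0 -sqrf_eq0.
rewrite cauchy_schwarz_defect; apply/eqP.
by have := sqr_enormD x y; rewrite xy => h; nra.
Qed.

Lemma enorm_le_mxnorm x : enorm x <= n%:R * `|x|.
Proof.
rewrite -(@ler_pXn2r _ 2) ?nnegrE ?enorm_ge0 ?mulr_ge0//.
rewrite sqr_enorm exprMn.
apply: (@le_trans _ _ (\sum_(i < n) `|x| ^+ 2)).
  apply: ler_sum => i _; rewrite -expr2 -(real_normK (num_real (x _ _))) lerXn2r ?nnegrE//.
  exact: coord_le_norm.
rewrite sumr_const card_ord -[leLHS]mulr_natl ler_wpM2r ?sqr_ge0//.
rewrite -natrX ler_nat; by case: n => // m; rewrite leq_pmulr.
Qed.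

Lemma ler_enorm_dist x y : `|enorm x - enorm y| <= enorm (x - y).
Proof.
have := ler_enormD (x - y) y; have := ler_enormD (y - x) x.
rewrite !subrK -opprB enormN => h1 h2.
by rewrite ler_norml; apply/andP; split; lra.
Qed.

Lemma enorm_continuous : continuous (@enorm R n).
Proof.
move=> x; apply/(@cvgrPdist_lt _ _ _ _ (nbhs_filter x)) => e e0.
have d0 : 0 < e / n.+1%:R by rewrite divr_gt0.
apply/nbhs_ballP; exists (e / n.+1%:R) => //= y; rewrite -ball_normE /= => xy.
apply: le_lt_trans (ler_enorm_dist _ _) _.
apply: le_lt_trans (enorm_le_mxnorm _) _.
apply: (@le_lt_trans _ _ (n.+1%:R * `|x - y|)).
  by rewrite ler_wpM2r// ler_nat.
by rewrite mulrC -ltr_pdivlMr ?ltr0n.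
Qed.

End Euclidean.

(** * Pointwise inequalities *)

Section PowerConvexity.
Variable R : realType.
Implicit Types (p a b t : R).

(* Strict convexity of exp, applied to 1 = (1/p) p + (1 - 1/p) 0. *)
Lemma powR_tangent_lt p t : 1 < p -> 0 <= t -> t != 1 ->
  1 + p * (t - 1) < t `^ p.
Proof.
move=> p1; rewrite le_eqVlt => /orP[/eqP <- _|t0 t1].
  by rewrite powR0 ?gt_eqF//; lra.
have -> : t `^ p = expR (p * ln t) by rewrite /powR gt_eqF.
have x0 : ln t != 0 by rewrite ln_eq0.
rewrite -{1}(lnK (t0 : t \is Num.pos)); set x := ln t in x0 *.
have -> : expR (p * x) = expR x * expR ((p - 1) * x).
  by rewrite -expRD; congr expR; ring.
have h1 : 1 + (p - 1) * x < expR ((p - 1) * x).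
  by apply: expR_gt1Dx; rewrite mulf_neq0//; lra.
have h2 : 1 - x < expR (- x) by apply: expR_gt1Dx; rewrite oppr_eq0.
have e0 : 0 < expR x by exact: expR_gt0.
have h3 : expR x * expR (- x) = 1 by rewrite -expRD subrr expR0.
have h4 : expR x * (1 + (p - 1) * x) < expR x * expR ((p - 1) * x).
  by rewrite ltr_pM2l.
have h5 : expR x * (1 - x) < 1 by rewrite -[ltRHS]h3 ltr_pM2l.
have h6 : (p - 1) * (expR x * (1 - x)) < (p - 1) * 1 by rewrite ltr_pM2l ?subr_gt0.
lra.
Qed.

(** The tangent bound is rescaled to touch the power at the mean [m]; in the weighted sum of the
    bounds at [a] and [b] the linear terms cancel, because [m] is their weighted mean. *)
Lemma powR_strictly_convex p th a b : 1 < p -> 0 < th -> th < 1 ->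
  0 <= a -> 0 <= b -> a != b ->
  ((1 - th) * a + th * b) `^ p < (1 - th) * a `^ p + th * b `^ p.
Proof.
move=> p1 th0 th1 a0 b0 ab; set m := _ + _.
have m0 : 0 < m.
  have : 0 < a \/ 0 < b.
    have [a_gt0|] := ltrP 0 a; first by left.
    have [b_gt0|b_le0 a_le0] := ltrP 0 b; first by right.
    by move: ab; rewrite (@le_anti _ _ a 0) ?a_le0// (@le_anti _ _ b 0) ?b_le0 ?eqxx.
  by rewrite /m => -[c0|c0]; nra.
have tangent c : 0 <= c -> c != m ->
    m `^ p * (1 + p * (c / m - 1)) < c `^ p.
  move=> c0 cm; have -> : c `^ p = m `^ p * (c / m) `^ p.
    by rewrite -powRM ?divr_ge0 ?(ltW m0)// mulrC divfK ?gt_eqF.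
  rewrite ltr_pM2l ?powR_gt0//.
  apply: powR_tangent_lt => //; first by rewrite divr_ge0 ?(ltW m0).
  by apply: contraNneq cm => h; rewrite -(divfK (lt0r_neq0 m0) c) h mul1r.
have am : a != m.
  by apply: contra_neq ab => e; rewrite /m in e; nra.
have bm : b != m.
  by apply: contra_neq ab => e; rewrite /m in e; nra.
have := tangent _ a0 am; have := tangent _ b0 bm.
set u := m `^ p; set A := a `^ p; set B := b `^ p => hB hA.
have : (1 - th) * (u * (1 + p * (a / m - 1))) +
       th * (u * (1 + p * (b / m - 1))) = u.
  have -> : (1 - th) * (u * (1 + p * (a / m - 1))) +
       th * (u * (1 + p * (b / m - 1))) = u + u * p * (m / m - 1).
    by rewrite {3}/m; ring.
  by rewrite divff ?gt_eqF// subrr mulr0 addr0.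
have : 0 < 1 - th by lra.
nra.
Qed.

Lemma powR_convex p th a b : 1 <= p -> 0 < th -> th < 1 ->
  0 <= a -> 0 <= b ->
  ((1 - th) * a + th * b) `^ p <= (1 - th) * a `^ p + th * b `^ p.
Proof.
rewrite le_eqVlt => /orP[/eqP <-|p1] th0 th1 a0 b0.
  by rewrite !powRr1// addr_ge0// mulr_ge0//; lra.
have [->|ab] := eqVneq a b; last exact/ltW/powR_strictly_convex.
by rewrite -!mulrDl subrK !mul1r.
Qed.

End PowerConvexity.

Section PointwiseBound.
Variables (R : realType) (n : nat) (lambda : R).
Hypothesis (l0 : 0 < lambda) (l12 : lambda <= 1 / 2).
Implicit Types (x y z : 'rV[R]_n) (p : R).

Let l0' : 0 <= lambda. Proof. exact: ltW. Qed.

Let l1 : 0 < 1 - lambda. Proof. by move: l0 l12; lra. Qed.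

Let l1' : 0 <= 1 - lambda. Proof. exact: ltW. Qed.

Let mu : R := 1 - 2 * lambda.

Lemma enorm_reflection_defect x y :
  (1 - lambda) * enorm x - lambda * enorm y <=
  enorm ((1 - lambda) *: x + lambda *: - y).
Proof.
have := ler_enormD ((1 - lambda) *: x + lambda *: - y) (lambda *: y).
rewrite scalerN subrK !enormZ !ger0_norm// => *; lra.
Qed.

(** Equality in the triangle inequality would make [w] and [y] point in the same direction, whereas
    [v] has a positive product with [w] and a negative one with [y]. *)
Lemma enorm_reflection_defect_lt x y v : 0 < dot x v -> dot y v < 0 ->
  (1 - lambda) * enorm x - lambda * enorm y <
  enorm ((1 - lambda) *: x + lambda *: - y).
Proof.
move=> xv yv; rewrite lt_neqAle enorm_reflection_defect andbT.
apply/eqP; set w := _ + lambda *: _ => e.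
have wE : w + lambda *: y = (1 - lambda) *: x by rewrite /w scalerN subrK.
have /enormD_eq : enorm (w + lambda *: y) = enorm w + enorm (lambda *: y).
  by rewrite wE !enormZ !ger0_norm// -e; lra.
move=> /(congr1 (fun q => dot q v)); rewrite /= !dotZl enormZ gtr0_norm//.
have -> : dot w v = (1 - lambda) * dot x v - lambda * dot y v.
  by rewrite /w scalerN dotDl dotNl !dotZl.
have y0 : 0 < enorm y.
  rewrite lt_def enorm_ge0 andbT enorm_eq0; apply: contraTneq yv => ->.
  by rewrite -(scale0r (0 : 'rV[R]_n)) dotZl mul0r ltxx.
move=> h; have lyv : lambda * dot y v < 0 by rewrite pmulr_rlt0.
have h1 : 0 < (1 - lambda) * dot x v - lambda * dot y v.
  by rewrite subr_gt0 (lt_trans lyv)// mulr_gt0.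
have : 0 < lambda * enorm y * ((1 - lambda) * dot x v - lambda * dot y v).
  by rewrite !mulr_gt0.
by rewrite h ltNge mulr_ge0_le0// ?enorm_ge0// ltW.
Qed.

Let th : R := lambda / (1 - lambda).

Let th0 : 0 < th. Proof. by rewrite divr_gt0. Qed.

Let thE : lambda = th * (1 - lambda).
Proof. by rewrite divfK// gt_eqF. Qed.

Let mu_ge0 : 0 <= mu. Proof. by move: l12; rewrite /mu; lra. Qed.

Let th_lt1 : 0 < mu -> th < 1.
Proof. by rewrite /th ltr_pdivrMr// mul1r /mu; lra. Qed.

(** Extracts the factor of the bound to be proved, which leaves a plain convexity statement at the
    point [z / mu]. *)
Let enorm_powR_rescale p z : 0 < mu ->
  enorm z `^ p = mu `^ (p - 1) * (mu * enorm (mu^-1 *: z) `^ p).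
Proof.
move=> mu0; rewrite mulrA [_ * mu]mulrC.
rewrite -{1}(powRr1 (ltW mu0)) -powRD; last by rewrite (gt_eqF mu0) implybT.
rewrite subrKC enormZ gtr0_norm ?invr_gt0//.
rewrite -powRM ?mulr_ge0 ?invr_ge0 ?enorm_ge0 ?(ltW mu0)//.
by rewrite mulrA divff ?gt_eqF// mul1r.
Qed.

(* [x] is the convex combination of [w := z / mu] and [y] with weights
   [mu / (1 - lambda)] and [lambda / (1 - lambda)], where
   [z := (1 - lambda) x - lambda y]. *)
Let combE x y : 0 < mu ->
  let w := mu^-1 *: ((1 - lambda) *: x + lambda *: - y) in
  x = (1 - th) *: w + th *: y.
Proof.
move=> mu0 w; apply: (scalerI (lt0r_neq0 l1)); rewrite scalerDr !scalerA.
have -> : (1 - lambda) * (1 - th) = mu by have := thE; rewrite /mu; lra.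
rewrite divff ?gt_eqF// scale1r mulrC -thE.
by rewrite scalerN subrK.
Qed.

(** For [p > 1] this is convexity of the [p]-th power of the norm at [x], seen as a combination of
    [z / mu] and [y], multiplied by [1 - lambda]. At [mu = 0] there is no such combination, but the
    left side vanishes. For [p = 1] it is the triangle inequality. *)
Lemma enorm_powR_defect p x y : 1 <= p ->
  mu `^ (p - 1) * ((1 - lambda) * enorm x `^ p - lambda * enorm y `^ p) <=
  enorm ((1 - lambda) *: x + lambda *: - y) `^ p.
Proof.
rewrite le_eqVlt => /orP[/eqP <-|p1].
  rewrite subrr powRr0 mul1r !powRr1 ?enorm_ge0//.
  exact: enorm_reflection_defect.
have [mu0|mu0] := eqVneq mu 0.
  by rewrite mu0 powR0 ?mul0r ?powR_ge0// subr_eq0 gt_eqF.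
have {}mu0 : 0 < mu by rewrite lt_def mu0 mu_ge0.
have p0 : 0 < p by lra.
have p0' : 0 <= p by lra.
have th1 : th < 1 by exact: th_lt1.
have th1' : 0 < 1 - th by rewrite subr_gt0.
set z := _ *: _ + _ *: _; rewrite (enorm_powR_rescale p z mu0).
rewrite ler_pM2l ?powR_gt0//; set w := _ *: z.
have xE : x = (1 - th) *: w + th *: y by exact: combE.
clearbody w.
have xle : enorm x <= (1 - th) * enorm w + th * enorm y.
  by rewrite {1}xE (le_trans (ler_enormD _ _))// !enormZ !gtr0_norm.
have : enorm x `^ p <= ((1 - th) * enorm w + th * enorm y) `^ p.
  by apply: (ge0_ler_powR p0'); rewrite ?nnegrE ?enorm_ge0 ?(le_trans (enorm_ge0 x) xle).
have conv := powR_convex (ltW p1) th0 th1 (enorm_ge0 w) (enorm_ge0 y).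
move=> xp; move: {xp conv}(le_trans xp conv).
move: thE mu0 l12; rewrite /mu; set A := enorm x `^ p; set B := enorm w `^ p.
set C := enorm y `^ p => e mu0 l2 h.
have : (1 - lambda) * A <= (1 - lambda) * ((1 - th) * B + th * C).
  by rewrite ler_wpM2l//; lra.
have -> : (1 - lambda) * ((1 - th) * B + th * C) =
  (1 - lambda - th * (1 - lambda)) * B + (th * (1 - lambda)) * C by ring.
by rewrite -e; lra.
Qed.

(** There are two sources of strictness. If [w], the point [z / mu], and [y] have different norms,
    the power is strictly convex between them; if the norms agree, the triangle inequality is
    strict, since equality would force [w = y] and hence [x = y]. At [mu = 0] the right side is a
    positive multiple of a power of the norm of [x - y]. *)
Lemma enorm_powR_defect_lt p x y : 1 < p -> x != y ->
  mu `^ (p - 1) * ((1 - lambda) * enorm x `^ p - lambda * enorm y `^ p) <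
  enorm ((1 - lambda) *: x + lambda *: - y) `^ p.
Proof.
move=> p1 xy; have [mu0|mu0] := eqVneq mu 0.
  rewrite mu0 powR0 ?mul0r; last by rewrite subr_eq0 gt_eqF.
  rewrite powR_gt0// lt_def enorm_ge0 andbT enorm_eq0.
  have -> : 1 - lambda = lambda by rewrite /mu in mu0; lra.
  by rewrite -scalerDr scaler_eq0 subr_eq0 negb_or xy gt_eqF.
have {}mu0 : 0 < mu by rewrite lt_def mu0 mu_ge0.
have p0 : 0 < p by lra.
have p0' : 0 <= p by lra.
have th1 : th < 1 by exact: th_lt1.
have th1' : 0 < 1 - th by rewrite subr_gt0.
set z := _ *: _ + _ *: _; rewrite (enorm_powR_rescale p z mu0).
rewrite ltr_pM2l ?powR_gt0//; set w := _ *: z.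
have xE : x = (1 - th) *: w + th *: y by exact: combE.
clearbody w.
have xle : enorm x <= (1 - th) * enorm w + th * enorm y.
  by rewrite {1}xE (le_trans (ler_enormD _ _))// !enormZ !gtr0_norm.
suff : enorm x `^ p < (1 - th) * enorm w `^ p + th * enorm y `^ p.
  move: thE mu0 l12; rewrite /mu; set A := enorm x `^ p; set B := enorm w `^ p.
  set C := enorm y `^ p => e mu0 l2 h.
  have : (1 - lambda) * A < (1 - lambda) * ((1 - th) * B + th * C).
    by rewrite ltr_pM2l.
  have -> : (1 - lambda) * ((1 - th) * B + th * C) =
    (1 - lambda - th * (1 - lambda)) * B + (th * (1 - lambda)) * C by ring.
  by rewrite -e; lra.
have [wy|wy] := eqVneq (enorm w) (enorm y); last first.
  apply: le_lt_trans (powR_strictly_convex p1 th0 th1 (enorm_ge0 _)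
    (enorm_ge0 _) wy).
  by apply: (ge0_ler_powR p0'); rewrite ?nnegrE ?enorm_ge0 ?(le_trans (enorm_ge0 x) xle).
rewrite wy -mulrDl subrK mul1r.
rewrite gt0_ltr_powR ?nnegrE ?enorm_ge0//.
rewrite lt_neqAle; apply/andP; split; last first.
  by rewrite (le_trans xle)// wy -mulrDl subrK mul1r.
apply: contra_neq xy => xn.
have /enormD_eq : enorm ((1 - th) *: w + th *: y) =
    enorm ((1 - th) *: w) + enorm (th *: y).
  rewrite -xE !enormZ !gtr0_norm//.
  by rewrite wy -mulrDl subrK mul1r xn.
rewrite !enormZ !gtr0_norm//.
rewrite wy !scalerA => e.
have [y0|y0] := eqVneq (enorm y) 0.
  move: wy; rewrite y0 => /eqP; rewrite enorm_eq0 => /eqP w0.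
  by move/eqP: y0; rewrite enorm_eq0 => /eqP y0; rewrite xE w0 y0 !scaler0 addr0.
have -> : x = w + th *: (y - w).
  by rewrite {1}xE scalerBl scale1r scalerBr -addrA [- _ + _]addrC.
have c0 : th * enorm y * (1 - th) != 0.
  exact: mulf_neq0 (mulf_neq0 (lt0r_neq0 th0) y0) (lt0r_neq0 th1').
suff -> : y = w by rewrite subrr scaler0 addr0.
apply: (scalerI c0); rewrite e; congr (_ *: _); ring.
Qed.

End PointwiseBound.

(** * Matching families of boxes *)

Section Boxes.
Variables (R : realType) (k : nat).

(* A weighted half-open box [prod_i [lo i, hi i[]. *)
Record wbox := WBox { lo : 'I_k -> R; hi : 'I_k -> R; wt : R }.

Implicit Types (b c : wbox) (s : seq wbox) (i j : 'I_k) (t : R).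

Definition wfbox b := [forall i, lo b i < hi b i].
Definition vol b := \prod_i (hi b i - lo b i).
(** Separation by a coordinate hyperplane rather than mere disjointness, because the induction cuts
    along that hyperplane. *)
Definition sepbox b c := [exists i, (hi b i <= lo c i) || (hi c i <= lo b i)].
(** The weights must agree because a piece inherits the bound on the integrand from the box it was
    cut from. *)
Definition subbox b c :=
  (wt b == wt c) && [forall i, (lo c i <= lo b i) && (hi b i <= hi c i)].
Definition upd (f : 'I_k -> R) i t j := if j == i then t else f j.

(** A list of at most one box: an empty piece disappears, so that boxes stay nondegenerate and their
    number can drop. *)
Definition cutl i t b : seq wbox :=
  if lo b i < t
  then [:: WBox (lo b) (upd (hi b) i (Num.min (hi b i) t)) (wt b)] else [::].
Definition cutr i t b : seq wbox :=
  if t < hi b i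
  then [:: WBox (upd (lo b) i (Num.max (lo b i) t)) (hi b) (wt b)] else [::].
Definition lcut i t s := flatten (map (cutl i t) s).
Definition rcut i t s := flatten (map (cutr i t) s).

Lemma vol_gt0 b : wfbox b -> 0 < vol b.
Proof. by move=> /forallP wf; apply: prodr_gt0 => i _; rewrite subr_gt0. Qed.

Lemma subbox_refl b : subbox b b.
Proof. by rewrite /subbox eqxx; apply/forallP => i; rewrite !lexx. Qed.

Lemma subbox_trans a b c : subbox a b -> subbox b c -> subbox a c.
Proof.
move=> /andP[/eqP ab /forallP AB] /andP[/eqP bc /forallP BC].
apply/andP; split; first by rewrite ab bc.
apply/forallP => i; have /andP[h1 h2] := AB i; have /andP[h3 h4] := BC i.
by rewrite (le_trans h3 h1) (le_trans h2 h4).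
Qed.

Lemma has_subbox_trans a s s' : has (subbox a) s ->
  all (fun b => has (subbox b) s') s -> has (subbox a) s'.
Proof.
elim: s => //= b s IH /orP[ab|as_] /andP[bs' ss']; last exact: IH.
elim: s' bs' {IH ss'} => //= c s' IH /orP[bc|/IH ->]; last by rewrite orbT.
by rewrite (subbox_trans ab bc).
Qed.

Lemma sepbox_sub a a' b b' : subbox a a' -> subbox b b' ->
  sepbox a' b' -> sepbox a b.
Proof.
move=> /andP[_ /forallP A] /andP[_ /forallP B] /existsP[i AB].
apply/existsP; exists i.
have /andP[a1 a2] := A i; have /andP[b1 b2] := B i.
by case/orP: AB => h; rewrite ?(le_trans a2 (le_trans h b1))//
  (le_trans b2 (le_trans h a1)) orbT.
Qed.

Lemma cutl_spec i t b : all (fun c => subbox c b && (hi c i <= t)) (cutl i t b).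
Proof.
rewrite /cutl; case: ifP => //= bt; rewrite /subbox /= /upd !eqxx ge_min lexx.
rewrite orbT !andbT; apply/forallP => j; rewrite lexx /=.
by case: eqP => // ->; rewrite ge_min lexx.
Qed.

Lemma cutr_spec i t b : all (fun c => subbox c b && (t <= lo c i)) (cutr i t b).
Proof.
rewrite /cutr; case: ifP => //= bt; rewrite /subbox /= /upd !eqxx le_max lexx.
rewrite orbT !andbT; apply/forallP => j; rewrite lexx andbT.
by case: eqP => // ->; rewrite le_max lexx.
Qed.

Lemma wf_cutl i t b : wfbox b -> all wfbox (cutl i t b).
Proof.
move=> /forallP wf; rewrite /cutl; case: ifP => //= bt; rewrite andbT.
apply/forallP => j; rewrite /= /upd; case: eqP => // ->.
by rewrite lt_min wf.
Qed.

Lemma wf_cutr i t b : wfbox b -> all wfbox (cutr i t b).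
Proof.
move=> /forallP wf; rewrite /cutr; case: ifP => //= bt; rewrite andbT.
apply/forallP => j; rewrite /= /upd; case: eqP => // ->.
by rewrite gt_max wf.
Qed.

Lemma volE b i : vol b = \prod_(j | j != i) (hi b j - lo b j) * (hi b i - lo b i).
Proof. by rewrite /vol (bigD1 i)//= mulrC. Qed.

Lemma vol_updhi b i v w :
  vol (WBox (lo b) (upd (hi b) i v) w) =
  \prod_(j | j != i) (hi b j - lo b j) * (v - lo b i).
Proof.
rewrite /vol (bigD1 i)//= /upd eqxx mulrC; congr (_ * _).
by apply: eq_bigr => j /negbTE ->.
Qed.

Lemma vol_updlo b i u w :
  vol (WBox (upd (lo b) i u) (hi b) w) =
  \prod_(j | j != i) (hi b j - lo b j) * (hi b i - u).
Proof.
rewrite /vol (bigD1 i)//= /upd eqxx mulrC; congr (_ * _).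
by apply: eq_bigr => j /negbTE ->.
Qed.

Lemma cutl_vol i t b : wfbox b -> \sum_(c <- cutl i t b) vol c =
  \prod_(j | j != i) (hi b j - lo b j) *
  Num.max 0 (Num.min (hi b i) t - lo b i).
Proof.
move=> /forallP/(_ i) wf; rewrite /cutl; case: ltrP => bt.
  rewrite big_seq1 vol_updhi; congr (_ * _); apply/esym/max_r.
  by rewrite subr_ge0 ltW// lt_min wf.
rewrite big_nil max_l ?mulr0// subr_le0 ge_min bt orbT//.
Qed.

(** Taking [F] constant equal to 1 gives volumes, taking it to be the identity gives the sums that
    approximate integrals. *)
Lemma cut_sum (F : R -> R) i t b : wfbox b ->
  \sum_(c <- cutl i t b) vol c * F (wt c) +
  \sum_(c <- cutr i t b) vol c * F (wt c) = vol b * F (wt b).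
Proof.
move=> /forallP/(_ i) wf; rewrite /cutl /cutr.
case: ltrP => lt; case: ltrP => ht; rewrite ?big_seq1 ?big_nil /=.
- rewrite vol_updhi vol_updlo (volE b i).
  by rewrite -mulrDl -mulrDr; congr (_ * _ * _); ring.
- by rewrite vol_updhi (volE b i) addr0.
- by rewrite vol_updlo (volE b i) add0r.
- by have := lt_le_trans wf (le_trans ht lt); rewrite ltxx.
Qed.

Lemma lcut_sum (F : R -> R) i t s : all wfbox s ->
  \sum_(c <- lcut i t s) vol c * F (wt c) +
  \sum_(c <- rcut i t s) vol c * F (wt c) = \sum_(b <- s) vol b * F (wt b).
Proof.
elim: s => [|b s IH] /=; first by rewrite !big_nil addr0.
move=> /andP[wfb wfs]; rewrite /lcut /rcut /= !big_cat big_cons/=.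
by rewrite addrACA cut_sum// IH.
Qed.

Lemma lcut_vol i t s : all wfbox s ->
  \sum_(c <- lcut i t s) vol c + \sum_(c <- rcut i t s) vol c =
  \sum_(b <- s) vol b.
Proof.
move=> wf; have /= := lcut_sum (fun=> 1) i t wf.
by rewrite !(eq_bigr _ (fun b _ => mulr1 (vol b))).
Qed.

Lemma wf_lcut i t s : all wfbox s -> all wfbox (lcut i t s).
Proof.
by elim: s => //= b s IH /andP[wb ws]; rewrite /lcut/= all_cat wf_cutl// IH.
Qed.

Lemma wf_rcut i t s : all wfbox s -> all wfbox (rcut i t s).
Proof.
by elim: s => //= b s IH /andP[wb ws]; rewrite /rcut/= all_cat wf_cutr// IH.
Qed.

Lemma lcut_spec i t s :
  all (fun c => has (subbox c) s && (hi c i <= t)) (lcut i t s).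
Proof.
elim: s => //= b s IH; rewrite /lcut/= all_cat; apply/andP; split.
  by apply: sub_all (cutl_spec i t b) => c /andP[-> ->].
by apply: sub_all IH => c /andP[-> ->]; rewrite orbT.
Qed.

Lemma rcut_spec i t s :
  all (fun c => has (subbox c) s && (t <= lo c i)) (rcut i t s).
Proof.
elim: s => //= b s IH; rewrite /rcut/= all_cat; apply/andP; split.
  by apply: sub_all (cutr_spec i t b) => c /andP[-> ->].
by apply: sub_all IH => c /andP[-> ->]; rewrite orbT.
Qed.

Lemma pairwise_flatten_sep (f : wbox -> seq wbox) s :
  (forall b, all (fun c => subbox c b) (f b)) ->
  (forall b, (size (f b) <= 1)%N) ->
  pairwise sepbox s -> pairwise sepbox (flatten (map f s)).
Proof.
move=> fsub f1; elim: s => //= b s IH /andP[bs ss]; rewrite pairwise_cat IH//.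
rewrite andbT; apply/andP; split; last first.
  by move: (f1 b); case: (f b) => [|x []].
apply: sub_all (fsub b) => c cb.
elim: {IH ss} s bs => //= d s IH /andP[bd bs]; rewrite all_cat IH// andbT.
by apply: sub_all (fsub d) => e ed; exact: sepbox_sub bd.
Qed.

Lemma pairwise_lcut i t s : pairwise sepbox s -> pairwise sepbox (lcut i t s).
Proof.
apply: pairwise_flatten_sep => b.
  by apply: sub_all (cutl_spec i t b) => c /andP[].
by rewrite /cutl; case: ifP.
Qed.

Lemma pairwise_rcut i t s : pairwise sepbox s -> pairwise sepbox (rcut i t s).
Proof.
apply: pairwise_flatten_sep => b.
  by apply: sub_all (cutr_spec i t b) => c /andP[].
by rewrite /cutr; case: ifP.
Qed.

Lemma size_lcut i t s : (size (lcut i t s) <= size s)%N.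
Proof.
elim: s => //= b s IH; rewrite /lcut/= size_cat -add1n leq_add//.
by rewrite /cutl; case: ifP.
Qed.

Lemma size_rcut i t s : (size (rcut i t s) <= size s)%N.
Proof.
elim: s => //= b s IH; rewrite /rcut/= size_cat -add1n leq_add//.
by rewrite /cutr; case: ifP.
Qed.

Lemma size_lcut_lt i t s : has (fun b => t <= lo b i) s ->
  (size (lcut i t s) < size s)%N.
Proof.
elim: s => //= b s IH; rewrite /lcut/= size_cat /cutl.
case: (leP t (lo b i)) => [h _|h /= /IH //].
by rewrite add0n ltnS size_lcut.
Qed.

Lemma size_rcut_lt i t s : has (fun b => hi b i <= t) s ->
  (size (rcut i t s) < size s)%N.
Proof.
elim: s => //= b s IH; rewrite /rcut/= size_cat /cutr.
case: (leP (hi b i) t) => [h _|h /= /IH //].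
by rewrite add0n ltnS size_rcut.
Qed.

(** The clamped form is a finite sum of continuous functions of [t], as the intermediate value
    theorem requires. *)
Lemma lcut_volE i t s : all wfbox s -> \sum_(c <- lcut i t s) vol c =
  \sum_(b <- s) \prod_(j | j != i) (hi b j - lo b j) *
    Num.max 0 (Num.min (hi b i) t - lo b i).
Proof.
elim: s => [|b s IH] /=; first by rewrite !big_nil.
by move=> /andP[wb ws]; rewrite /lcut/= big_cat big_cons /= cutl_vol// IH.
Qed.

Lemma sum_vol_ge0 s : all wfbox s -> 0 <= \sum_(b <- s) vol b.
Proof.
elim: s => [|b s IH] /=; first by rewrite big_nil.
by move=> /andP[wb ws]; rewrite big_cons addr_ge0 ?IH// ltW ?vol_gt0.
Qed.

Lemma lcut_all i t s : all wfbox s -> all (fun b => hi b i <= t) s ->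
  \sum_(c <- lcut i t s) vol c = \sum_(b <- s) vol b.
Proof.
move=> wf ht; rewrite lcut_volE//; elim: s wf ht => [|b s IH] /=.
  by rewrite !big_nil.
move=> /andP[wb ws] /andP[hb hs]; rewrite !big_cons IH// (volE b i) min_l//.
by rewrite max_r// subr_ge0 ltW// (forallP wb).
Qed.

Lemma lcut_none i t s : all (fun b => t <= lo b i) s -> lcut i t s = [::].
Proof.
elim: s => //= b s IH /andP[bt st]; rewrite /lcut/= [flatten _]IH// cats0.
by rewrite /cutl ltNge bt.
Qed.

Lemma boxes_bounded i s : exists T,
  all (fun b => - T <= lo b i) s && all (fun b => hi b i <= T) s.
Proof.
elim: s => [|b s [T /andP[h1 h2]]] /=; first by exists 0.
exists (Num.max T (Num.max (- lo b i) (hi b i))).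
set M := Num.max _ _; have TM : T <= M by rewrite le_max lexx.
have loM : - M <= lo b i by rewrite lerNl !le_max lexx orbT.
have hiM : hi b i <= M by rewrite !le_max lexx !orbT.
rewrite loM hiM /=; apply/andP; split.
  by apply: sub_all h1 => c; apply: le_trans; rewrite lerN2.
by apply: sub_all h2 => c /le_trans; apply.
Qed.

Lemma lcut_vol_continuous i s : all wfbox s ->
  continuous (fun t => \sum_(c <- lcut i t s) vol c).
Proof.
move=> wf; rewrite (_ : (fun t => _) = (fun t =>
  \sum_(b <- s) \prod_(j | j != i) (hi b j - lo b j) *
    Num.max 0 (Num.min (hi b i) t - lo b i))); last first.
  by apply/funext => t; rewrite lcut_volE.
move=> t; elim: s {wf} => [|b s IH].
  under eq_fun do rewrite big_nil; exact: cvg_cst.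
under eq_fun do rewrite big_cons; apply: cvgD; last exact: IH.
apply: cvgM; first exact: cvg_cst.
have ct : {for t, continuous (fun t : R => (Num.min (hi b i) t - lo b i : R^o))}.
  apply: cvgB; last exact: cvg_cst.
  by apply: (@continuous_min _ _ (fun=> hi b i : R^o) id); [exact: cvg_cst|exact: cvg_id].
by apply: (@continuous_max _ _ (fun=> 0 : R^o) _ _ _ ct); exact: cvg_cst.
Qed.

(** The bound [t0 <= t] will place everything beyond the cut inside a prescribed cap. *)
Lemma lcut_IVT i s t0 v : all wfbox s ->
  \sum_(c <- lcut i t0 s) vol c <= v <= \sum_(b <- s) vol b ->
  exists2 t, t0 <= t & \sum_(c <- lcut i t s) vol c = v.
Proof.
move=> wf /andP[v1 v2]; have [T /andP[_ hT]] := boxes_bounded i s.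
set g := fun t => \sum_(c <- lcut i t s) vol c.
have hT' : all (fun b => hi b i <= Num.max t0 T) s.
  by apply: sub_all hT => b; rewrite le_max => ->; rewrite orbT.
have [] := @IVT R g t0 (Num.max t0 T) v.
- by rewrite le_max lexx.
- exact/continuous_subspaceT/lcut_vol_continuous.
- by rewrite /g (lcut_all wf hT') ge_min v1 /= le_max v2 orbT.
by move=> c; rewrite in_itv /= => /andP[t0c _] gc; exists c.
Qed.

Lemma lcut_IVT0 i s v : all wfbox s -> 0 <= v <= \sum_(b <- s) vol b ->
  exists t, \sum_(c <- lcut i t s) vol c = v.
Proof.
move=> wf v01; have [T /andP[hT _]] := boxes_bounded i s.
have [|t _ <-] := @lcut_IVT i s (- T) v wf; last by exists t.
by rewrite lcut_none// big_nil.
Qed.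

End Boxes.

Section Matching.
Variables (R : realType) (k : nat).
Implicit Types (b c : wbox R k) (p q : wbox R k * wbox R k).

Definition cbox (u v : R) p : wbox R k :=
  WBox (fun i => u * lo p.1 i + v * lo p.2 i)
       (fun i => u * hi p.1 i + v * hi p.2 i)
       (u * wt p.1 + v * wt p.2).

(* [P] cuts the boxes of [As] and of [Bs] into pieces of equal volumes, paired
   in such a way that the Minkowski combinations of the pairs are disjoint. *)
Record matching (u v : R) (As Bs : seq (wbox R k))
    (P : seq (wbox R k * wbox R k)) : Prop := Matching {
  matching_wf : all (fun p => wfbox p.1 && wfbox p.2) P;
  matching_subl : all (fun p => has (subbox p.1) As) P;
  matching_subr : all (fun p => has (subbox p.2) Bs) P;
  matching_vol : all (fun p => vol p.1 == vol p.2) P;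
  matching_sep : pairwise (@sepbox R k) (map (cbox u v) P);
  matching_suml : forall F : R -> R,
    \sum_(p <- P) vol p.1 * F (wt p.1) = \sum_(b <- As) vol b * F (wt b);
  matching_sumr : forall F : R -> R,
    \sum_(p <- P) vol p.2 * F (wt p.2) = \sum_(b <- Bs) vol b * F (wt b) }.

Variables (u v : R).
Hypotheses (u0 : 0 < u) (v0 : 0 < v) (uv1 : u + v = 1).

Lemma wf_cbox p : wfbox p.1 -> wfbox p.2 -> wfbox (cbox u v p).
Proof.
move=> /forallP w1 /forallP w2; apply/forallP => i /=.
by rewrite ltrD// ltr_pM2l.
Qed.

(** Bounds [1] and [r] from below by the tangent line of [expR] at [m]; in the combination with
    weights [u] and [v] the linear terms cancel. *)
Lemma weighted_AGM (r : R) : 0 < r -> expR (v * ln r) <= u + v * r.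
Proof.
move=> r0; set m := v * ln r.
have e0 : 0 < expR m by exact: expR_gt0.
have h1 : expR m * (1 - m) <= 1.
  by rewrite -[leRHS](expRxMexpNx_1 m) ler_pM2l// expR_ge1Dx.
have h2 : expR m * (1 + (ln r - m)) <= r.
  have {2}-> : r = expR m * expR (ln r - m) by rewrite -expRD subrKC lnK ?posrE.
  by rewrite ler_pM2l// expR_ge1Dx.
have h3 : u * (expR m * (1 - m)) <= u * 1 by rewrite ler_pM2l.
have h4 : v * (expR m * (1 + (ln r - m))) <= v * r by rewrite ler_pM2l.
have -> : expR m = u * (expR m * (1 - m)) + v * (expR m * (1 + (ln r - m))).
  have -> : u = 1 - v by rewrite -uv1 addrK.
  by rewrite /m; ring.
by rewrite -[X in _ <= X + _](mulr1 u) lerD.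
Qed.

(** With [r i] the ratio of the [i]-th sides, the quotient of the volumes is the product of the
    [u + v * r i], each at least the power [v] of [r i]; equal volumes make the product of the [r i]
    equal to 1. *)
Lemma vol_cbox_ge p : wfbox p.1 -> wfbox p.2 -> vol p.1 = vol p.2 ->
  vol p.1 <= vol (cbox u v p).
Proof.
move=> wf1 wf2 vE; have v1 := vol_gt0 wf1.
move/forallP in wf1; move/forallP in wf2.
pose r i := (hi p.2 i - lo p.2 i) / (hi p.1 i - lo p.1 i).
have a0 i : 0 < hi p.1 i - lo p.1 i by rewrite subr_gt0.
have r0 i : 0 < r i by rewrite divr_gt0// subr_gt0.
have -> : vol (cbox u v p) = vol p.1 * \prod_i (u + v * r i).
  rewrite /vol -big_split /=; apply: eq_bigr => i _.
  rewrite mulrDr mulrCA [_ * r i]mulrC divfK ?gt_eqF//; ring.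
rewrite -[leLHS]mulr1 ler_pM2l//.
have e1 : \prod_i expR (v * ln (r i)) = 1.
  rewrite -expR_sum -mulr_sumr (_ : \sum_i ln (r i) = 0) ?mulr0 ?expR0//.
  apply: expR_inj; rewrite expR0 expR_sum.
  under eq_bigr do rewrite lnK ?posrE//.
  rewrite prodf_div -/(vol p.2) -/(vol p.1) vE divff//.
  by rewrite -vE gt_eqF.
rewrite -[leLHS]e1.
by apply: ler_prod => i _; rewrite expR_ge0 weighted_AGM.
Qed.

(** Combinations of pairs below the cuts lie below [u * t + v * t'] in direction [i], those of pairs
    above lie above it. The families are arbitrary, so weights may be changed on one side of the
    cuts. *)
Lemma matching_sep_cat i t t' As Bs As' Bs' P Q :
  all (fun b => hi b i <= t) As -> all (fun b => hi b i <= t') Bs ->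
  all (fun b => t <= lo b i) As' -> all (fun b => t' <= lo b i) Bs' ->
  matching u v As Bs P -> matching u v As' Bs' Q ->
  pairwise (@sepbox R k) (map (cbox u v) (P ++ Q)).
Proof.
move=> hA hB hA' hB' mP mQ.
rewrite map_cat pairwise_cat (matching_sep mP) (matching_sep mQ) !andbT.
have sub_hi s x c : all (fun b => hi b i <= x) s -> has (subbox c) s ->
    hi c i <= x.
  elim: s => //= b s IH /andP[bx sx] /orP[/andP[_ /forallP/(_ i)/andP[_ h]]|/IH]; last exact.
  exact: le_trans bx.
have sub_lo s x c : all (fun b => x <= lo b i) s -> has (subbox c) s ->
    x <= lo c i.
  elim: s => //= b s IH /andP[bx sx] /orP[/andP[_ /forallP/(_ i)/andP[h _]]|/IH]; last exact.
  exact: le_trans h.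
have HP : all (fun p => (hi p.1 i <= t) && (hi p.2 i <= t')) P.
  rewrite all_predI; apply/andP; split.
    by apply: sub_all (matching_subl mP) => p; exact: sub_hi.
  by apply: sub_all (matching_subr mP) => p; exact: sub_hi.
have HQ : all (fun p => (t <= lo p.1 i) && (t' <= lo p.2 i)) Q.
  rewrite all_predI; apply/andP; split.
    by apply: sub_all (matching_subl mQ) => p; exact: sub_lo.
  by apply: sub_all (matching_subr mQ) => p; exact: sub_lo.
rewrite /allrel all_map; apply: sub_all HP => p /andP[p1 p2] /=.
rewrite all_map; apply: sub_all HQ => q /andP[q1 q2] /=.
apply/existsP; exists i => /=; apply/orP; left.
by apply: lerD; rewrite ler_pM2l//; [exact: le_trans q1|exact: le_trans q2].
Qed.

Lemma matching_cut i t t' As Bs P Q :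
  all (@wfbox R k) As -> all (@wfbox R k) Bs ->
  matching u v (lcut i t As) (lcut i t' Bs) P ->
  matching u v (rcut i t As) (rcut i t' Bs) Q ->
  matching u v As Bs (P ++ Q).
Proof.
move=> wA wB mP mQ; split.
- by rewrite all_cat (matching_wf mP) (matching_wf mQ).
- rewrite all_cat; apply/andP; split.
    apply: sub_all (matching_subl mP) => p /has_subbox_trans; apply.
    by apply: sub_all (lcut_spec i t As) => b /andP[].
  apply: sub_all (matching_subl mQ) => p /has_subbox_trans; apply.
  by apply: sub_all (rcut_spec i t As) => b /andP[].
- rewrite all_cat; apply/andP; split.
    apply: sub_all (matching_subr mP) => p /has_subbox_trans; apply.
    by apply: sub_all (lcut_spec i t' Bs) => b /andP[].
  apply: sub_all (matching_subr mQ) => p /has_subbox_trans; apply.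
  by apply: sub_all (rcut_spec i t' Bs) => b /andP[].
- by rewrite all_cat (matching_vol mP) (matching_vol mQ).
- apply: (@matching_sep_cat i t t' _ _ _ _ _ _ _ _ _ _ mP mQ).
  + by apply: sub_all (lcut_spec i t As) => b /andP[].
  + by apply: sub_all (lcut_spec i t' Bs) => b /andP[].
  + by apply: sub_all (rcut_spec i t As) => b /andP[].
  + by apply: sub_all (rcut_spec i t' Bs) => b /andP[].
- by move=> F; rewrite big_cat /= (matching_suml mP) (matching_suml mQ) lcut_sum.
- by move=> F; rewrite big_cat /= (matching_sumr mP) (matching_sumr mQ) lcut_sum.
Qed.

Lemma sum_vol_eq0 s : all (@wfbox R k) s -> \sum_(b <- s) vol b = 0 -> s = [::].
Proof.
case: s => // b s /= /andP[wb ws]; rewrite big_cons => e.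
by have := ltr_wpDr (sum_vol_ge0 ws) (vol_gt0 wb); rewrite e ltxx.
Qed.

Lemma sepbox_cut b c : sepbox b c -> exists i t,
  has (fun d => t <= lo d i) [:: b; c] && has (fun d => hi d i <= t) [:: b; c].
Proof.
by move=> /existsP[i /orP[h|h]]; exists i;
  [exists (hi b i)|exists (hi c i)] => /=; rewrite h !lexx !orbT.
Qed.

(* Hadwiger-Ohmann: a hyperplane separating two boxes of one family and a
   parallel one cutting off the same volume from the other family reduce the
   number of boxes on both sides. *)
Lemma matching_exists As Bs : all (@wfbox R k) As -> all (@wfbox R k) Bs ->
  pairwise (@sepbox R k) As -> pairwise (@sepbox R k) Bs ->
  \sum_(b <- As) vol b = \sum_(b <- Bs) vol b ->
  exists P, matching u v As Bs P.
Proof.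
have [m] := ubnP (size As + size Bs); elim: m As Bs => // m IH As Bs.
rewrite ltnS => szm wA wB sA sB volE.
(* One cut per family suffices: equal volumes below imply equal volumes above, one family loses a
   box on both sides, and the other does not grow. *)
have cut i t t' : \sum_(b <- lcut i t As) vol b = \sum_(b <- lcut i t' Bs) vol b ->
    (size (lcut i t As) < size As)%N && (size (rcut i t As) < size As)%N ||
    (size (lcut i t' Bs) < size Bs)%N && (size (rcut i t' Bs) < size Bs)%N ->
    exists P, matching u v As Bs P.
  move=> ve sz.
  have lA := size_lcut i t As; have lB := size_lcut i t' Bs.
  have rA := size_rcut i t As; have rB := size_rcut i t' Bs.
  have [||||||P mP] := IH (lcut i t As) (lcut i t' Bs).
  - by apply: leq_trans szm; case/orP: sz => /andP[s1 s2];
      [rewrite -addSn|rewrite -addnS]; exact: leq_add.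
  - exact: wf_lcut.
  - exact: wf_lcut.
  - exact: pairwise_lcut.
  - exact: pairwise_lcut.
  - exact: ve.
  have [||||||Q mQ] := IH (rcut i t As) (rcut i t' Bs).
  - by apply: leq_trans szm; case/orP: sz => /andP[s1 s2];
      [rewrite -addSn|rewrite -addnS]; exact: leq_add.
  - exact: wf_rcut.
  - exact: wf_rcut.
  - exact: pairwise_rcut.
  - exact: pairwise_rcut.
  - have := lcut_vol i t wA; have := lcut_vol i t' wB; rewrite -volE -ve => <-.
    by move/addrI.
  by exists (P ++ Q); exact: matching_cut mP mQ.
have between s i t : all (@wfbox R k) s ->
    0 <= \sum_(b <- lcut i t s) vol b <= \sum_(b <- s) vol b.
  move=> ws; rewrite sum_vol_ge0 ?wf_lcut//= -(lcut_vol i t ws) lerDl.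
  by rewrite sum_vol_ge0// wf_rcut.
case: As => [|a [|a' As]] in szm wA sA volE cut *.
- have -> : Bs = [::] by apply: sum_vol_eq0 => //; rewrite -volE big_nil.
  by exists [::]; split => // F; rewrite !big_nil.
- case: Bs => [|b [|b' Bs]] in szm wB sB volE cut *.
  + by have := sum_vol_eq0 wA; rewrite volE big_nil => /(_ erefl).
  + exists [:: (a, b)]; rewrite !big_seq1 in volE.
    move: wA wB => /= /andP[wa _] /andP[wb _]; split => //=.
    * by rewrite wa wb.
    * by rewrite subbox_refl.
    * by rewrite subbox_refl.
    * by rewrite volE eqxx.
    * by move=> F; rewrite !big_seq1.
    * by move=> F; rewrite !big_seq1.
  + have /sepbox_cut[i [t /andP[h1 h2]]] : sepbox b b' by case/andP: sB => /andP[].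
    have [|t' ht'] := @lcut_IVT0 _ _ i [:: a] (\sum_(c <- lcut i t [:: b, b' & Bs]) vol c) wA.
      by rewrite volE; exact: between.
    apply: (cut i t' t) => //; apply/orP; right.
    by rewrite (@size_lcut_lt _ _ _ _ ([:: b; b'] ++ Bs)) ?(@size_rcut_lt _ _ _ _ ([:: b; b'] ++ Bs)) ?has_cat ?h1 ?h2.
- have /sepbox_cut[i [t /andP[h1 h2]]] : sepbox a a' by case/andP: sA => /andP[].
  have [|t' ht'] := @lcut_IVT0 _ _ i Bs (\sum_(c <- lcut i t [:: a, a' & As]) vol c) wB.
    by rewrite -volE; exact: between.
  apply: (cut i t t') => //; apply/orP; left.
  by rewrite (@size_lcut_lt _ _ _ _ ([:: a; a'] ++ As)) ?(@size_rcut_lt _ _ _ _ ([:: a; a'] ++ As)) ?has_cat ?h1 ?h2.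
Qed.

End Matching.

(** * Hausdorff measure: Lipschitz maps and measurability *)

Section Hausdorff.
Variable R : realType.
Local Open Scope ereal_scope.

Lemma le_expe (x y : \bar R) m : 0 <= x -> x <= y -> x ^+ m <= y ^+ m.
Proof.
move=> x0 xy; elim: m => [|m IH]; first by rewrite !expe0.
by rewrite !expeS; apply: lee_pmul => //; exact: expe_ge0.
Qed.

Lemma expeZ (t : R) (x : \bar R) m :
  (t%:E * x) ^+ m = (t ^+ m)%:E * x ^+ m.
Proof.
elim: m => [|m IH]; first by rewrite !expe0 mul1e.
by rewrite !expeS IH exprS EFinM muleACA.
Qed.

Lemma diam_le n (A : set 'rV[R]_n) (d : \bar R) :
  (forall x y, A x -> A y -> (enorm (x - y))%:E <= d) -> diam A <= d.
Proof. by move=> h; apply: ge_ereal_sup => _ [x Ax [y Ay <-]]; exact: h. Qed.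

Lemma enorm_le_diam n (A : set 'rV[R]_n) x y : A x -> A y ->
  (enorm (x - y))%:E <= diam A.
Proof.
by move=> Ax Ay; apply: ereal_sup_ubound; exists x => //; exists y.
Qed.

Lemma diam_set0 n : diam (set0 : set 'rV[R]_n) = -oo.
Proof.
rewrite /diam (_ : [set _ | _ in _ & _ in _] = set0) ?ereal_sup0//.
by apply/seteqP; split=> [_ [x []]|].
Qed.

Section Lipschitz.
Variables (n m : nat) (f : 'rV[R]_n -> 'rV[R]_m) (t : R).
Hypotheses (t0 : (0 < t)%R)
  (ft : forall x y, (enorm (f x - f y) <= t * enorm (x - y))%R).

Lemma hausdorff_gauge_lipschitz k A :
  hausdorff_gauge k (f @` A) <= (t ^+ k)%:E * hausdorff_gauge k A.
Proof.
rewrite /hausdorff_gauge; have [->|A0] := eqVneq A set0.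
  by rewrite image_set0 eqxx mule0.
have fA0 : f @` A != set0 by apply/set0P/image_nonempty/set0P.
rewrite (negbTE fA0).
rewrite muleCA -expeZ lee_wpmul2l//.
  by rewrite lee_fin divr_ge0// unit_ball_volume_ge0.
apply: le_expe; first exact: diam_ge0.
apply: diam_le => _ _ [x Ax <-] [y Ay <-].
apply: (@le_trans _ _ (t * enorm (x - y))%:E); first by rewrite lee_fin.
by rewrite EFinM lee_pmul2l ?lte_fin ?enorm_le_diam.
Qed.

(** The image of a cover at scale [d / t] is a cover at scale [d]. *)
Lemma hausdorff_outer_lipschitz k A :
  hausdorff_outer k (f @` A) <= (t ^+ k)%:E * hausdorff_outer k A.
Proof.
apply: ge_ereal_sup => _ [d /= d0 <-].
apply: (@le_trans _ _ ((t ^+ k)%:E * hausdorff_content k (d / t) A)); last first.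
  rewrite lee_pmul2l ?lte_fin ?exprn_gt0//.
  by apply: ereal_sup_ubound; exists (d / t)%R => //=; rewrite divr_gt0.
rewrite -lee_pdivrMl ?exprn_gt0//.
apply: le_ereal_inf_tmp => _ [F [AF Fd] <-].
rewrite lee_pdivrMl ?exprn_gt0// -nneseriesZl; last first.
  by move=> i _; exact: hausdorff_gauge_ge0.
apply: (@le_trans _ _ (\sum_(i <oo) hausdorff_gauge k (f @` F i))).
  apply: ereal_inf_lbound; exists (fun i => f @` F i) => //; split.
    by move=> _ [x /AF[i _ Fix] <-]; exists i => //; exists x.
  move=> i; apply: diam_le => _ _ [x Fx <-] [y Fy <-].
  have := le_trans (enorm_le_diam Fx Fy) (Fd i).
  rewrite !lee_fin ler_pdivlMr// mulrC; exact: le_trans.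
apply: lee_nneseries => [i _ _|i _]; first exact: hausdorff_gauge_ge0.
exact: hausdorff_gauge_lipschitz.
Qed.

End Lipschitz.

Lemma hausdorff_outer_isometry n k (f g : 'rV[R]_n -> 'rV[R]_n) A :
  (forall x y, enorm (f x - f y) = enorm (x - y)) -> cancel f g ->
  cancel g f -> hausdorff_outer k (f @` A) = hausdorff_outer k A.
Proof.
move=> fi fg gf.
have le1 h B : (forall x y, (enorm (h x - h y) <= 1 * enorm (x - y))%R) ->
    hausdorff_outer k (h @` B) <= hausdorff_outer k (B : set 'rV[R]_n).
  by move=> /(hausdorff_outer_lipschitz ltr01)/(_ k B); rewrite expr1n mul1e.
apply/eqP; rewrite eq_le; apply/andP; split.
  by apply: le1 => x y; rewrite fi mul1r.
have {1}-> : A = g @` (f @` A).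
  rewrite image_comp; apply/seteqP; split=> [x Ax|_ [x Ax <-]] /=.
    by exists x => //=; rewrite fg.
  by rewrite fg.
by apply: le1 => x y; rewrite mul1r -fi !gf.
Qed.

Section MetricOuterMeasure.
Variables (n k : nat).
Implicit Types A B X : set 'rV[R]_n.

Lemma le_hausdorff_content_scale (d d' : R) A : (d <= d')%R ->
  hausdorff_content k d' A <= hausdorff_content k d A.
Proof.
move=> dd'; apply: ereal_inf_le_tmp => _ [F [AF Fd] <-].
by exists F => //; split=> // i; rewrite (le_trans (Fd i))// lee_fin.
Qed.

(** A set of diameter at most [d] cannot meet both [A] and [B], so every cover of the union splits
    into two covers. *)
Lemma hausdorff_content_separated (d : R) A B :
  (forall x y, A x -> B y -> (d < enorm (x - y))%R) ->
  hausdorff_content k d A + hausdorff_content k d B <=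
  hausdorff_content k d (A `|` B).
Proof.
move=> sep; apply: le_ereal_inf_tmp => _ [F [ABF Fd] <-].
pose G C i := if pselect (F i `&` C !=set0) then F i else set0.
have Gin C i : F i `&` C !=set0 -> G C i = F i.
  by move=> h; rewrite /G; case: pselect.
have Gout C i : ~ (F i `&` C !=set0) -> G C i = set0.
  by move=> h; rewrite /G; case: pselect.
have Gge0 C i : 0 <= hausdorff_gauge k (G C i) by exact: hausdorff_gauge_ge0.
have Gcontent C : C `<=` A `|` B ->
    hausdorff_content k d C <= \sum_(i <oo) hausdorff_gauge k (G C i).
  move=> CAB; apply: ereal_inf_lbound; exists (G C) => //; split.
    move=> x Cx; have [i _ Fix] := ABF _ (CAB _ Cx); exists i => //.
    by rewrite Gin//; exists x.
  move=> i; have [/Gin ->|/Gout ->] := pselect (F i `&` C !=set0) => //.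
  by rewrite diam_set0 leNye.
apply: (@le_trans _ _ (\sum_(i <oo) hausdorff_gauge k (G A i) +
                       \sum_(i <oo) hausdorff_gauge k (G B i))).
  by apply: leeD; apply: Gcontent => x; [left|right].
rewrite -nneseriesD//; apply: lee_nneseries => [i _ _|i _].
  by rewrite adde_ge0.
have g0 : hausdorff_gauge k (set0 : set 'rV[R]_n) = 0.
  by rewrite /hausdorff_gauge eqxx.
have [FA|/Gout ->] := pselect (F i `&` A !=set0); last first.
  rewrite g0 add0e; have [/Gin ->|/Gout ->//] := pselect (F i `&` B !=set0) => //.
  by rewrite g0 hausdorff_gauge_ge0.
rewrite (Gin _ _ FA); have [[y [Fy By]]|/Gout ->] := pselect (F i `&` B !=set0); last first.
  by rewrite g0 adde0.
case: FA => x [Fx Ax].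
have := le_trans (enorm_le_diam Fx Fy) (Fd i).
by rewrite lee_fin leNgt sep.
Qed.

Lemma hausdorff_outer_separated (e : R) A B : (0 < e)%R ->
  (forall x y, A x -> B y -> (e <= enorm (x - y))%R) ->
  hausdorff_outer k A + hausdorff_outer k B <= hausdorff_outer k (A `|` B).
Proof.
move=> e0 sep; have HABge0 := hausdorff_outer_ge0 k (A `|` B).
case: (ltP (hausdorff_outer k (A `|` B)) +oo) => [HABfin|]; last first.
  by rewrite leye_eq => /eqP ->; rewrite leey.
have fin C : C `<=` A `|` B -> hausdorff_outer k C \is a fin_num.
  move=> CAB; rewrite ge0_fin_numE ?hausdorff_outer_ge0//.
  by apply: le_lt_trans HABfin; exact: le_hausdorff_outer.
have finA : hausdorff_outer k A \is a fin_num by apply: fin => x; left.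
have finB : hausdorff_outer k B \is a fin_num by apply: fin => x; right.
rewrite -leeBrDr//; apply: ge_ereal_sup => _ [d1 /= d10 <-].
rewrite leeBrDr// addeC.
have finC : hausdorff_content k d1 A \is a fin_num.
  rewrite ge0_fin_numE ?hausdorff_content_ge0//.
  apply: (@le_lt_trans _ _ (hausdorff_outer k A)); last first.
    by rewrite ltey_eq finA.
  by apply: ereal_sup_ubound; exists d1.
rewrite -leeBrDr//; apply: ge_ereal_sup => _ [d2 /= d20 <-].
rewrite leeBrDr// addeC.
(* Small enough for both scales, and strictly below the gap [e]. *)
pose d : R := Num.min (Num.min d1 d2) (e / 2)%R.
have d0 : (0 < d)%R by rewrite !lt_min d10 d20 divr_gt0.
have de : (d < e)%R.
  by rewrite (@le_lt_trans _ _ (e / 2)%R) ?ge_min ?lexx ?orbT//; lra.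
apply: (@le_trans _ _ (hausdorff_content k d (A `|` B))); last first.
  by apply: ereal_sup_ubound; exists d.
apply: le_trans (hausdorff_content_separated _); last first.
  by move=> x y Ax By; exact: lt_le_trans (sep _ _ Ax By).
by apply: leeD; apply: le_hausdorff_content_scale; rewrite !ge_min lexx ?orbT.
Qed.

(* Caratheodory's criterion, along the layers
   [1 / (j + 2) <= g < 1 / (j + 1)]; every second layer is separated from the
   previous ones. *)
Lemma caratheodory_lipschitz_sublevel (g : 'rV[R]_n -> R) :
  (forall x y, (`|g x - g y| <= enorm (x - y))%R) ->
  (hausdorff_outer k : {outer_measure set 'rV[R]_n -> \bar R}).-caratheodory
    [set x | (g x <= 0)%R].
Proof.
move=> glip; apply: le_caratheodory_measurable => X.
set H := hausdorff_outer k; set S := [set x | (g x <= 0)%R].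
change (H (X `&` S) + H (X `&` ~` S) <= H X).
have [Xfin|] := ltP (H X) +oo; last by rewrite leye_eq => /eqP ->; rewrite leey.
have Hge0 Y : 0 <= H Y by exact: hausdorff_outer_ge0.
have H0 : H set0 = 0 by exact: hausdorff_outer0.
have sep (r s : R) Y Z : (r < s)%R -> Y `<=` [set x | (g x <= r)%R] ->
    Z `<=` [set x | (s <= g x)%R] -> H Y + H Z <= H (Y `|` Z).
  move=> rs Yr Zs; apply: (@hausdorff_outer_separated (s - r)).
    by rewrite subr_gt0.
  move=> x y /Yr /= xr /Zs /= ys; have := glip x y.
  by rewrite ler_norml => /andP[h _]; lra.
pose a (j : nat) : R := (j.+1%:R^-1)%R.
have a0 j : (0 < a j)%R by rewrite invr_gt0.
have alt i j : (i < j)%N -> (a j < a i)%R.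
  by move=> ij; rewrite ltf_pV2 ?posrE// ltr_nat.
pose L j := X `&` [set x | (a j.+1 <= g x < a j)%R].
(* Passing from one chosen layer to the next skips a layer, which provides the gap in the values of
   [g]. *)
have layers (m0 : nat) N : \sum_(j < N) H (L (m0 + j.*2).+1%N) <=
    H (X `&` [set x | (a (m0 + N.*2)%N <= g x)%R]).
  elim: N => [|N IH]; first by rewrite big_ord0.
  rewrite big_ord_recr /= addeC.
  apply: (@le_trans _ _ (H (L (m0 + N.*2).+1%N) +
      H (X `&` [set x | (a (m0 + N.*2)%N <= g x)%R]))).
    by rewrite leeD2l.
  apply: (@le_trans _ _ (H (L (m0 + N.*2).+1%N `|`
      (X `&` [set x | (a (m0 + N.*2)%N <= g x)%R])))).
    apply: (sep (a (m0 + N.*2).+1%N) (a (m0 + N.*2)%N)).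
  - exact: alt.
  - by move=> x [_ /= /andP[_ /ltW]].
  - by move=> x [].
  apply: le_hausdorff_outer; rewrite doubleS !addnS => x [|] [Xx /= gx].
    by split => //=; case/andP: gx.
  by split => //=; rewrite (le_trans _ gx)// ltW// alt.
have HX N m0 : \sum_(j < N) H (L (m0 + j.*2).+1%N) <= H X.
  by apply: le_trans (layers _ _) _; apply: le_hausdorff_outer => x [].
(* Layers of either parity have total at most [H X], so the full series converges and its tails tend
   to 0. *)
have partial N : \sum_(0 <= j < N) H (L j.+1) <= H X + H X.
  apply: (@le_trans _ _ (\sum_(0 <= j < N.*2) H (L j.+1))).
    apply: lee_sum_nneg_natr => //; by rewrite -addnn leq_addr.
  suff -> : \sum_(0 <= j < N.*2) H (L j.+1) =
      \sum_(j < N) H (L (0 + j.*2).+1%N) + \sum_(j < N) H (L (1 + j.*2).+1%N).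
    by apply: leeD; exact: HX.
  elim: N => [|N IH]; first by rewrite !big_ord0 big_nil adde0.
  by rewrite doubleS !big_nat_recr//= IH !big_ord_recr/= addeACA addeA.
have tail_fin : \sum_(j <oo) H (L j.+1) < +oo.
  apply: (@le_lt_trans _ _ (H X + H X)); last first.
    by rewrite lte_add_pinfty.
  apply: lime_le; first by apply: is_cvg_nneseries.
  by apply: nearW => N; exact: partial.
(* The points of [X] with [0 < g x < a N.+1] fill the layers from [N.+1] on; what remains of [X]
   outside [S] is at a positive distance from [S]. *)
have main N : H (X `&` S) + H (X `&` ~` S) <=
    H X + \sum_(N <= j <oo) H (L j.+1).
  apply: (@le_trans _ _ (H (X `&` S) + (H (X `&` [set x | (a N.+1 <= g x)%R]) +
     \sum_(N <= j <oo) H (L j.+1)))).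
    rewrite leeD2l//.
    pose T j := L (j + N).+1%N.
    rewrite -(@nneseries_addn _ (fun j => H (L j.+1)))//.
    apply: (@le_trans _ _ (H (X `&` [set x | (a N.+1 <= g x)%R]) +
        H (\bigcup_j T j))); last first.
      by rewrite leeD2l// hausdorff_outer_sigma_subadditive.
    apply: le_trans (outer_measureU2 (hausdorff_outer k :
      {outer_measure set 'rV[R]_n -> \bar R}) _ _).
    apply: le_hausdorff_outer => x [Xx /= /negP]; rewrite -ltNge => gx.
    have [h|h] := leP (a N.+1) (g x); first by left.
    right.
    have [m am] : exists m, (a m <= g x)%R.
      exists (Num.bound (g x)^-1); rewrite /a invf_ple ?posrE//.
      have := archi_boundP (ltW (_ : 0 < (g x)^-1)%R); rewrite invr_gt0.
      move=> /(_ gx)/ltW/le_trans; apply; by rewrite ler_nat.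
    have := ex_minnP (ex_intro (fun m => a m <= g x)%R m am).
    case=> {am}m am mmin.
    have Nm : (N.+1 < m)%N.
      rewrite ltnNge; apply/negP; rewrite leq_eqVlt => /orP[/eqP mN|mN].
        by move: h; rewrite ltNge -mN am.
      by have := lt_trans h (alt _ _ mN); rewrite ltNge am.
    case: m => [|[|j]] in am mmin Nm *; [by []|by []|].
    rewrite !ltnS in Nm; exists (j - N)%N => //; rewrite /T subnK//.
    split => //=; rewrite am ltNge /=.
    by apply/negP => /mmin; rewrite ltnn.
  rewrite addeA leeD2r//.
  apply: (@le_trans _ _ (H ((X `&` S) `|` (X `&` [set x | (a N.+1 <= g x)%R])))).
    by apply: (sep 0%R (a N.+1)) => // x [].
  by apply: le_hausdorff_outer => x [|] [].
have cv := nneseries_tail_cvg tail_fin (fun _ _ => Hge0 _).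
have cvX : H X + \sum_(N <= j <oo) H (L j.+1) @[N --> \oo] --> H X + 0.
  by apply: cvgeD cv; [rewrite adde_defC fin_num_adde_defr|exact: cvg_cst].
rewrite -[leRHS]adde0 -(cvg_lim _ cvX)//.
apply: lime_ge; first by apply/cvg_ex; exists (H X + 0).
by apply: nearW => N; exact: main.
Qed.

End MetricOuterMeasure.
End Hausdorff.

(** * Measurability of closed sets and integration of continuous functions *)

Section BorelCaratheodory.
Variables (R : realType) (n k : nat).

Local Notation cara := (caratheodory_type (@hausdorff_outer R n k)).

Lemma lipschitz_sublevel_measurable (g : 'rV[R]_n -> R) (C : R) : 0 < C ->
  (forall x y, `|g x - g y| <= C * enorm (x - y)) ->
  measurable ([set x | g x <= 0] : set cara).
Proof.
move=> C0 gC; rewrite (_ : [set x | _] = [set x | C^-1 * g x <= 0]); last first.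
  by apply/seteqP; split => x /=; rewrite pmulr_rle0 ?invr_gt0.
apply: caratheodory_lipschitz_sublevel => x y.
rewrite -mulrBr normrM gtr0_norm ?invr_gt0// mulrC ler_pdivrMr//.
by rewrite mulrC.
Qed.

(** [F] is the zero set of the distance to [F], which is 1-Lipschitz for the Euclidean norm. *)
Lemma closed_measurable_cara (F : set 'rV[R]_n) : closed F ->
  measurable (F : set cara).
Proof.
move=> clF; have [->|/set0P[z0 Fz0]] := eqVneq F set0; first exact: measurable0.
pose D x := [set enorm (x - z) | z in F].
pose g x := inf (D x).
have D0 x : D x !=set0 by exists (enorm (x - z0)), z0.
have Dlb x : has_lbound (D x).
  by exists 0 => _ [z _ <-]; exact: enorm_ge0.
have g_lip x y : g x <= enorm (x - y) + g y.
  rewrite -lerBlDl; apply: lb_le_inf => // _ [z Fz <-].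
  rewrite lerBlDl; apply: (@le_trans _ _ (enorm (x - z))).
    by apply: ge_inf => //; exists z.
  by rewrite -{1}(subrKA y) ler_enormD.
rewrite (_ : F = [set x | g x <= 0]).
  apply: (@lipschitz_sublevel_measurable g 1) => // x y; rewrite mul1r.
  have h1 := g_lip x y; have := g_lip y x; rewrite -(opprB x y) enormN => h2.
  by rewrite ler_norml; apply/andP; split; lra.
apply/seteqP; split => x /=.
  move=> Fx; apply: ge_inf => //; exists x => //.
  by rewrite subrr enorm0.
move=> gx; apply: clF => B /nbhs_ballP[e /= e0 eB].
have /inf_lt : inf (D x) < e by exact: le_lt_trans gx e0.
move=> /(_ (D0 x))[_ [z Fz <-] xz]; exists z; split => //; apply: eB.
by rewrite -ball_normE /=; exact: le_lt_trans (mxnorm_le_enorm _) xz.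
Qed.

Lemma continuous_measurable_cara (h : 'rV[R]_n -> R) (D : set cara) :
  continuous h -> measurable_fun D (h : cara -> R).
Proof.
move=> ch; apply: measurable_funTS.
apply: (measurability _ (RGenOpens.measurableE R)).
move=> _ [_ [a [b ->] <-]]; rewrite setTI -[X in measurable X]setCK.
apply: measurableC; apply: closed_measurable_cara; rewrite closedC.
by apply: open_comp => [x _|]; [exact: ch|exact: interval_open].
Qed.

End BorelCaratheodory.

Section HausdorffIntegral.
Variables (R : realType) (n k : nat).
Implicit Types (h g : 'rV[R]_n -> R) (D : set 'rV[R]_n).

Local Notation cara := (caratheodory_type (@hausdorff_outer R n k)).
Local Notation H := (@hausdorff_outer R n k).
Local Notation mu := (hausdorff_measure R n k).

Definition hmeasurable D : Prop := measurable (D : set cara).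

Definition hint h D : \bar R := (\int[mu]_(x in D) (h x)%:E)%E.

Lemma hmeasurableD D E : hmeasurable D -> hmeasurable E ->
  hmeasurable (D `\` E).
Proof. exact: measurableD. Qed.

Lemma hmeasurableU D E : hmeasurable D -> hmeasurable E ->
  hmeasurable (D `|` E).
Proof. exact: measurableU. Qed.

Lemma hmeasurable0 : hmeasurable set0.
Proof. exact: measurable0. Qed.

Lemma hausdorff_outerU D E : hmeasurable D -> hmeasurable E ->
  D `&` E = set0 -> (H (D `|` E) = H D + H E)%E.
Proof. move=> mD mE DE; exact: (@measureU _ _ _ mu). Qed.

Lemma hausdorff_outer_setD D E : hmeasurable D -> hmeasurable E ->
  E `<=` D -> (H D = H E + H (D `\` E))%E.
Proof.
move=> mD mE ED; rewrite -hausdorff_outerU ?setDUK//; first exact: hmeasurableD.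
by apply/seteqP; split=> // x [Ex [_]].
Qed.

Section Continuous.
Variable h : 'rV[R]_n -> R.
Hypotheses (ch : continuous h) (h0 : forall x, 0 <= h x).

Let mh D : measurable_fun (D : set cara) (fun x : cara => (h x)%:E).
Proof. by apply/measurable_EFinP; exact: continuous_measurable_cara. Qed.

Lemma hint_ge0 D : (0%R%:E <= hint h D)%E.
Proof.
apply: (@integral_ge0 _ _ _ mu D (fun x => (h x)%:E)) => x _.
by rewrite lee_fin.
Qed.

Lemma hint_setD D E : hmeasurable D -> hmeasurable E -> E `<=` D ->
  (hint h D = hint h E + hint h (D `\` E))%E.
Proof.
move=> mD mE ED; rewrite /hint.
rewrite -(@ge0_integral_setU _ _ _ mu E (D `\` E) mE (hmeasurableD mD mE)
  (fun x => (h x)%:E)).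
- by rewrite setDUK.
- exact: mh.
- by move=> x _; rewrite lee_fin.
- by rewrite disj_set2E; apply/eqP/seteqP; split=> // x [Ex [_]].
Qed.

Lemma hint_ge_cst D (c : R) : hmeasurable D -> 0 <= c ->
  (forall x, D x -> c <= h x) -> (c%:E * H D <= hint h D)%E.
Proof.
move=> mD c0 hc; rewrite -[H D]/(mu D) -(@integral_cst _ _ _ mu D mD c%:E).
apply: (@ge0_le_integral _ _ _ mu D mD (fun=> c%:E) (fun x => (h x)%:E)).
- by move=> x _; rewrite lee_fin.
- exact: measurable_cst.
- exact: mh.
- by move=> x Dx; rewrite lee_fin hc.
Qed.

Lemma hint_le_cst D (c : R) : hmeasurable D ->
  (forall x, D x -> h x <= c) -> (hint h D <= c%:E * H D)%E.
Proof.
move=> mD hc; rewrite -[H D]/(mu D) -(@integral_cst _ _ _ mu D mD c%:E).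
apply: (@ge0_le_integral _ _ _ mu D mD (fun x => (h x)%:E) (fun=> c%:E)).
- by move=> x _; rewrite lee_fin.
- exact: mh.
- exact: measurable_cst.
- by move=> x Dx; rewrite lee_fin hc.
Qed.

End Continuous.
End HausdorffIntegral.

(** * Hausdorff measure in affine charts *)

Section GridCounting.
Variable R : realType.

(** The smallest and the largest index in the interval differ by less than [2 * rho * m]. *)
Lemma card_short_interval (m : nat) (c rho : R) : (0 < m)%N -> 0 < rho ->
  \sum_(x < m) (`|x%:R / m%:R - c| < rho)%R%:R <= 2 * rho * m%:R + 1 :> R.
Proof.
move=> m0 rho0; pose T : pred 'I_m := fun x => `|x%:R / m%:R - c| < rho.
rewrite (_ : \sum_(x < m) _ = #|T|%:R); last first.
  rewrite -sum1_card natr_sum [RHS]big_mkcond /=; apply: eq_bigr => x _.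
  by rewrite (_ : (x \in T) = T x)// /T; case: (_ < _).
have [/existsP[x0 Tx0]|] := boolP [exists x, T x]; last first.
  rewrite negb_exists => /forallP T0; rewrite (_ : #|T| = 0%N).
    by have : 0 <= 2 * rho * m%:R; [by rewrite !mulr_ge0 ?ler0n// ltW|lra].
  by apply: eq_card0 => x; apply/negbTE; exact: T0.
pose a := [arg min_(x < x0 | T x) nat_of_ord x].
pose b := [arg max_(x > x0 | T x) nat_of_ord x].
have [Ta amin] : T a /\ (forall x, T x -> (a <= x)%N).
  by rewrite /a; case: arg_minnP.
have [Tb bmax] : T b /\ (forall x, T x -> (x <= b)%N).
  by rewrite /b; case: arg_maxnP.
have ab := bmax _ Ta.
have cardT : (#|T| <= (b - a).+1)%N.
  rewrite cardE -(size_map val) -(size_iota a (b - a).+1).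
  apply: uniq_leq_size; first by rewrite (map_inj_uniq val_inj) enum_uniq.
  move=> y /mapP[x xT ->]; have Tx : T x by move: xT; rewrite mem_enum.
  by rewrite mem_iota amin//= addnS subnKC// ltnS bmax.
apply: (@le_trans _ _ (b - a).+1%:R); first by rewrite ler_nat.
rewrite -natr1 lerD2r natrB//.
have m0' : 0 < m%:R :> R by rewrite ltr0n.
rewrite -ler_pdivrMr// mulrBl.
move: Ta Tb; rewrite /T !ltr_norml => /andP[a1 a2] /andP[b1 b2]; lra.
Qed.

(* Counting the points of the grid [{0, 1/m, .., (m-1)/m}^k] in each cube. *)
Lemma cube_cover_sum (k N : nat) (c : 'I_N -> 'rV[R]_k) (rho : 'I_N -> R) :
  (forall i, 0 < rho i) ->
  [set a : 'rV[R]_k | forall j, 0 <= a ord0 j <= 1] `<=`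
    [set a | exists i, `|a - c i| < rho i] ->
  1 <= \sum_i (4 * rho i) ^+ k.
Proof.
move=> rho0 cover.
(* For a grid this fine the count [2 * rho * m + 1] is at most [4 * rho * m], whence the constant
   4. *)
have [m [m0 mrho]] : exists m, (0 < m)%N /\ forall i, 1 <= 2 * rho i * m%:R.
  pose s := \sum_i (rho i)^-1.
  have sge i : (rho i)^-1 <= s.
    rewrite /s (bigD1 i)//= lerDl sumr_ge0// => j _.
    by rewrite invr_ge0 ltW.
  have s0 : 0 <= s by apply: sumr_ge0 => j _; rewrite invr_ge0 ltW.
  exists (Num.bound s).+1; split=> // i.
  have ms : s <= (Num.bound s).+1%:R.
    by rewrite (le_trans (ltW (archi_boundP s0)))// ler_nat.
  have : (rho i)^-1 * rho i <= (Num.bound s).+1%:R * rho i.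
    by rewrite ler_pM2r// (le_trans (sge i)).
  by rewrite mulVf ?gt_eqF// => h; rewrite -mulrA [rho i * _]mulrC; lra.
have m0' : 0 < m%:R :> R by rewrite ltr0n.
pose pt (z : {ffun 'I_k -> 'I_m}) : 'rV[R]_k := \row_j ((z j)%:R / m%:R).
pose hit i j (x : 'I_m) : R := (`|x%:R / m%:R - c i ord0 j| < rho i)%R%:R.
(* A grid point lies in a cube exactly when the product of its coordinate indicators is 1; summed
   over the grid, this product factors over the coordinates. *)
have total : (m ^ k)%:R <=
      \sum_(z : {ffun 'I_k -> 'I_m}) \sum_i \prod_j hit i j (z j) :> R.
  rewrite -[k in (_ ^ k)%N]card_ord -[m in (m ^ _)%N]card_ord -card_ffun.
  rewrite -sum1_card natr_sum; apply: ler_sum => z _.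
  have [|i zi] := cover (pt z).
    move=> j; rewrite mxE divr_ge0//= ler_pdivrMr// mul1r ler_nat.
    exact/ltnW/ltn_ord.
  rewrite (bigD1 i)//= (_ : \prod_j _ = 1); last first.
    apply: big1 => j _; rewrite /hit (le_lt_trans _ zi)//.
    apply: le_trans (coord_le_norm _ j); by rewrite !mxE.
  by rewrite lerDl sumr_ge0// => i' _; rewrite prodr_ge0.
move: total; rewrite exchange_big /=.
rewrite (eq_bigr (fun i => \prod_j \sum_x hit i j x)); last first.
  by move=> i _; rewrite bigA_distr_bigA.
move=> /le_trans h; have : (m ^ k)%:R <= \sum_i (4 * rho i * m%:R) ^+ k.
  apply: h; apply: ler_sum => i _.
  rewrite -[k in _ ^+ k]card_ord -prodr_const; apply: ler_prod => j _.
  rewrite sumr_ge0//=; apply: le_trans (card_short_interval _ m0 (rho0 i)) _.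
  by have := mrho i; lra.
rewrite natrX (eq_bigr (fun i => (4 * rho i) ^+ k * m%:R ^+ k)); last first.
  by move=> i _; rewrite exprMn.
by rewrite -mulr_suml ler_pMl// exprn_gt0.
Qed.

End GridCounting.

Section ContentOuter.
Variables (R : realType) (n k : nat) (d : R).

HB.instance Definition _ := isOuterMeasure.Build R 'rV[R]_n
  (@hausdorff_content R n k d) (@hausdorff_content0 R n k d)
  (@hausdorff_content_ge0 R n k d) (@le_hausdorff_content R n k d)
  (@hausdorff_content_sigma_subadditive R n k d).

Lemma hausdorff_content_gauge (A : set 'rV[R]_n) : (diam A <= d%:E)%E ->
  (hausdorff_content k d A <= hausdorff_gauge k A)%E.
Proof.
move=> Ad; pose F (i : nat) : set 'rV[R]_n := if i is 0%N then A else set0.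
have -> : hausdorff_gauge k A = (\sum_(i <oo) hausdorff_gauge k (F i))%E.
  rewrite (@nneseries_split _ _ 0 1); last by move=> *; exact: hausdorff_gauge_ge0.
  rewrite big_nat1 /= eseries0 ?adde0// => -[|i] //= _ _.
  by rewrite /hausdorff_gauge eqxx.
apply: ereal_inf_lbound; exists F => //; split => [x Ax|[|i] //=].
  by exists 0%N.
by rewrite diam_set0 leNye.
Qed.

Lemma hausdorff_content_bigcup (I : finType) (F : I -> set 'rV[R]_n) :
  (hausdorff_content k d [set x | exists i, F i x] <=
   \sum_i hausdorff_content k d (F i))%E.
Proof.
apply: (@le_trans _ _ (hausdorff_content k d (\big[setU/set0]_i F i))).
  apply: le_hausdorff_content => x [i Fix].
  by rewrite (bigD1 i)//=; left.
elim/big_rec2: _ => [|i y A _ IH]; first by rewrite hausdorff_content0.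
apply: le_trans (outer_measureU2 (hausdorff_content k d :
  {outer_measure set 'rV[R]_n -> \bar R}) _ _) _.
by rewrite leeD2l.
Qed.

End ContentOuter.

Section Parametrization.
Variables (R : realType) (n k : nat).
Implicit Types (x y : 'rV[R]_n) (M : 'M[R]_(k, n)) (a b : 'rV[R]_k).

Definition param x0 M a : 'rV[R]_n := x0 + a *m M.

Definition hbox (l h : 'I_k -> R) : set 'rV[R]_k :=
  [set a | forall i, l i <= a ord0 i < h i].

Definition ucube : set 'rV[R]_k := hbox (fun=> 0) (fun=> 1).

Lemma paramB x0 M a b : param x0 M a - param x0 M b = (a - b) *m M.
Proof. by rewrite /param opprD addrACA subrr add0r mulmxBl. Qed.

Lemma mulmx_bound m p (N : 'M[R]_(m, p)) : exists C : R, 0 < C /\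
  forall a : 'rV[R]_m, `|a *m N| <= C * `|a|.
Proof.
exists (1 + \sum_i \sum_j `|N i j|); split.
  by rewrite ltr_wpDr// sumr_ge0// => i _; rewrite sumr_ge0.
move=> a; apply: rV_norm_le => [|j].
  by rewrite mulr_ge0// addr_ge0// sumr_ge0// => i _; rewrite sumr_ge0.
rewrite mxE mulrDl mul1r (le_trans (ler_norm_sum _ _ _))//.
apply: (@le_trans _ _ ((\sum_i \sum_j `|N i j|) * `|a|)).
  rewrite mulr_suml; apply: ler_sum => i _.
  rewrite normrM mulrC ler_pM ?coord_le_norm//.
  by rewrite (bigD1 j)//= lerDl sumr_ge0.
by rewrite lerDr.
Qed.

Lemma param_lipschitz x0 M : exists C : R, 0 < C /\
  forall a b, enorm (param x0 M a - param x0 M b) <= C * `|a - b|.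
Proof.
have [C [C0 hC]] := mulmx_bound M; exists (n.+1%:R * C); split.
  by rewrite mulr_gt0.
move=> a b; rewrite paramB (le_trans (enorm_le_mxnorm _))// -mulrA.
by rewrite ler_pM// ler_nat.
Qed.

(* Cells of side [1 / N] cover the unit cube and their gauges sum up to a
   quantity which does not depend on [N]. *)
Lemma unit_cube_finite x0 M :
  (hausdorff_outer k (param x0 M @` ucube) < +oo)%E.
Proof.
have [C [C0 hC]] := param_lipschitz x0 M.
pose w := unit_ball_volume R k / 2 ^+ k.
have w0 : 0 <= w by rewrite divr_ge0// unit_ball_volume_ge0.
suff h : (hausdorff_outer k (param x0 M @` ucube) <=
    (w * C ^+ k)%:E)%E by rewrite (le_lt_trans h) ?ltry.
apply: ge_ereal_sup => _ [d /= d0 <-].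
pose N := (Num.bound (C / d)).+1.
have N0 : 0 < N%:R :> R by rewrite ltr0n.
have CN : C / N%:R <= d.
  rewrite ler_pdivrMr// mulrC -ler_pdivrMr//.
  have := archi_boundP (divr_ge0 (ltW C0) (ltW d0)) => /ltW/le_trans; apply.
  by rewrite ler_nat.
pose cell (z : {ffun 'I_k -> 'I_N}) : set 'rV[R]_k :=
  hbox (fun i => (z i)%:R / N%:R) (fun i => (z i).+1%:R / N%:R).
have diam_cell z : (diam (param x0 M @` cell z) <= (C / N%:R)%:E)%E.
  apply: diam_le => _ _ [a az <-] [b bz <-]; rewrite lee_fin.
  apply: le_trans (hC _ _) _; rewrite ler_wpM2l ?(ltW C0)//.
  apply: rV_norm_le => [|i]; first by rewrite invr_ge0 ltW.
  have /andP[a1 a2] := az i; have /andP[b1 b2] := bz i.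
  rewrite !mxE; move: a2 b2; rewrite -natr1 mulrDl mul1r => a2 b2.
  by rewrite ler_norml; apply/andP; split; lra.
apply: (@le_trans _ _ (hausdorff_content k d
    [set x | exists z, (param x0 M @` cell z) x])).
  apply: le_hausdorff_content => _ [a ha <-].
  have idx (i : 'I_k) : exists z : 'I_N, z%:R / N%:R <= a ord0 i < z.+1%:R / N%:R.
    have /andP[a0 a1] := ha i.
    have aN0 : 0 <= a ord0 i * N%:R by rewrite mulr_ge0.
    have /andP[t1 t2] := truncn_itv aN0.
    have tN : (Num.truncn (a ord0 i * N%:R) < N)%N.
      rewrite -(ltr_nat R) (le_lt_trans t1)// -[ltRHS]mul1r ltr_pM2r//.
    by exists (Ordinal tN); rewrite ler_pdivrMr// ltr_pdivlMr//= t1 t2.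
  have [z hz] := choice idx; exists [ffun i => z i]; exists a => // i.
  by rewrite ffunE.
apply: le_trans (hausdorff_content_bigcup _ _ _) _.
apply: (@le_trans _ _ (\sum_(z : {ffun 'I_k -> 'I_N}) (w * (C / N%:R) ^+ k)%:E)%E).
  apply: lee_sum => z _; apply: le_trans (hausdorff_content_gauge _ _) _.
    by apply: le_trans (diam_cell z) _; rewrite lee_fin.
  rewrite /hausdorff_gauge; case: ifPn => z0.
    by rewrite lee_fin mulr_ge0// exprn_ge0// divr_ge0// ltW.
  by rewrite -/w [leRHS]EFinM lee_wpmul2l ?lee_fin// EFin_expe le_expe// diam_ge0.
rewrite sumEFin sumr_const card_ffun !card_ord lee_fin -[leLHS]mulr_natr natrX.
by rewrite -mulrA -exprMn divfK ?gt_eqF.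
Qed.

End Parametrization.

Section CubePositive.
Variables (R : realType) (n k : nat).
Implicit Types (x y : 'rV[R]_n) (M : 'M[R]_(k.+1, n)) (a b : 'rV[R]_k.+1).

(** The pseudo-inverse makes the inverse chart defined and Lipschitz on the whole ambient space, not
    only on the range of the chart. *)
Definition unparam x0 M y : 'rV[R]_k.+1 := (y - x0) *m pinvmx M.

Lemma paramK x0 M : row_free M -> cancel (param x0 M) (unparam x0 M).
Proof. by move=> fM a; rewrite /unparam /param addrAC subrr add0r mulmxKp. Qed.

Lemma unparam_lipschitz x0 M : exists C : R, 0 < C /\
  forall x y, `|unparam x0 M x - unparam x0 M y| <= C * enorm (x - y).
Proof.
have [C [C0 hC]] := mulmx_bound (pinvmx M); exists C; split=> // x y.
rewrite /unparam -mulmxBl opprB addrA subrK (le_trans (hC _))//.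
by rewrite ler_pM2l// mxnorm_le_enorm.
Qed.

Lemma unit_ball_volume_gt0 m : 0 < unit_ball_volume R m.
Proof.
have [N] := ubnP m; elim: N m => // N IH [|[|m]]//= mN.
by rewrite mulr_gt0 ?divr_gt0 ?mulr_gt0 ?pi_gt0 ?IH// -ltnS ltnW.
Qed.

Lemma exprD_le (u v : R) m : 0 <= u -> 0 <= v ->
  (u + v) ^+ m <= 2 ^+ m * (u ^+ m + v ^+ m).
Proof.
move=> u0 v0; have um : 0 <= u ^+ m by rewrite exprn_ge0.
have vm : 0 <= v ^+ m by rewrite exprn_ge0.
have [uv|vu] := leP u v.
  apply: (@le_trans _ _ (2 ^+ m * v ^+ m)).
    rewrite -exprMn lerXn2r ?nnegrE ?addr_ge0 ?mulr_ge0//.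
    by rewrite mulr_natl mulr2n lerD2r.
  by rewrite ler_pM2l ?exprn_gt0// lerDr.
apply: (@le_trans _ _ (2 ^+ m * u ^+ m)).
  rewrite -exprMn lerXn2r ?nnegrE ?addr_ge0 ?mulr_ge0//.
  by rewrite mulr_natl mulr2n lerD2l ltW.
by rewrite ler_pM2l ?exprn_gt0// lerDl.
Qed.

(** Were the measure zero, the cube would be covered by sets with an arbitrarily small sum of powers
    of diameters. In the chart each lies in an open ball of comparable radius; compactness leaves
    finitely many balls, against the counting bound. *)
Lemma closed_unit_cube_positive x0 M : row_free M ->
  (0 < hausdorff_outer k.+1
    (param x0 M @` [set a : 'rV[R]_k.+1 | forall j, (0 <= a ord0 j <= 1)%R]))%E.
Proof.
move=> fM; set Q := [set a : 'rV[R]_k.+1 | _].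
rewrite lt0e hausdorff_outer_ge0 andbT; apply/eqP => H0.
have [C [C0 hC]] := unparam_lipschitz x0 M.
pose w := unit_ball_volume R k.+1 / 2 ^+ k.+1.
have w0 : 0 < w by rewrite divr_gt0 ?unit_ball_volume_gt0// exprn_gt0.
(* Chosen so that the finite sum to be contradicted is at most [D * e = 1 / 2]; the factor 8 is the
   4 of the counting bound times the 2 lost when a power of [C * dm i + eta i] is split. *)
pose D := 8 ^+ k.+1 * (C ^+ k.+1 / w + 1).
have D0 : 0 < D.
  by rewrite mulr_gt0 ?exprn_gt0// ltr_wpDl// divr_ge0 ?exprn_ge0// ltW.
pose e := (2 * D)^-1.
have e0 : 0 < e by rewrite invr_gt0 mulr_gt0.
have content0 : hausdorff_content k.+1 1 (param x0 M @` Q) = 0%E.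
  apply/eqP; rewrite eq_le hausdorff_content_ge0 andbT -H0.
  by apply: ereal_sup_ubound; exists 1 => //=; exact: ltr01.
move: content0; rewrite /hausdorff_content; set S := (X in ereal_inf X) => S0.
have Sfin : ereal_inf S \is a fin_num by rewrite S0.
have [_ [F [QF Fd] <-]] := lb_ereal_inf_adherent e0 Sfin.
rewrite S0 add0e => Fe {S S0 Sfin}.
(* The diameter of the empty set is [-oo], hence the separate value 0. *)
pose dm i := if F i == set0 then 0 else fine (diam (F i)).
have dmE i : F i != set0 -> (dm i)%:E = diam (F i).
  move=> Fi; rewrite /dm (negbTE Fi) fineK// ge0_fin_numE ?diam_ge0//.
  by rewrite (le_lt_trans (Fd i))// ltry.
have dm0 i : 0 <= dm i.
  rewrite /dm; case: ifPn => // Fi; by rewrite fine_ge0// diam_ge0.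
have gaugeE i : hausdorff_gauge k.+1 (F i) = (w * dm i ^+ k.+1)%:E.
  rewrite /hausdorff_gauge /w; have [Fi0|Fi] := ifPn.
    by rewrite /dm Fi0 expr0n mulr0.
  by rewrite -dmE// -EFin_expe -EFinM.
have gsum N : \sum_(i < N) dm i ^+ k.+1 <= e / w.
  rewrite ler_pdivlMr// mulrC mulr_sumr -lee_fin -sumEFin.
  apply: le_trans (ltW Fe).
  rewrite (eq_bigr (fun i : 'I_N => hausdorff_gauge k.+1 (F i))); last first.
    by move=> i _; rewrite gaugeE.
  rewrite -(big_mkord xpredT (fun i => hausdorff_gauge k.+1 (F i))).
  by apply: nneseries_lim_ge => i _ _; exact: hausdorff_gauge_ge0.
(* Slack making every radius positive, even around a single point, with total at most [e]. *)
pose eta (i : nat) : R := e / 2 ^+ i.+1.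
have eta0 i : 0 < eta i by rewrite divr_gt0 ?exprn_gt0.
have etasum N : \sum_(i < N) eta i <= e.
  suff -> : \sum_(i < N) eta i = e * (1 - 1 / 2 ^+ N).
    by rewrite ler_piMr ?(ltW e0)// gerBl divr_ge0 ?exprn_ge0.
  elim: N => [|N IH]; first by rewrite big_ord0 expr0 divr1 subrr mulr0.
  rewrite big_ord_recr/= IH /eta exprS.
  have : (2 : R) ^+ N != 0 by rewrite expf_neq0.
  by move=> h; field.
pose p i := if pselect (F i !=set0) is left Fi then unparam x0 M (projT1 (cid Fi)) else 0.
pose rho i := C * dm i + eta i.
have rho0 i : 0 < rho i by rewrite ltr_wpDl// mulr_ge0// ltW.
have cov : Q `<=` \bigcup_i ball (p i) (rho i).
  move=> a Qa; have [i _ Fia] : (\bigcup_i F i) (param x0 M a) by apply: QF; exists a.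
  exists i => //; rewrite -ball_normE /=.
  rewrite /p; case: pselect => [Fi|[]]; last by exists (param x0 M a).
  case: (cid Fi) => /= y Fy.
  rewrite -{1}(paramK x0 fM a) (le_lt_trans (hC _ _))// /rho.
  rewrite ltr_pwDr// ler_pM2l// -lee_fin dmE ?enorm_le_diam//.
  by apply/set0P; exists y.
have Qcompact : compact Q.
  pose A (i : 'I_k.+1) : set R := `[0, 1]%classic.
  have := @rV_compact R k.+1 A (fun i => @segment_compact _ _ _).
  congr compact; apply/seteqP; split => a /= h j; have := h j; rewrite /A /= in_itv//.
rewrite compact_cover in Qcompact.
have [i _||D' _ cov'] := Qcompact nat setT (fun i => ball (p i) (rho i)).
- exact: ball_open.
- exact: cov.
pose N := (\max_(i <- finmap.enum_fset D') i).+1.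
have : 1 <= \sum_(i < N) (4 * rho i) ^+ k.+1.
  apply: (@cube_cover_sum R k.+1 N (fun i => p i) (fun i => rho i)) => [i|a Qa].
    exact: rho0.
  have [i Di] := cov' a Qa.
  have iN : (i < N)%N by rewrite ltnS; apply: leq_bigmax_seq.
  by rewrite -ball_normE /= distrC => h; exists (Ordinal iN).
apply/negP; rewrite -ltNge.
apply: (@le_lt_trans _ _ (D * e)); last first.
  by rewrite /e invfM mulrCA divff ?gt_eqF// mulr1 invf_lt1 ?ltr1n.
have rho_le i : (4 * rho i) ^+ k.+1 <=
    8 ^+ k.+1 * (C ^+ k.+1 * dm i ^+ k.+1 + eta i).
  have e1 : e <= 1.
    have : 1 <= D.
      rewrite /D -[leLHS]mulr1 ler_pM// ?exprn_ege1 ?ler1n//.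
      by rewrite lerDr divr_ge0 ?exprn_ge0// ltW.
    move=> D1; have D2 : 0 < 2 * D by rewrite mulr_gt0.
    by rewrite (invf_le1 D2) (le_trans D1)// ler_peMl ?(ltW D0)// ler1n.
  have eta1 : eta i <= 1.
    by rewrite ler_pdivrMr ?exprn_gt0// mul1r (le_trans e1)// exprn_ege1// ler1n.
  have etaX : eta i ^+ k.+1 <= eta i.
    by rewrite exprS ler_piMr ?exprn_ile1// ltW.
  have x0' : 0 <= C * dm i by rewrite mulr_ge0// ltW.
  apply: (@le_trans _ _ (8 ^+ k.+1 * ((C * dm i) ^+ k.+1 + eta i ^+ k.+1))).
    rewrite exprMn (_ : 8 = 4 * 2 :> R); last by ring.
    rewrite [(4 * 2) ^+ _]exprMn -mulrA ler_pM2l ?exprn_gt0//.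
    by rewrite exprD_le// ltW.
  by rewrite exprMn ler_pM2l ?exprn_gt0// lerD2l.
apply: (@le_trans _ _ (\sum_(i < N)
    8 ^+ k.+1 * (C ^+ k.+1 * dm i ^+ k.+1 + eta i))).
  by apply: ler_sum => i _; exact: rho_le.
rewrite -mulr_sumr big_split/= -mulr_sumr /D -mulrA ler_pM2l ?exprn_gt0//.
rewrite mulrDl mul1r lerD ?etasum//.
by rewrite -mulrA ler_pM2l ?exprn_gt0// mulrC gsum.
Qed.

End CubePositive.

(** Cauchy's equation: nonnegativity makes [g] monotone, and comparing [m * x] with its integer part
    bounds the distance of [g x] to [x * g 1] by [g 1 / m] for every [m > 0]. *)
Lemma additive_linear (R : realType) (g : R -> R) :
  (forall x, 0 <= x -> 0 <= g x) ->
  (forall x y, 0 <= x -> 0 <= y -> g (x + y) = g x + g y) ->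
  forall x, 0 <= x -> g x = x * g 1.
Proof.
move=> g0 gD x x0.
have mono u v : 0 <= u -> u <= v -> g u <= g v.
  by move=> u0 uv; rewrite -(subrKC u v) gD ?subr_ge0// lerDl g0 ?subr_ge0.
have gn y m : 0 <= y -> g (m%:R * y) = m%:R * g y.
  move=> y0; elim: m => [|m IH].
    have := gD 0 0 (lexx _) (lexx _); rewrite addr0 !mul0r => h; lra.
  by rewrite -!natr1 !mulrDl !mul1r gD ?mulr_ge0// IH.
have close m : m%:R * `|g x - x * g 1| <= g 1.
  have mx0 : 0 <= m%:R * x by rewrite mulr_ge0.
  have /andP[t1 t2] := truncn_itv mx0.
  set t := Num.truncn _ in t1 t2.
  have h1 : t%:R * g 1 <= m%:R * g x.
    by rewrite -gn// -gn// mulr1 mono.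
  have h2 : m%:R * g x <= t%:R * g 1 + g 1.
    rewrite -[X in _ + X]mul1r -mulrDl natr1 -gn// -gn// mulr1 mono//.
    exact: ltW.
  have g1 := g0 1 ler01.
  have h3 : t%:R * g 1 <= m%:R * x * g 1 by rewrite ler_wpM2r.
  have h4 : m%:R * x * g 1 <= t%:R * g 1 + g 1.
    rewrite -[X in _ + X]mul1r -mulrDl natr1 ler_wpM2r//.
    exact: ltW.
  rewrite -[m%:R in leLHS]ger0_norm// -normrM ler_norml mulrBr.
  by apply/andP; split; lra.
apply/eqP; rewrite -subr_eq0 -normr_eq0; apply/eqP/le_anti.
rewrite normr_ge0 andbT leNgt; apply/negP => e0.
have := archi_boundP (divr_ge0 (g0 1 ler01) (ltW e0)).
by rewrite ltr_pdivrMr// ltNge close.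
Qed.

(** * Measure of the image of a box under a chart *)

Section BoxMeasure.
Variables (R : realType) (n k : nat) (x0 : 'rV[R]_n) (M : 'M[R]_(k.+1, n)).
Hypothesis fM : row_free M.
Implicit Types (l h s : 'I_k.+1 -> R) (a b : 'rV[R]_k.+1) (i : 'I_k.+1).

Local Notation cara := (caratheodory_type (@hausdorff_outer R n k.+1)).
Local Notation H := (@hausdorff_outer R n k.+1).
Local Notation phi := (param x0 M).

(** The range of the chart is the set of points fixed by [unparam] followed by [phi]; this and the
    coordinate bounds are expressed by sublevel sets of Lipschitz functions on the whole space. *)
Lemma param_hbox_measurable l h : measurable (phi @` hbox l h : set cara).
Proof.
have [C [C0 hC]] := unparam_lipschitz x0 M.
have [C' [C'0 hC']] := param_lipschitz x0 M.
pose L i : set cara := [set y | l i - unparam x0 M y ord0 i <= 0].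
pose U i : set cara := [set y | h i - unparam x0 M y ord0 i <= 0].
pose E : set cara := [set y | enorm (phi (unparam x0 M y) - y) <= 0].
have coordC (t : 'I_k.+1 -> R) i : measurable
    ([set y | t i - unparam x0 M y ord0 i <= 0] : set cara).
  apply: (@lipschitz_sublevel_measurable R n k.+1
    (fun y => t i - unparam x0 M y ord0 i) C) => // x y.
  rewrite opprB addrC addrA subrK -normrN opprB.
  apply: le_trans (hC _ _); have := coord_le_norm (unparam x0 M x - unparam x0 M y) i.
  by rewrite !mxE.
have mE : measurable E.
  apply: (@lipschitz_sublevel_measurable R n k.+1
    (fun y => enorm (phi (unparam x0 M y) - y)) (C' * C + 1)).
    by rewrite addr_gt0 ?mulr_gt0.
  move=> x y; apply: le_trans (ler_enorm_dist _ _) _.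
  rewrite opprD opprK addrACA -{2}(opprK y) -opprD.
  apply: le_trans (ler_enormD _ _) _; rewrite enormN mulrDl mul1r lerD2r.
  by apply: le_trans (hC' _ _) _; rewrite -mulrA ler_pM2l.
rewrite (_ : _ @` _ = E `&` \bigcap_(i in [set: 'I_k.+1]) (L i `\` U i)).
  apply: measurableI => //; apply: fin_bigcap_measurable => [|i _].
    exact: finite_finset.
  by apply: measurableD; exact: coordC.
apply/seteqP; split => [_ [a ha <-]|y [Ey hy]].
  split; first by rewrite /E/= paramK// subrr enorm0.
  move=> i _; rewrite /L /U /= paramK//; have /andP[a1 a2] := ha i.
  split; first by rewrite subr_le0.
  by apply/negP; rewrite -ltNge subr_gt0.
have yE : phi (unparam x0 M y) = y.
  apply/eqP; rewrite -subr_eq0 -enorm_eq0; apply/eqP/le_anti.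
  by rewrite Ey enorm_ge0.
exists (unparam x0 M y) => // i; have [] := hy i Logic.I; rewrite /L /U /=.
by rewrite subr_le0 => -> /negP; rewrite -ltNge subr_gt0 => ->.
Qed.

Lemma param_hbox_translate b l h :
  H (phi @` hbox (fun i => b ord0 i + l i) (fun i => b ord0 i + h i)) =
  H (phi @` hbox l h).
Proof.
rewrite -(@hausdorff_outer_isometry _ n k.+1 (fun y => b *m M + y)
  (fun y => - (b *m M) + y) (phi @` hbox l h)); first last.
- by move=> y; rewrite addNKr.
- by move=> y; rewrite addKr.
- by move=> y z; rewrite opprD addrACA subrr add0r.
congr H; apply/seteqP; split => [_ [a ha <-]|_ [_ [a ha <-] <-]].
  exists (phi (a - b)).
    exists (a - b) => // i; rewrite !mxE; have /andP[h1 h2] := ha i.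
    by rewrite lerBrDl h1 ltrBlDl.
  by rewrite /param mulmxBl addrCA subrKC.
exists (b + a) => [i|]; last by rewrite /param mulmxDl addrCA.
by rewrite !mxE lerD2l ltrD2l.
Qed.

Lemma param_hbox_split l h i t : l i <= t -> t <= h i ->
  (H (phi @` hbox l h) = H (phi @` hbox l (upd h i t)) +
                         H (phi @` hbox (upd l i t) h))%E.
Proof.
move=> lt th.
pose mu := hausdorff_measure R n k.+1.
rewrite -[H (_ @` hbox l (upd h i t))]/(mu _) -[H (_ @` hbox (upd l i t) h)]/(mu _).
rewrite -measureU; [|exact: param_hbox_measurable|exact: param_hbox_measurable|].
  rewrite -image_setU; congr (H (_ @` _)).
  apply/seteqP; split => [a ha|a [ha|ha] j].
  - have [at_|ta] := ltP (a ord0 i) t; [left|right] => j; rewrite /upd.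
      by case: eqP => [->|_]; [case/andP: (ha i) => -> _|exact: ha].
    by case: eqP => [->|_]; [case/andP: (ha i) => _ ->; rewrite ta|exact: ha].
  - have /andP[a1] := ha j; rewrite /upd a1 /=; case: eqP => // -> a2.
    exact: lt_le_trans a2 th.
  - have /andP[+ a2] := ha j; rewrite /upd a2 andbT; case: eqP => // -> a1.
    exact: le_trans lt a1.
apply/seteqP; split => // _ [[a ha <-] [b hb /(can_inj (paramK x0 fM)) ab]].
have := ha i; have := hb i; rewrite ab /upd eqxx => /andP[h1 _] /andP[_ h2].
by have := le_lt_trans h1 h2; rewrite ltxx.
Qed.

(** The exact value is never computed: finiteness and positivity are enough, since both integrals
    carry the same factor. *)
Definition box_density : R := fine (H (phi @` @ucube R k.+1)).

Let f s : \bar R := H (phi @` hbox (fun=> 0) s).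

Let f_finite s : (f s < +oo)%E.
Proof.
pose B := 1 + \sum_i `|s i|.
have B0 : 0 < B by rewrite ltr_wpDr// sumr_ge0.
apply: le_lt_trans (unit_cube_finite x0 (B *: M)).
apply: le_hausdorff_outer => _ [a ha <-]; exists (B^-1 *: a).
  move=> i; have /andP[a1 a2] := ha i; rewrite mxE mulr_ge0 ?invr_ge0 ?(ltW B0)//=.
  rewrite mulrC ltr_pdivrMr// mul1r (lt_le_trans a2)//.
  rewrite (le_trans (ler_norm _))// /B (bigD1 i)//= addrCA lerDl.
  by rewrite addr_ge0// sumr_ge0.
by rewrite /param -scalemxAr -scalemxAl scalerA divff ?gt_eqF// scale1r.
Qed.

Let f_fin_num s : f s \is a fin_num.
Proof. by rewrite ge0_fin_numE ?hausdorff_outer_ge0. Qed.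

Let f_add s i u v : 0 <= u -> 0 <= v ->
  f (upd s i (u + v)) = (f (upd s i u) + f (upd s i v))%E.
Proof.
move=> u0 v0; rewrite /f (@param_hbox_split _ _ i u)//; last first.
  by rewrite /upd eqxx lerDl.
congr (_ + _)%E.
  by congr (H (_ @` hbox _ _)); apply/funext => j; rewrite /upd; case: eqP.
rewrite -[RHS](param_hbox_translate (u *: delta_mx ord0 i)).
congr (H (_ @` hbox _ _)); apply/funext => j; rewrite /upd !mxE eqxx /=;
  by case: eqP => _; rewrite ?mulr1 ?mulr0 ?add0r ?addr0.
Qed.

Let f_coord s i : 0 <= s i ->
  fine (f s) = s i * fine (f (upd s i 1)).
Proof.
move=> si0; pose g u := fine (f (upd s i u)).
rewrite -[RHS](@additive_linear _ g) //.
- rewrite /g; congr (fine (f _)); apply/funext => j; rewrite /upd.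
  by case: eqP => [->|].
- by move=> u _; rewrite fine_ge0// hausdorff_outer_ge0.
- by move=> u v u0 v0; rewrite /g f_add// fineD.
Qed.

(** Translation reduces to a box at the origin, whose measure is additive and hence linear in each
    side. In [tr m] the first [m] sides have already been normalised to 1. *)
Lemma param_hbox_volume l h : (forall i, l i <= h i) ->
  H (phi @` hbox l h) = (box_density * \prod_i (h i - l i))%:E.
Proof.
move=> lh; pose s i := h i - l i.
have -> : H (phi @` hbox l h) = f s.
  rewrite /f -[RHS](param_hbox_translate (\row_i l i)).
  congr (H (_ @` hbox _ _)); apply/funext => i; rewrite mxE.
    by rewrite addr0.
  by rewrite /s subrKC.
rewrite -[LHS](fineK (f_fin_num s)); congr EFin.
have s0 i : 0 <= s i by rewrite subr_ge0.
pose tr m (i : 'I_k.+1) : R := if (i < m)%N then 1 else s i.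
have step m : (m <= k.+1)%N ->
    fine (f s) = (\prod_(i < k.+1 | (i < m)%N) s i) * fine (f (tr m)).
  elim: m => [|m IH] mk; first by rewrite big_pred0_eq mul1r.
  rewrite IH ?(ltnW mk)//; pose i := Ordinal mk.
  rewrite (@f_coord (tr m) i); last by rewrite /tr ltnn.
  rewrite mulrA; congr (_ * fine (f _)); last first.
    by apply/funext => j; rewrite /upd /tr ltnS -val_eqE /=; case: ltngtP.
  rewrite [RHS](bigD1 i)//= mulrC /tr ltnn; congr (_ * _).
  by apply: eq_bigl => j; rewrite ltnS -val_eqE /=; case: ltngtP.
rewrite (step k.+1)// mulrC; congr (_ * _).
  rewrite /box_density /f; congr (fine (H (_ @` hbox _ _))).
  by apply/funext => i; rewrite /tr ltn_ord.
by apply: eq_bigl => i; rewrite ltn_ord.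
Qed.

(** Positivity is known for the closed cube, which fits into the half-open one after scaling by
    1/2. *)
Lemma box_density_gt0 : 0 < box_density.
Proof.
have fM' : row_free (2^-1 *: M) by rewrite /row_free mxrank_scale_nz.
have := closed_unit_cube_positive x0 fM'.
set Q := [set a : 'rV[R]_k.+1 | _] => pos.
rewrite /box_density fine_gt0//; apply/andP; split; last exact: unit_cube_finite.
apply: lt_le_trans pos _; apply: le_hausdorff_outer => _ [a ha <-].
exists (2^-1 *: a) => [i|].
  have /andP[a1 a2] := ha i; rewrite mxE mulr_ge0//=.
  by rewrite mulrC ltr_pdivrMr// mul1r; lra.
by rewrite /param -scalemxAr -scalemxAl.
Qed.

End BoxMeasure.

(** * The integral inequality *)

Section Darboux.
Variables (R : realType) (n k : nat) (x0 : 'rV[R]_n) (M : 'M[R]_(k.+1, n)).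
Hypothesis fM : row_free M.
Implicit Types (b c : wbox R k.+1) (s : seq (wbox R k.+1)).

Local Notation H := (@hausdorff_outer R n k.+1).
Local Notation hmeas := (@hmeasurable R n k.+1).
Local Notation hint := (@hint R n k.+1).
Local Notation phi := (param x0 M).
Local Notation dens := (box_density x0 M).

Definition bset b : set 'rV[R]_k.+1 := hbox (lo b) (hi b).

Definition bimg b : set 'rV[R]_n := phi @` bset b.

Lemma bset_sub b c : subbox b c -> bset b `<=` bset c.
Proof.
move=> /andP[_ /forallP bc] a ab i; have /andP[h1 h2] := bc i.
by have /andP[h3 h4] := ab i; rewrite (le_trans h1 h3) (lt_le_trans h4 h2).
Qed.

Lemma bset_sep b c : sepbox b c -> forall a, bset b a -> bset c a -> False.
Proof.
move=> /existsP[i bc] a /(_ i)/andP[h1 h2] /(_ i)/andP[h3 h4].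
case/orP: bc => h.
  by have := lt_le_trans h2 (le_trans h h3); rewrite ltxx.
by have := lt_le_trans h4 (le_trans h h1); rewrite ltxx.
Qed.

Lemma bimg_measurable b : hmeas (bimg b).
Proof. exact: param_hbox_measurable. Qed.

Lemma bimg_vol b : wfbox b -> H (bimg b) = (dens * vol b)%:E.
Proof. by move=> /forallP wf; apply: param_hbox_volume => // i; exact: ltW. Qed.

Lemma bimg_disjoint b c : sepbox b c -> bimg b `&` bimg c = set0.
Proof.
move=> bc; apply/seteqP; split => // _ [[a ab <-] [a' a'c]].
move=> /(can_inj (paramK x0 fM)) aa'; rewrite aa' in a'c.
exact: bset_sep bc _ ab a'c.
Qed.

Definition bunion s : set 'rV[R]_n := \big[setU/set0]_(b <- s) bimg b.

Lemma bunion_measurable s : hmeas (bunion s).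
Proof.
rewrite /bunion; elim/big_rec: _ => [|b A _ mA]; first exact: hmeasurable0.
by apply: hmeasurableU => //; exact: bimg_measurable.
Qed.

Lemma bunion_le s : all (@wfbox R k.+1) s ->
  (H (bunion s) <= (dens * \sum_(b <- s) vol b)%:E)%E.
Proof.
rewrite /bunion; elim: s => [|b s IH] /=.
  by rewrite !big_nil hausdorff_outer0 mulr0.
move=> /andP[wb ws]; rewrite !big_cons mulrDr EFinD -bimg_vol//.
apply: le_trans (outer_measureU2 (H : {outer_measure set 'rV[R]_n -> \bar R}) _ _) _.
by rewrite leeD2l// IH.
Qed.

Lemma bunion_notin b s : all (sepbox b) s ->
  forall x, bunion s x -> ~ bimg b x.
Proof.
rewrite /bunion => + x + bx; elim: s => [|c s IH] /=; first by rewrite big_nil.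
move=> /andP[bc bs]; rewrite big_cons => -[cx|]; last exact: IH.
by have : (bimg b `&` bimg c) x by []; rewrite bimg_disjoint.
Qed.

Lemma bunion_ge s (K : set 'rV[R]_n) :
  hmeas K -> all (@wfbox R k.+1) s ->
  pairwise (@sepbox R k.+1) s -> bunion s `<=` K ->
  ((dens * \sum_(b <- s) vol b)%:E <= H K)%E.
Proof.
rewrite /bunion; elim: s K => [|b s IH] K mK /=.
  by move=> _ _ _; rewrite big_nil mulr0 hausdorff_outer_ge0.
move=> /andP[wb ws] /andP[bs ss]; rewrite !big_cons => sK.
have bK : bimg b `<=` K by move=> x bx; apply: sK; left.
have mb := bimg_measurable b.
rewrite (hausdorff_outer_setD mK mb bK).
rewrite mulrDr EFinD -bimg_vol// leeD2l// IH//; first exact: hmeasurableD.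
move=> x sx; split; first by apply: sK; right.
exact: bunion_notin bs _ sx.
Qed.

Variable h : 'rV[R]_n -> R.
Hypotheses (ch : continuous h) (h0 : forall x, 0 <= h x).

(** Weights may be negative whereas [h] is not, hence the truncation. The condition
    [has (subbox b) s] plays the part of membership, boxes having no decidable equality, and it
    passes to pieces of boxes. *)
Lemma hint_ge_boxes s (L : set 'rV[R]_n) : hmeas L ->
  all (@wfbox R k.+1) s -> pairwise (@sepbox R k.+1) s ->
  (forall b, has (subbox b) s -> forall a, bset b a ->
    L (phi a) /\ wt b <= h (phi a)) ->
  ((dens * \sum_(b <- s) vol b * Num.max 0 (wt b))%:E <= hint h L)%E.
Proof.
elim: s L => [|b s IH] L mL /=.
  by move=> _ _ _; rewrite big_nil mulr0 hint_ge0.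
move=> /andP[wb ws] /andP[bs ss] good.
have gb := good b; rewrite subbox_refl /= in gb.
have bL : bimg b `<=` L by move=> _ [a ab <-]; have [] := gb isT a ab.
have mb := bimg_measurable b.
rewrite (hint_setD ch h0 mL mb bL) big_cons mulrDr EFinD leeD//.
  rewrite mulrA mulrC EFinM -bimg_vol// hint_ge_cst ?le_max ?lexx//.
  by move=> _ [a ab <-]; rewrite ge_max h0; have [] := gb isT a ab.
apply: IH => //; first exact: hmeasurableD.
move=> c cs a ac; have [|h1 h2] := good c _ a ac; first by rewrite cs orbT.
split => //; split => // -[a' a'b /(can_inj (paramK x0 fM)) aa'].
rewrite aa' in a'b.
have bc : sepbox b c.
  elim: s bs cs {ws ss good} => //= d s IH /andP[bd bs] /orP[cd|cs].
    by apply: sepbox_sub bd => //; exact: subbox_refl.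
  exact: IH.
exact: bset_sep bc _ a'b ac.
Qed.

Lemma hint_le_boxes s (K : set 'rV[R]_n) (B : R) : hmeas K ->
  all (@wfbox R k.+1) s -> pairwise (@sepbox R k.+1) s -> bunion s `<=` K ->
  (forall x, K x -> h x <= B) ->
  (forall b, has (subbox b) s -> forall a, bset b a -> h (phi a) <= wt b) ->
  (hint h K <=
   (dens * \sum_(b <- s) vol b * wt b)%:E + B%:E * H (K `\` bunion s))%E.
Proof.
elim: s K => [|b s IH] K mK /=.
  move=> _ _ _ hB _; rewrite big_nil mulr0 add0e /bunion big_nil setD0.
  exact: hint_le_cst.
move=> /andP[wb ws] /andP[bs ss]; rewrite /bunion !big_cons => sK hB good.
have gb := good b; rewrite subbox_refl /= in gb.
have bK : bimg b `<=` K by move=> x bx; apply: sK; left.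
have mb := bimg_measurable b.
rewrite (hint_setD ch h0 mK mb bK) mulrDr EFinD -[leRHS]addeA leeD//.
  rewrite mulrA mulrC EFinM -bimg_vol// hint_le_cst//.
  by move=> _ [a ab <-]; rewrite gb.
rewrite -setDDl; apply: IH => //.
- exact: hmeasurableD.
- move=> x sx; split; first by apply: sK; right.
  exact: bunion_notin bs _ sx.
- by move=> x [Kx _]; exact: hB.
- by move=> c cs; apply: good; rewrite cs orbT.
Qed.

End Darboux.

(** On the compact set of pairs whose values differ by at least [e], the distance of the two points
    has a positive minimum, which serves as [d]. *)
Lemma compact_unif_continuous (R : realType) m (A : set 'rV[R]_m.+1)
    (psi : 'rV[R]_m.+1 -> R) (e : R) :
  compact A -> continuous psi -> 0 < e ->
  exists2 d : R, 0 < d & forall a b, A a -> A b -> `|a - b| < d ->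
    `|psi a - psi b| < e.
Proof.
move=> cA cpsi e0.
pose T := ('rV[R]_m.+1 * 'rV[R]_m.+1)%type.
pose g (p : T) : R := `|psi p.1 - psi p.2|.
pose f (p : T) : R := `|p.1 - p.2|.
have cg : continuous g.
  move=> p; apply: cvg_norm; apply: cvgB.
    by apply: continuous_comp; [exact: cvg_fst|exact: cpsi].
  by apply: continuous_comp; [exact: cvg_snd|exact: cpsi].
have cf : continuous f.
  by move=> p; apply: cvg_norm; apply: cvgB; [exact: cvg_fst|exact: cvg_snd].
pose S := (A `*` A) `&` (g @^-1` [set x | e <= x]).
have cS : compact S.
  apply: compact_closedI; first exact: compact_setX.
  by apply: preimage_closed => //; exact: closed_ge.
have [S0|S0] := pselect (S !=set0); last first.
  exists 1 => // a b Aa Ab _; rewrite ltNge; apply/negP => h.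
  by apply: S0; exists (a, b).
have [c cS' cmin] := compact_EVT_min S0 cS (continuous_subspaceT cf).
move: cS'; rewrite inE => -[_ ec].
exists (f c) => [|a b Aa Ab ab].
  rewrite lt_def normr_ge0 andbT normr_eq0 subr_eq0; apply/eqP => c12.
  by move: ec; rewrite /g/= c12 subrr normr0 leNgt e0.
rewrite ltNge; apply/negP => h.
have := cmin (a, b); rewrite inE => /(_ (conj (conj Aa Ab) h)).
by rewrite leNgt ab.
Qed.

(** * Inner approximation of a body by grid cells *)

Section Grid.
Variables (R : realType) (n k : nat) (x0 : 'rV[R]_n) (M : 'M[R]_(k.+1, n)).
Hypothesis fM : row_free M.
Variables (K : set 'rV[R]_n) (rho B : R).
Local Notation H := (@hausdorff_outer R n k.+1).
Local Notation phi := (param x0 M).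
Hypotheses (rho0 : 0 < rho) (B0 : 0 < B)
  (convK : forall x y t, K x -> K y -> 0 <= t -> t <= 1 ->
     K (t *: x + (1 - t) *: y))
  (innerK : forall a, `|a| <= rho -> K (phi a))
  (boundK : forall y, K y -> exists2 a, `|a| <= B & phi a = y).
Implicit Types (a : 'rV[R]_k.+1) (b c : wbox R k.+1) (s : seq (wbox R k.+1)).

Lemma param_convex a a' t :
  phi (t *: a + (1 - t) *: a') = t *: phi a + (1 - t) *: phi a'.
Proof.
rewrite /param mulmxDl -!scalemxAl !scalerDr addrACA -scalerDl subrKC.
by rewrite scale1r.
Qed.

(** The point [a'] is a convex combination of [a] and a point of the inner ball of radius [rho]. *)
Lemma shrink_neighborhood a a' t : 0 <= t -> t < 1 -> K (phi a) ->
  `|a' - t *: a| <= (1 - t) * rho -> K (phi a').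
Proof.
move=> t0 t1 Ka aa'; have t1' : 0 < 1 - t by rewrite subr_gt0.
have -> : a' = t *: a + (1 - t) *: ((1 - t)^-1 *: (a' - t *: a)).
  by rewrite scalerA divff ?gt_eqF// scale1r subrKC.
rewrite param_convex; apply: convK => //; last exact: ltW.
apply: innerK; rewrite normrZ gtr0_norm ?invr_gt0// mulrC ler_pdivrMr//.
by rewrite mulrC.
Qed.

Lemma param_bounded a : K (phi a) -> `|a| <= B.
Proof.
by move=> /boundK[a' a'B /(can_inj (paramK x0 fM)) <-].
Qed.

Definition closedbox b a := forall i, lo b i <= a ord0 i <= hi b i.

Lemma bset_closedbox b a : bset b a -> closedbox b a.
Proof. by move=> ab i; have /andP[-> /ltW ->] := ab i. Qed.

Lemma closedbox_sub b c a : subbox b c -> closedbox b a -> closedbox c a.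
Proof.
move=> /andP[_ /forallP bc] ab i; have /andP[h1 h2] := bc i.
by have /andP[h3 h4] := ab i; rewrite (le_trans h1 h3) (le_trans h4 h2).
Qed.

(* The cells of a fine grid which lie inside [K] cover every homothetic copy
   [t K] with [t < 1]. *)
Lemma grid_exists (psi : 'rV[R]_k.+1 -> R) (t e : R) :
  0 <= t -> t < 1 -> continuous psi -> 0 < e ->
  exists s, [/\ all (@wfbox R k.+1) s, pairwise (@sepbox R k.+1) s,
    forall b, has (subbox b) s -> forall a, closedbox b a ->
      K (phi a) /\ `|psi a - wt b| <= e &
    forall a, K (phi a) -> bunion x0 M s (phi (t *: a))].
Proof.
move=> t0 t1 cpsi e0.
pose A : set 'rV[R]_k.+1 := [set a | forall i, a ord0 i \in `[- B, B]].
have cA : compact A.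
  have := @rV_compact R k.+1 (fun=> `[- B, B]%classic)
    (fun i => @segment_compact _ _ _).
  by congr compact; apply/seteqP; split => a /= h j; have := h j.
have KA a : K (phi a) -> A a.
  move=> /param_bounded aB i; rewrite in_itv/= -ler_norml.
  exact: le_trans (coord_le_norm _ _) aB.
have [d d0 unif] := compact_unif_continuous cA cpsi e0.
(* [d / 2] controls the oscillation of [psi] on a cell; [(1 - t) * rho] keeps the whole cell around
   a point [t *: a] inside [K]. *)
pose sg := Num.min (d / 2) ((1 - t) * rho).
have sg0 : 0 < sg by rewrite lt_min divr_gt0//= mulr_gt0// subr_gt0.
have sgd : sg < d.
  by rewrite (@le_lt_trans _ _ (d / 2)) ?ge_min ?lexx//; lra.
pose N := (Num.bound (2 * B / sg)).+1.
have N0 : (0 < N)%N by [].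
pose cell (z : {ffun 'I_k.+1 -> 'I_N}) : wbox R k.+1 :=
  let l i := - B + (z i)%:R * sg in
  WBox l (fun i => - B + (z i).+1%:R * sg) (psi (\row_i l i)).
have cell_lo z : closedbox (cell z) (\row_i lo (cell z) i).
  by move=> i; rewrite mxE lexx /= lerD2l ler_pM2r// ler_nat.
have cell_diam z a a' : closedbox (cell z) a -> closedbox (cell z) a' ->
    `|a - a'| <= sg.
  move=> az a'z; apply: rV_norm_le => [|i]; first exact: ltW.
  have /andP[h1 h2] := az i; have /andP[h3 h4] := a'z i.
  move: h2 h4; rewrite /= -natr1 mulrDl mul1r => h2 h4.
  by rewrite !mxE ler_norml; apply/andP; split; move: h1 h3 => /=; lra.
pose good z := `[< forall a, closedbox (cell z) a -> K (phi a) >].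
pose zs := [seq z <- enum {: {ffun 'I_k.+1 -> 'I_N}} | good z].
exists (map cell zs); split.
- rewrite all_map; apply/allP => z _ /=; apply/forallP => i /=.
  by rewrite ltrD2l ltr_pM2r// ltr_nat.
- rewrite pairwise_map; have := filter_uniq good (enum_uniq {: {ffun 'I_k.+1 -> 'I_N}}).
  rewrite -/zs uniq_pairwise; apply: sub_pairwise => z z' /= zz'.
  have /existsP[i zi] : [exists i, z i != z' i].
    rewrite -negb_forall; apply: contra zz' => /forallP h.
    by apply/eqP/ffunP => i; apply/eqP.
  apply/existsP; exists i => /=; rewrite !lerD2l !ler_pM2r// !ler_nat.
  by move: zi; rewrite -val_eqE neq_ltn.
- move=> b; rewrite has_map => /hasP[z]; rewrite mem_filter => /andP[/asboolP gz _].
  move=> /= bz a ab; have az := closedbox_sub bz ab.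
  split; first exact: gz.
  case/andP: bz => /eqP -> _; apply/ltW/unif.
  + exact/KA/gz.
  + exact/KA/gz/cell_lo.
  + by apply: le_lt_trans sgd; apply: cell_diam az (cell_lo z).
- move=> a Ka.
  have taB i : 0 <= (t *: a) ord0 i + B /\ (t *: a) ord0 i + B <= 2 * B.
    have : `|(t *: a) ord0 i| <= B.
      rewrite mxE normrM (ger0_norm t0).
      apply: (@le_trans _ _ (1 * `|a ord0 i|)); first by rewrite ler_wpM2r// ltW.
      by rewrite mul1r (le_trans (coord_le_norm _ _))// param_bounded.
    by rewrite ler_norml => /andP[h1 h2]; split; lra.
  have idx (i : 'I_k.+1) : exists z : 'I_N,
      - B + z%:R * sg <= (t *: a) ord0 i < - B + z.+1%:R * sg.
    have [h1 h2] := taB i; have q0 := divr_ge0 h1 (ltW sg0).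
    have /andP[t1' t2'] := truncn_itv q0.
    have tN : (Num.truncn (((t *: a) ord0 i + B) / sg) < N)%N.
      rewrite -(ltr_nat R) (le_lt_trans t1')//.
      apply: (@le_lt_trans _ _ (2 * B / sg)).
        by rewrite ler_pM2r ?invr_gt0.
      have BB : 0 <= 2 * B / sg by rewrite divr_ge0 ?mulr_ge0// ltW.
      by rewrite (lt_le_trans (archi_boundP BB))// ler_nat.
    exists (Ordinal tN) => /=; move: t1' t2'.
    rewrite ler_pdivlMr// ltr_pdivrMr// => t1' t2'.
    by apply/andP; split; lra.
  have [z0 hz0] := choice idx; pose z := [ffun i => z0 i].
  have taz : bset (cell z) (t *: a) by move=> i /=; rewrite ffunE.
  have gz : z \in zs.
    rewrite mem_filter mem_enum andbT; apply/asboolP => a' a'z.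
    apply: (shrink_neighborhood t0 t1 Ka).
    apply: le_trans (cell_diam _ _ _ a'z (bset_closedbox taz)) _.
    by rewrite ge_min lexx orbT.
  rewrite /bunion big_map (big_rem z gz) /=; left.
  by exists (t *: a).
Qed.

Hypothesis mK : @hmeasurable R n k.+1 K.

Lemma body_measure_finite : (H K < +oo)%E.
Proof.
apply: (@le_lt_trans _ _ (H (phi @` hbox (fun=> - B) (fun=> B + 1)))).
  apply: le_hausdorff_outer => y /boundK[a aB <-]; exists a => // i.
  have := le_trans (coord_le_norm a i) aB; rewrite ler_norml => /andP[-> /=].
  by move/le_lt_trans; apply; rewrite ltrDl.
have BB : - B <= B + 1 by move: B0; lra.
by rewrite param_hbox_volume ?ltry.
Qed.

(** The homothety of ratio [t^-1] about [x0] maps the union of the boxes onto a set containing [K],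
    and it multiplies the measure by at most [t^-1] to the power [k.+1]. *)
Lemma body_measure_setD s t : 0 < t ->
  bunion x0 M s `<=` K -> (forall a, K (phi a) -> bunion x0 M s (phi (t *: a))) ->
  (H (K `\` bunion x0 M s) <= ((1 - t ^+ k.+1) * fine (H K))%:E)%E.
Proof.
move=> t0 sK cover.
have finE : H K = (fine (H K))%:E.
  by rewrite fineK// ge0_fin_numE ?hausdorff_outer_ge0// body_measure_finite.
have mS := bunion_measurable x0 fM s.
have SK : (H (bunion x0 M s) <= H K)%E by exact: le_hausdorff_outer.
have finS : H (bunion x0 M s) = (fine (H (bunion x0 M s)))%:E.
  rewrite fineK// ge0_fin_numE ?hausdorff_outer_ge0//.
  by rewrite (le_lt_trans SK)// body_measure_finite.
have DK : (H (K `\` bunion x0 M s) <= H K)%E.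
  by apply: le_hausdorff_outer => x [].
have finD : H (K `\` bunion x0 M s) = (fine (H (K `\` bunion x0 M s)))%:E.
  rewrite fineK// ge0_fin_numE ?hausdorff_outer_ge0//.
  by rewrite (le_lt_trans DK)// body_measure_finite.
have sub : (H K <= ((t^-1) ^+ k.+1)%:E * H (bunion x0 M s))%E.
  have t0' : 0 < t^-1 by rewrite invr_gt0.
  apply: le_trans (@hausdorff_outer_lipschitz R n n (fun x => x0 + t^-1 *: (x - x0))
    t^-1 t0' _ k.+1 _); last first.
    move=> x y; rewrite opprD addrACA subrr add0r -scalerBr opprB addrA subrK.
    by rewrite enormZ gtr0_norm.
  apply: le_hausdorff_outer => y Ky; have [a _ ay] := boundK Ky.
  exists (phi (t *: a)); first by apply: cover; rewrite ay.
  rewrite /param [x0 + _ - x0]addrAC subrr add0r -scalemxAl scalerA mulVf ?gt_eqF//.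
  by rewrite scale1r.
have := hausdorff_outer_setD mK mS sK.
move: sub; rewrite finE finS finD -EFinM -EFinD !lee_fin exprVn => sub -[e].
have {}sub : t ^+ k.+1 * fine (H K) <= fine (H (bunion x0 M s)).
  by rewrite -ler_pdivlMl ?exprn_gt0.
by rewrite mulrBl mul1r; lra.
Qed.

End Grid.

Section BoxOperations.
Variables (R : realType) (k : nat).
Implicit Types (b c : wbox R k) (s : seq (wbox R k)).

Lemma has_all_ex (T : Type) (p q : pred T) (s : seq T) :
  has p s -> all q s -> exists x, p x && q x.
Proof.
elim: s => //= x s IH /orP[px|ps] /andP[qx qs]; last exact: IH.
by exists x; rewrite px qx.
Qed.

(** Shifting weights turns approximate values of the integrand into lower or upper bounds, and later
    credits the defect to the boxes in the caps. *)
Definition addw (d : R) b := WBox (lo b) (hi b) (wt b + d).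

(** The weight changes sign because the box of [-K] enters the pointwise inequality through
    [- f]. *)
Definition negb_box b :=
  WBox (fun i => - hi b i) (fun i => - lo b i) (- wt b).

Lemma has_addw d b s : has (subbox b) (map (addw d) s) ->
  has (subbox (addw (- d) b)) s.
Proof.
rewrite has_map; apply: sub_has => c /= /andP[/eqP bc h].
by rewrite /subbox /= bc addrK eqxx.
Qed.

Lemma all_addw d (p : pred (wbox R k)) s : (forall b, p (addw d b) = p b) ->
  all p (map (addw d) s) = all p s.
Proof. by move=> pd; rewrite all_map; apply: eq_all => b; exact: pd. Qed.

Lemma pairwise_addw d s :
  pairwise (@sepbox R k) (map (addw d) s) = pairwise (@sepbox R k) s.
Proof. by rewrite pairwise_map. Qed.

Lemma sum_vol_addw d s : \sum_(b <- map (addw d) s) vol b = \sum_(b <- s) vol b.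
Proof. by rewrite big_map. Qed.

Lemma sum_wt_addw d s : \sum_(b <- map (addw d) s) vol b * wt b =
  \sum_(b <- s) vol b * wt b + d * \sum_(b <- s) vol b.
Proof.
rewrite big_map mulr_sumr -big_split; apply: eq_bigr => b _ /=.
by rewrite mulrDr [d * _]mulrC.
Qed.

Lemma has_negb b s : has (subbox b) (map negb_box s) ->
  has (subbox (negb_box b)) s.
Proof.
rewrite has_map; apply: sub_has => c /= /andP[/eqP bc /forallP h].
rewrite /subbox /= bc opprK eqxx; apply/forallP => i.
by have /andP[h1 h2] := h i; rewrite lerNr h2 lerNl.
Qed.

Lemma wf_negb s : all (@wfbox R k) s -> all (@wfbox R k) (map negb_box s).
Proof.
rewrite all_map; apply: sub_all => b /forallP wf; apply/forallP => i /=.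
by rewrite ltrN2.
Qed.

Lemma pairwise_negb s : pairwise (@sepbox R k) s ->
  pairwise (@sepbox R k) (map negb_box s).
Proof.
rewrite pairwise_map; apply: sub_pairwise => b c /existsP[i bc].
by apply/existsP; exists i => /=; rewrite !lerN2 orbC.
Qed.

Lemma vol_negb b : vol (negb_box b) = vol b.
Proof. by apply: eq_bigr => i _ /=; rewrite opprK addrC. Qed.

Lemma sum_vol_negb s : \sum_(b <- map negb_box s) vol b = \sum_(b <- s) vol b.
Proof. by rewrite big_map; apply: eq_bigr => b _; rewrite vol_negb. Qed.

Lemma sum_wt_negb s : \sum_(b <- map negb_box s) vol b * wt b =
  - \sum_(b <- s) vol b * wt b.
Proof.
by rewrite big_map -sumrN; apply: eq_bigr => b _; rewrite vol_negb /= mulrN.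
Qed.

Lemma lcut_addw_vol d i t s : all (@wfbox R k) s ->
  \sum_(b <- lcut i t (map (addw d) s)) vol b = \sum_(b <- lcut i t s) vol b.
Proof.
move=> ws; rewrite !lcut_volE ?big_map//.
by rewrite all_addw.
Qed.

Lemma lcut_negb_vol i t s : all (@wfbox R k) s ->
  \sum_(b <- lcut i (- t) (map negb_box s)) vol b +
  \sum_(b <- lcut i t s) vol b = \sum_(b <- s) vol b.
Proof.
move=> ws; rewrite !lcut_volE ?wf_negb// big_map.
elim: s ws => [|b s IH] /=; first by rewrite !big_nil addr0.
move=> /andP[/forallP wb ws]; rewrite !big_cons addrACA IH//; congr (_ + _).
rewrite (volE b i) (eq_bigr (fun j => hi b j - lo b j)); last first.
  by move=> j _; rewrite opprK addrC.
rewrite -mulrDr; congr (_ * _); have := wb i.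
set x := lo b i; set y := hi b i => xy.
rewrite opprK.
have mp (z : R) : 0 <= z -> Num.max 0 z = z by exact: max_r.
have mn (z : R) : z <= 0 -> Num.max 0 z = 0 by exact: max_l.
have [xt|xt] := leP x t; have [yt|yt] := leP y t.
- have e1 : Num.min (- x) (- t) = - t by apply: min_r; lra.
  have h1 : - t + y <= 0 by lra.
  have h2 : 0 <= y - x by lra.
  by rewrite e1 (mn _ h1) (mp _ h2); lra.
- have e1 : Num.min (- x) (- t) = - t by apply: min_r; lra.
  have h1 : 0 <= - t + y by lra.
  have h2 : 0 <= t - x by lra.
  by rewrite e1 (mp _ h1) (mp _ h2); lra.
- by exfalso; lra.
- have e1 : Num.min (- x) (- t) = - x by apply: min_l; lra.
  have h1 : 0 <= - x + y by lra.
  have h2 : t - x <= 0 by lra.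
  by rewrite e1 (mp _ h1) (mn _ h2); lra.
Qed.

(** Each coordinate of [a] has a relative position [th] in the combined interval; the same position
    is taken in both factors. *)
Lemma cbox_decompose (u v : R) (p : wbox R k.+1 * wbox R k.+1)
    (a : 'rV[R]_k.+1) : 0 < u -> 0 < v ->
  wfbox p.1 -> wfbox p.2 -> bset (cbox u v p) a ->
  exists a1 a2, [/\ bset p.1 a1, bset p.2 a2 & a = u *: a1 + v *: a2].
Proof.
move=> u0 v0 /forallP w1 /forallP w2 ha.
pose w i := u * (hi p.1 i - lo p.1 i) + v * (hi p.2 i - lo p.2 i).
have d1 i : 0 < hi p.1 i - lo p.1 i by rewrite subr_gt0.
have d2 i : 0 < hi p.2 i - lo p.2 i by rewrite subr_gt0.
have wgt0 i : 0 < w i by rewrite addr_gt0// mulr_gt0.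
pose th i := (a ord0 i - (u * lo p.1 i + v * lo p.2 i)) / w i.
have th01 i : 0 <= th i < 1.
  have /andP[/= h1 h2] := ha i.
  rewrite divr_ge0 ?subr_ge0 ?(ltW (wgt0 _))//= ltr_pdivrMr// mul1r /w.
  by rewrite ltrBlDl; move: h2; congr (_ < _); ring.
exists (\row_i (lo p.1 i + th i * (hi p.1 i - lo p.1 i))).
exists (\row_i (lo p.2 i + th i * (hi p.2 i - lo p.2 i))).
have inside (l d x : R) : 0 < d -> 0 <= x < 1 -> l <= l + x * d < l + d.
  move=> d0 /andP[x0 x1]; rewrite lerDl mulr_ge0// ?(ltW d0)//= ltrD2l.
  by rewrite gtr_pMl.
split.
- by move=> i; rewrite mxE; have := inside (lo p.1 i) _ _ (d1 i) (th01 i); rewrite subrKC.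
- by move=> i; rewrite mxE; have := inside (lo p.2 i) _ _ (d2 i) (th01 i); rewrite subrKC.
apply/rowP => i; rewrite !mxE.
have : th i * w i = a ord0 i - (u * lo p.1 i + v * lo p.2 i).
  by rewrite /th divfK// gt_eqF.
by rewrite /w => e; lra.
Qed.

End BoxOperations.

Section CutCover.
Variables (R : realType) (n k : nat) (x0 : 'rV[R]_n) (M : 'M[R]_(k.+1, n)).
Hypothesis fM : row_free M.
Implicit Types (b c : wbox R k.+1) (s : seq (wbox R k.+1)) (a : 'rV[R]_k.+1)
  (t : R) (i : 'I_k.+1).
Local Notation phi := (param x0 M).

Lemma bunion_cons b s : bunion x0 M (b :: s) = bimg x0 M b `|` bunion x0 M s.
Proof. by rewrite /bunion big_cons. Qed.

Lemma bunion_cat s s' :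
  bunion x0 M (s ++ s') = bunion x0 M s `|` bunion x0 M s'.
Proof. by rewrite /bunion big_cat. Qed.

Lemma rcut_cover i t s a : t <= a ord0 i ->
  bunion x0 M s (phi a) -> bunion x0 M (rcut i t s) (phi a).
Proof.
move=> ta; elim: s => [|b s IH]; first by rewrite /bunion !big_nil.
rewrite bunion_cons => -[[a' a'b /(can_inj (paramK x0 fM)) aa']|].
  rewrite {}aa' in a'b; rewrite /rcut /= bunion_cat; left; rewrite /cutr.
  have /andP[_ ah] := a'b i; rewrite (le_lt_trans ta ah) /bunion big_seq1.
  exists a => // j; rewrite /= /upd; case: eqP => [->|_]; last exact: a'b.
  by have /andP[h1 h2] := a'b i; rewrite ge_max h1 ta h2.
by move=> /IH; rewrite /rcut /= bunion_cat; right.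
Qed.

Lemma lcut_cover i t s a : a ord0 i < t ->
  bunion x0 M s (phi a) -> bunion x0 M (lcut i t s) (phi a).
Proof.
move=> ta; elim: s => [|b s IH]; first by rewrite /bunion !big_nil.
rewrite bunion_cons => -[[a' a'b /(can_inj (paramK x0 fM)) aa']|].
  rewrite {}aa' in a'b; rewrite /lcut /= bunion_cat; left; rewrite /cutl.
  have /andP[al _] := a'b i; rewrite (le_lt_trans al ta) /bunion big_seq1.
  exists a => // j; rewrite /= /upd; case: eqP => [->|_]; last exact: a'b.
  by have /andP[h1 h2] := a'b i; rewrite lt_min h1 ta h2.
by move=> /IH; rewrite /lcut /= bunion_cat; right.
Qed.

Lemma bunion_addw d s : bunion x0 M (map (addw d) s) = bunion x0 M s.
Proof. by rewrite /bunion big_map. Qed.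

(** Lets [K] and [L], charted over different base points, share one density. *)
Lemma box_density_translate x1 : box_density x1 M = box_density x0 M.
Proof.
rewrite /box_density; congr fine.
rewrite -(@hausdorff_outer_isometry R n k.+1 (fun y => (x1 - x0) + y)
  (fun y => - (x1 - x0) + y) (param x0 M @` @ucube R k.+1)).
- congr hausdorff_outer; rewrite image_comp; apply: eq_imagel => a _ /=.
  by rewrite /param addrA subrK.
- by move=> y z; rewrite opprD addrACA subrr add0r.
- by move=> y; rewrite addKr.
- by move=> y; rewrite addNKr.
Qed.

End CutCover.

(** Bernoulli's inequality at [t = 1 - s]. *)
Lemma power_near_one (R : realType) (m : nat) (c d : R) : 0 <= c -> 0 < d ->
  exists t, [/\ 0 < t, t < 1 & (1 - t ^+ m) * c <= d].
Proof.
move=> c0 d0; pose q := m.+1%:R * (c + 1).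
have q0 : 0 < q by rewrite mulr_gt0// ltr_wpDl.
pose s := Num.min (1 / 2) (d / q).
have s0 : 0 < s by rewrite lt_min !divr_gt0.
have s12 : s <= 1 / 2 by rewrite ge_min lexx.
have sd : s * q <= d by rewrite -ler_pdivlMr// ge_min lexx orbT.
have bern j : 1 - j%:R * s <= (1 - s) ^+ j.
  elim: j => [|j IH]; first by rewrite mul0r subr0 expr0.
  rewrite exprS -natr1; have j0 : 0 <= j%:R :> R by rewrite ler0n.
  have : (1 - s) * (1 - j%:R * s) <= (1 - s) * (1 - s) ^+ j.
    by rewrite ler_wpM2l//; move: s12 s0; lra.
  have : 0 <= j%:R * s * s by rewrite !mulr_ge0// ltW.
  lra.
exists (1 - s); split; [lra|lra|].
have := bern m => hb; apply: le_trans sd; rewrite /q.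
apply: (@le_trans _ _ (m%:R * s * c)).
  by rewrite ler_wpM2r//; lra.
have -> : m%:R * s * c = s * (m%:R * c) by ring.
by rewrite ler_pM2l// ler_pM// ?ler_nat// lerDl.
Qed.

Lemma param_continuous (R : realType) n k x0 (M : 'M[R]_(k, n)) :
  continuous (param x0 M).
Proof.
have [C [C0 hC]] := param_lipschitz x0 M.
move=> a; apply/(@cvgrPdist_lt _ _ _ _ (nbhs_filter a)) => e e0.
apply/nbhs_ballP; exists (e / C); first by rewrite /= divr_gt0.
move=> b; rewrite -ball_normE /= => ab.
apply: le_lt_trans (mxnorm_le_enorm _) _; apply: le_lt_trans (hC _ _) _.
by rewrite mulrC -ltr_pdivlMr.
Qed.

(** * Comparison of the two integrals, with a defect on two caps *)

Section Core.
Variables (R : realType) (n k : nat) (x0 : 'rV[R]_n) (M : 'M[R]_(k.+1, n)).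
Hypothesis fM : row_free M.
Variables (K : set 'rV[R]_n) (rho B : R).
Local Notation H := (@hausdorff_outer R n k.+1).
Local Notation hmeas := (@hmeasurable R n k.+1).
Local Notation hint := (@hint R n k.+1).
Local Notation phi := (param x0 M).
Local Notation dens := (box_density x0 M).
Hypotheses (rho0 : 0 < rho) (B0 : 0 < B)
  (convK : forall x y t, K x -> K y -> 0 <= t -> t <= 1 ->
     K (t *: x + (1 - t) *: y))
  (innerK : forall a, `|a| <= rho -> K (phi a))
  (boundK : forall y, K y -> exists2 a, `|a| <= B & phi a = y)
  (mK : hmeas K).
Variables (u v : R).
Hypotheses (u0 : 0 < u) (v0 : 0 < v) (uv1 : u + v = 1) (vu : v <= u).
Let L := minkowski_comb u K v (opp_set K).
Hypothesis mL : hmeas L.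
Variables (f h : 'rV[R]_n -> R) (F : R).
Hypotheses (cf : continuous f) (ch : continuous h)
  (f0 : forall x, 0 <= f x) (h0 : forall x, 0 <= h x)
  (fF : forall x, K x -> f x <= F).
Hypothesis fh : forall x y, K x -> K y -> u * f x - v * f y <= h (u *: x + v *: - y).
Variables (T0 T1 d : R) (Qp Qm : wbox R k.+1).
Hypotheses (d0 : 0 <= d)
  (fhd : forall a b : 'rV[R]_k.+1, K (phi a) -> K (phi b) ->
     T0 <= a ord0 ord0 -> b ord0 ord0 <= T1 ->
     u * f (phi a) - v * f (phi b) + d <= h (u *: phi a + v *: - phi b))
  (wQp : wfbox Qp) (wQm : wfbox Qm)
  (Qp_cap : forall a, bset Qp a -> K (phi a) /\ T0 <= a ord0 ord0)
  (Qm_cap : forall a, bset Qm a -> K (phi a) /\ a ord0 ord0 < T1).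

Let dens0 : 0 < dens := box_density_gt0 x0 fM.

(** A volume available in both caps whatever the grid; the division by 2 leaves room for the part of
    the caps that the grid misses. *)
Let w0 := Num.min (vol Qp) (vol Qm) / 2.

Let w0_gt0 : 0 < w0.
Proof. by rewrite divr_gt0// lt_min !vol_gt0. Qed.

Let finK : H K = (fine (H K))%:E.
Proof.
by rewrite fineK// ge0_fin_numE ?hausdorff_outer_ge0//; exact: (body_measure_finite fM B0 boundK).
Qed.

Let HK0 : 0 <= fine (H K).
Proof. by rewrite fine_ge0// hausdorff_outer_ge0. Qed.

Let F0 : 0 <= F.
Proof.
apply: le_trans (f0 (phi 0)) _; apply: fF; apply: innerK.
by rewrite normr0 ltW.
Qed.

Let x0L := u *: x0 + v *: - x0.

(** Boxes of [-K] live in the coordinates [- a]. With this convention a combination of coordinate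
    boxes is a coordinate box for [L], over the same matrix [M]. *)
Let paramL a b : param x0L M (u *: a + v *: b) = u *: phi a + v *: - phi (- b).
Proof.
rewrite /param mulmxDl -!scalemxAl mulNmx opprB scalerDr scalerBr /x0L.
by rewrite scalerN addrACA -[- (v *: x0) + _]addrC.
Qed.

Section OneGrid.
Variables (e t : R) (s : seq (wbox R k.+1)).
Hypotheses (ws : all (@wfbox R k.+1) s) (ss : pairwise (@sepbox R k.+1) s)
  (goods : forall b, has (subbox b) s -> forall a, closedbox b a ->
     K (phi a) /\ `|f (phi a) - wt b| <= e)
  (rest : (H (K `\` bunion x0 M s) <= (dens * w0)%:E)%E).

(** Lowering the weights by the grid error makes them lower bounds: of [f] on the boxes of [U], and
    of [- f] at the reflected points on those of [V]. *)
Let U := map (addw (- e)) s.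
Let V := map (addw (- e)) (map (@negb_box R k.+1) s).
Let T := \sum_(b <- s) vol b.
Let S := \sum_(b <- s) vol b * wt b.

Let sK : bunion x0 M s `<=` K.
Proof.
move: goods; rewrite /bunion; elim: s => [|b s' IH] good; first by rewrite big_nil.
rewrite big_cons => x [[a ab <-]|].
  have := good b; rewrite /= subbox_refl => /(_ isT a (bset_closedbox ab)).
  by case.
by apply: IH => c cs a ac; apply: good => //=; rewrite cs orbT.
Qed.

Let wU : all (@wfbox R k.+1) U.
Proof. by rewrite all_addw. Qed.

Let wV : all (@wfbox R k.+1) V.
Proof. by rewrite all_addw ?wf_negb. Qed.

Let sU : pairwise (@sepbox R k.+1) U.
Proof. by rewrite pairwise_addw. Qed.

Let sV : pairwise (@sepbox R k.+1) V.
Proof. by rewrite pairwise_addw pairwise_negb. Qed.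

Let volU : \sum_(b <- U) vol b = T.
Proof. exact: sum_vol_addw. Qed.

Let volV : \sum_(b <- V) vol b = T.
Proof. by rewrite sum_vol_addw sum_vol_negb. Qed.

Let goodU b : has (subbox b) U -> forall a, bset b a ->
  K (phi a) /\ wt b <= f (phi a).
Proof.
move=> /has_addw /goods bs a ab; have [] := bs a (bset_closedbox ab).
rewrite /= opprK => Ka; rewrite ler_norml => /andP[h1 _]; split => //; lra.
Qed.

Let goodV b : has (subbox b) V -> forall a, bset b a ->
  K (phi (- a)) /\ wt b <= - f (phi (- a)).
Proof.
move=> /has_addw /has_negb /goods bs a ab.
have ca : closedbox (negb_box (addw (- - e) b)) (- a).
  move=> i /=; rewrite mxE !lerN2; have /andP[h1 h2] := ab i.
  by rewrite h1 ltW.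
have [] := bs _ ca; rewrite /= opprK => Ka.
rewrite ler_norml => /andP[_ h1]; split => //; lra.
Qed.

(** [Qp] lies in the cap and is covered by the grid up to measure [dens * w0]; as its volume is at
    least [2 * w0], boxes of total volume at least [w0] remain above [T0]. *)
Let capU : \sum_(b <- lcut ord0 T0 U) vol b <= T - w0.
Proof.
rewrite lcut_addw_vol// /T -(lcut_vol ord0 T0 ws) -addrA lerDl subr_ge0.
suff hcap : dens * (vol Qp - w0) <= dens * \sum_(c <- rcut ord0 T0 s) vol c.
  rewrite ler_pM2l// in hcap; apply: le_trans hcap.
  have : Num.min (vol Qp) (vol Qm) <= vol Qp by rewrite ge_min lexx.
  by rewrite /w0; lra.
rewrite -lee_fin mulrBr EFinB leeBlDr// -bimg_vol//.
apply: (@le_trans _ _ (H (bunion x0 M (rcut ord0 T0 s)) +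
    H (K `\` bunion x0 M s))%E); last first.
  by rewrite leeD// bunion_le// wf_rcut.
apply: le_trans (outer_measureU2 (H : {outer_measure set 'rV[R]_n -> \bar R}) _ _).
apply: le_hausdorff_outer => _ [a aQ <-]; have [Ka aT] := Qp_cap aQ.
have [sa|nsa] := pselect (bunion x0 M s (phi a)); last by right.
by left; exact: rcut_cover.
Qed.

(** Negation turns the half-space below [T1] into one above [- T1], so both families are cut with
    the same orientation. *)
Let capV : \sum_(b <- lcut ord0 (- T1) V) vol b <= T - w0.
Proof.
rewrite lcut_addw_vol ?wf_negb// /T -(lcut_negb_vol ord0 T1 ws).
rewrite -addrA lerDl subr_ge0.
suff hcap : dens * (vol Qm - w0) <= dens * \sum_(c <- lcut ord0 T1 s) vol c.
  rewrite ler_pM2l// in hcap; apply: le_trans hcap.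
  have : Num.min (vol Qp) (vol Qm) <= vol Qm by rewrite ge_min lexx orbT.
  by rewrite /w0; lra.
rewrite -lee_fin mulrBr EFinB leeBlDr// -bimg_vol//.
apply: (@le_trans _ _ (H (bunion x0 M (lcut ord0 T1 s)) +
    H (K `\` bunion x0 M s))%E); last first.
  by rewrite leeD// bunion_le// wf_lcut.
apply: le_trans (outer_measureU2 (H : {outer_measure set 'rV[R]_n -> \bar R}) _ _).
apply: le_hausdorff_outer => _ [a aQ <-]; have [Ka aT] := Qm_cap aQ.
have [sa|nsa] := pselect (bunion x0 M s (phi a)); last by right.
by left; exact: lcut_cover.
Qed.

(* The caps, on which the pointwise inequality has defect [d], are matched
   with each other. *)
Lemma hint_ge_grid :
  ((dens * ((u - v) * S - e * T + d * w0))%:E <= hint h L)%E.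
Proof.
have T0w : T - w0 <= T by rewrite gerBl ltW.
(* By the cap estimates, the cuts that leave volume [w0] beyond them can be placed past [T0] and
   [- T1], hence inside the caps. *)
have [tc tcT volA1] : exists2 tc, T0 <= tc &
    \sum_(b <- lcut ord0 tc U) vol b = T - w0.
  by apply: lcut_IVT => //; rewrite capU volU.
have [sc scT volB1] : exists2 sc, - T1 <= sc &
    \sum_(b <- lcut ord0 sc V) vol b = T - w0.
  by apply: lcut_IVT => //; rewrite capV volV.
have volA2 : \sum_(b <- rcut ord0 tc U) vol b = w0.
  by have := lcut_vol ord0 tc wU; rewrite volA1 volU; lra.
have volB2 : \sum_(b <- rcut ord0 sc V) vol b = w0.
  by have := lcut_vol ord0 sc wV; rewrite volB1 volV; lra.
have [P1 mP1] : exists P, matching u v (lcut ord0 tc U) (lcut ord0 sc V) P.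
  apply: matching_exists => //; rewrite ?wf_lcut ?pairwise_lcut//.
  by rewrite volA1 volB1.
(* Raising both weights by [d] raises the weight of a combination by [u * d + v * d = d], exactly
   the defect available on the caps. *)
have [P2 mP2] : exists P, matching u v (map (addw d) (rcut ord0 tc U))
    (map (addw d) (rcut ord0 sc V)) P.
  apply: matching_exists => //; rewrite ?all_addw ?pairwise_addw ?wf_rcut ?pairwise_rcut//.
  by rewrite !sum_vol_addw volA2 volB2.
have sepP : pairwise (@sepbox R k.+1) (map (cbox u v) (P1 ++ P2)).
  apply: (@matching_sep_cat _ _ u v u0 v0 ord0 tc sc _ _ _ _ _ _ _ _ _ _ mP1 mP2).
  - by apply: sub_all (lcut_spec ord0 tc U) => b /andP[].
  - by apply: sub_all (lcut_spec ord0 sc V) => b /andP[].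
  - by rewrite all_addw//; apply: sub_all (rcut_spec ord0 tc U) => b /andP[].
  - by rewrite all_addw//; apply: sub_all (rcut_spec ord0 sc V) => b /andP[].
have wfP : all (fun p => wfbox p.1 && wfbox p.2) (P1 ++ P2).
  by rewrite all_cat (matching_wf mP1) (matching_wf mP2).
have wfC : all (@wfbox R k.+1) (map (cbox u v) (P1 ++ P2)).
  by rewrite all_map; apply: sub_all wfP => p /andP[w1 w2]; exact: wf_cbox.
have hsub c c' : subbox c c' -> bset c `<=` bset c' by exact: bset_sub.
have lower1 p : has (subbox p.1) (lcut ord0 tc U) ->
    has (subbox p.2) (lcut ord0 sc V) -> forall a1 a2, bset p.1 a1 -> bset p.2 a2 ->
    L (u *: phi a1 + v *: - phi (- a2)) /\
    u * wt p.1 + v * wt p.2 <= h (u *: phi a1 + v *: - phi (- a2)).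
  move=> hA hB a1 a2 ha1 ha2.
  have hA' : has (subbox p.1) U.
    by apply: (has_subbox_trans hA); apply: sub_all (lcut_spec ord0 tc U) => b /andP[].
  have hB' : has (subbox p.2) V.
    by apply: (has_subbox_trans hB); apply: sub_all (lcut_spec ord0 sc V) => b /andP[].
  have [K1 w1] := goodU hA' ha1; have [K2 w2] := goodV hB' ha2.
  split; first by exists (phi a1) => //; exists (- phi (- a2)) => //; exists (phi (- a2)).
  apply: le_trans (fh K1 K2); rewrite -mulrN.
  by rewrite lerD// ler_pM2l.
have lower2 p : has (subbox p.1) (map (addw d) (rcut ord0 tc U)) ->
    has (subbox p.2) (map (addw d) (rcut ord0 sc V)) ->
    forall a1 a2, bset p.1 a1 -> bset p.2 a2 ->
    L (u *: phi a1 + v *: - phi (- a2)) /\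
    u * wt p.1 + v * wt p.2 <= h (u *: phi a1 + v *: - phi (- a2)).
  move=> /has_addw hA /has_addw hB a1 a2 ha1 ha2.
  have [b /andP[/andP[_ /forallP/(_ ord0)/andP[lo1 _]] /andP[hA1 lo1']]] :=
    has_all_ex hA (rcut_spec ord0 tc U).
  have [b' /andP[/andP[_ /forallP/(_ ord0)/andP[lo2 _]] /andP[hB1 lo2']]] :=
    has_all_ex hB (rcut_spec ord0 sc V).
  have hA' : has (subbox (addw (- d) p.1)) U.
    by apply: (has_subbox_trans hA); apply: sub_all (rcut_spec ord0 tc U) => c /andP[].
  have hB' : has (subbox (addw (- d) p.2)) V.
    by apply: (has_subbox_trans hB); apply: sub_all (rcut_spec ord0 sc V) => c /andP[].
  have [K1 /= w1] := goodU hA' ha1; have [K2 /= w2] := goodV hB' ha2.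
  split; first by exists (phi a1) => //; exists (- phi (- a2)) => //; exists (phi (- a2)).
  have /andP[l1 _] := ha1 ord0; have /andP[l2 _] := ha2 ord0.
  have a1T : T0 <= a1 ord0 ord0.
    by rewrite (le_trans tcT)// (le_trans lo1')// (le_trans lo1).
  have a2T : (- a2) ord0 ord0 <= T1.
    rewrite mxE lerNl (le_trans scT)// (le_trans lo2')//.
    exact: le_trans lo2 l2.
  apply: le_trans (fhd K1 K2 a1T a2T).
  have e1 : u * (wt p.1 - d) <= u * f (phi a1) by rewrite ler_pM2l.
  have e2 : v * (wt p.2 - d) <= v * - f (phi (- a2)) by rewrite ler_pM2l.
  have e3 : u * d + v * d = d by rewrite -mulrDl uv1 mul1r.
  by move: e1 e2; rewrite !mulrBr mulrN; lra.
have lower p a : wfbox p.1 -> wfbox p.2 ->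
    (forall a1 a2, bset p.1 a1 -> bset p.2 a2 ->
      L (u *: phi a1 + v *: - phi (- a2)) /\
      u * wt p.1 + v * wt p.2 <= h (u *: phi a1 + v *: - phi (- a2))) ->
    bset (cbox u v p) a ->
    L (param x0L M a) /\ wt (cbox u v p) <= h (param x0L M a).
  move=> w1 w2 hp /(cbox_decompose u0 v0 w1 w2)[a1 [a2 [ha1 ha2 ->]]].
  by rewrite paramL; exact: hp.
apply: (@le_trans _ _ (dens * \sum_(b <- map (cbox u v) (P1 ++ P2))
    vol b * Num.max 0 (wt b))%:E); last first.
  rewrite -(box_density_translate x0 M x0L).
  apply: (@hint_ge_boxes _ _ _ x0L M fM h ch h0 _ L mL wfC sepP).
  move=> b; rewrite has_map has_cat => /orP[|] /has_all_ex hb a ab.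
    have [p /andP[/= bp /andP[/andP[w1 w2] /andP[s1 s2]]]] :=
      hb (fun p => (wfbox p.1 && wfbox p.2) &&
        (has (subbox p.1) (lcut ord0 tc U) && has (subbox p.2) (lcut ord0 sc V)))
      (etrans (all_predI _ _ _) (introT andP (conj (matching_wf mP1)
        (etrans (all_predI _ _ _) (introT andP (conj (matching_subl mP1) (matching_subr mP1))))))).
    case/andP: (bp) => /eqP -> _.
    by apply: (lower p a w1 w2); [exact: lower1|exact: hsub bp _ ab].
  have [p /andP[/= bp /andP[/andP[w1 w2] /andP[s1 s2]]]] :=
    hb (fun p => (wfbox p.1 && wfbox p.2) &&
      (has (subbox p.1) (map (addw d) (rcut ord0 tc U)) &&
       has (subbox p.2) (map (addw d) (rcut ord0 sc V))))
    (etrans (all_predI _ _ _) (introT andP (conj (matching_wf mP2)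
      (etrans (all_predI _ _ _) (introT andP (conj (matching_subl mP2) (matching_subr mP2))))))).
  case/andP: (bp) => /eqP -> _.
  by apply: (lower p a w1 w2); [exact: lower2|exact: hsub bp _ ab].
rewrite lee_fin ler_pM2l//.
have SU : \sum_(b <- U) vol b * wt b = S - e * T.
  by rewrite sum_wt_addw mulNr.
have SV : \sum_(b <- V) vol b * wt b = - S - e * T.
  by rewrite sum_wt_addw sum_wt_negb sum_vol_negb mulNr.
have sum1 : \sum_(p <- P1 ++ P2) (u * (vol p.1 * wt p.1) + v * (vol p.2 * wt p.2)) =
    (u - v) * S - e * T + d * w0.
  rewrite big_split /= -!mulr_sumr !big_cat /=.
  rewrite (matching_suml mP1 id) (matching_suml mP2 id).
  rewrite (matching_sumr mP1 id) (matching_sumr mP2 id) /=.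
  rewrite !sum_wt_addw volA2 volB2.
  have := lcut_sum id ord0 tc wU; have := lcut_sum id ord0 sc wV.
  rewrite /= SU SV => hv hu.
  set a1 := \sum_(c <- lcut _ _ U) _ in hu *.
  set a2 := \sum_(c <- rcut _ _ U) _ in hu *.
  set b1 := \sum_(c <- lcut _ _ V) _ in hv *.
  set b2 := \sum_(c <- rcut _ _ V) _ in hv *.
  have -> : a2 = S - e * T - a1 by lra.
  have -> : b2 = - S - e * T - b1 by lra.
  have -> : v = 1 - u by rewrite -uv1 addrC addKr.
  by ring.
rewrite -sum1 big_map.
have : all (fun p => (wfbox p.1 && wfbox p.2) && (vol p.1 == vol p.2)) (P1 ++ P2).
  by rewrite all_predI wfP all_cat (matching_vol mP1) (matching_vol mP2).
elim: (P1 ++ P2) => [|p P IH]; first by rewrite !big_nil.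
move=> /= /andP[/andP[/andP[w1 w2] /eqP ve] aP].
rewrite !big_cons lerD//; last exact: IH.
rewrite -ve mulrCA [v * _]mulrCA -mulrDr.
have v1 := vol_gt0 w1; have vc := vol_cbox_ge u0 v0 uv1 w1 w2 ve.
(* The truncation comes before the passage to the larger volume, which is only favourable for a
   nonnegative weight. *)
apply: (@le_trans _ _ (vol p.1 * Num.max 0 (u * wt p.1 + v * wt p.2))).
  by rewrite ler_pM2l// le_max lexx orbT.
by rewrite ler_wpM2r// le_max lexx.
Qed.

Lemma hint_le_grid : (hint f K <=
  (dens * (S + e * T))%:E + F%:E * H (K `\` bunion x0 M s))%E.
Proof.
rewrite -(bunion_addw x0 M e s) -(sum_wt_addw e s).
apply: hint_le_boxes => //.
- by rewrite all_addw.
- by rewrite pairwise_addw.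
- by rewrite bunion_addw.
- move=> b /has_addw /goods bs a ab; have [_] := bs a (bset_closedbox ab).
  by rewrite /= ler_norml => /andP[_ h1]; lra.
Qed.

Lemma grid_volume_le : dens * T <= fine (H K).
Proof. by rewrite -lee_fin -finK bunion_ge. Qed.

End OneGrid.

(** The witness does not involve the grid, so the defect survives when the accuracy [e] tends to 0.
    Taking [d = 0] gives the inequality itself. *)
Theorem hint_core : exists2 eta : R, 0 < eta &
  ((u - v)%:E * hint f K + (d * eta)%:E <= hint h L)%E.
Proof.
exists (dens * w0); first exact: mulr_gt0.
apply/lee_addgt0Pr => e e0; set hK := fine (H K); have hK0 : 0 <= hK by exact: HK0.
(* The oscillation on the grid enters both integrals and costs at most [e / 4] in each; the
   uncovered part of [K] costs at most [e / 2]. *)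
pose eps := e / (4 * (hK + 1)).
have hK1 : 0 < hK + 1 by rewrite ltr_wpDl.
have eps0 : 0 < eps by rewrite divr_gt0// mulr_gt0.
have F1 : 0 < F + 1 by rewrite ltr_wpDl.
(* The uncovered part must be small for two reasons: to leave volume [w0] in both caps, and to
   contribute at most [e / 2] under the bound [F]. *)
have bnd0 : 0 < Num.min (dens * w0) (e / (2 * (F + 1))).
  by rewrite lt_min mulr_gt0//= divr_gt0// mulr_gt0.
have [t [t0 t1 tK]] := @power_near_one R k.+1 hK _ hK0 bnd0.
have cpsi : continuous (fun a => f (phi a)).
  by move=> a; apply: continuous_comp; [exact: param_continuous|exact: cf].
have [s [ws ss goods cover]] := grid_exists fM rho0 B0 convK innerK boundK
  (ltW t0) t1 cpsi eps0.
have sK : bunion x0 M s `<=` K.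
  move: goods; rewrite /bunion; elim: {ws ss cover} s => [|b s' IH] good; first by rewrite big_nil.
  rewrite big_cons => x [[a ab <-]|].
    have := good b; rewrite /= subbox_refl => /(_ isT a (bset_closedbox ab)).
    by case.
  by apply: IH => c cs a ac; apply: good => //=; rewrite cs orbT.
have restE := body_measure_setD fM B0 boundK mK t0 sK cover.
have rest : (H (K `\` bunion x0 M s) <= (dens * w0)%:E)%E.
  apply: le_trans restE _; rewrite lee_fin (le_trans tK)//.
  by rewrite ge_min lexx.
have low := hint_ge_grid ws ss goods rest.
have up := hint_le_grid ws ss goods.
have vol_le := grid_volume_le ws ss goods.
set S := \sum_(b <- s) vol b * wt b in low up.
set T := \sum_(b <- s) vol b in low up vol_le.
have {}up : (hint f K <= (dens * (S + eps * T) + e / 2)%:E)%E.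
  apply: le_trans up _; rewrite EFinD leeD2l//.
  apply: (@le_trans _ _ (F%:E * (e / (2 * (F + 1)))%:E)%E).
    rewrite lee_wpmul2l ?lee_fin// (le_trans restE)// lee_fin (le_trans tK)//.
    by rewrite ge_min lexx orbT.
  have -> : (F%:E * (e / (2 * (F + 1)))%:E)%E = (e / 2 * (F / (F + 1)))%:E.
    by rewrite -EFinM; congr EFin; rewrite invfM; ring.
  rewrite lee_fin ler_piMr// ?divr_ge0 ?(ltW e0)//.
  by rewrite ler_pdivrMr// mul1r lerDl.
have uv0 : 0 <= u - v by rewrite subr_ge0.
apply: (@le_trans _ _ ((u - v) * (dens * (S + eps * T) + e / 2) + d * (dens * w0))%:E).
  by rewrite [leRHS]EFinD leeD2r// [leRHS]EFinM lee_wpmul2l// lee_fin.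
apply: (@le_trans _ _ ((dens * ((u - v) * S - eps * T + d * w0))%:E + e%:E)%E); last first.
  by rewrite leeD2r.
rewrite -EFinD lee_fin.
have h1 : eps * (dens * T) <= e / 4.
  apply: (@le_trans _ _ (eps * (hK + 1))).
    by rewrite ler_pM2l// (le_trans vol_le)// lerDl.
  have -> : eps * (hK + 1) = e / 4 * ((hK + 1) / (hK + 1)).
    by rewrite /eps invfM; ring.
  by rewrite divff ?gt_eqF// mulr1.
have h2 : 0 <= eps * (dens * T).
  have T_ge0 : 0 <= T by exact: sum_vol_ge0.
  by rewrite mulr_ge0 ?(ltW eps0)// mulr_ge0// ltW.
have uv1' : u - v <= 1.
  by rewrite -uv1 lerD2l (le_trans _ (ltW v0))// oppr_le0 ltW.
have h3 : (u - v) * (eps * (dens * T)) <= 1 * (eps * (dens * T)) by rewrite ler_wpM2r.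
have h4 : (u - v) * (e / 2) <= 1 * (e / 2) by rewrite ler_wpM2r// divr_ge0// ltW.
lra.
Qed.

End Core.

(** * Charts of convex bodies *)

Lemma convex_setP (R : realType) n (K : set 'rV[R]_n) x y t : convex_set K ->
  K x -> K y -> 0 <= t -> t <= 1 -> K (t *: x + (1 - t) *: y).
Proof.
move=> cK Kx Ky t0 t1; have := cK x y (Itv01 t0 t1).
by rewrite !inE => /(_ Kx Ky).
Qed.

Section AffineParametrization.
Variables (R : realType) (n : nat).
Implicit Types (K : set 'rV[R]_n) (x y z w : 'rV[R]_n).

(* Membership of [x + S (z - x)] in [K] is tracked through the pair [(S, z)], so
   that no division by a vanishing weight occurs. *)
Lemma convex_star_sum K x (I : Type) (s : seq I) (a : I -> R)
    (y : I -> 'rV[R]_n) (S : R) : convex_set K -> K x ->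
  (forall i, 0 <= a i) -> (forall i, K (x + y i)) ->
  \sum_(i <- s) a i <= S ->
  exists2 z, K z & \sum_(i <- s) a i *: y i = S *: (z - x).
Proof.
move=> cK Kx a0 Ky; elim: s S => [|i s IH] S.
  by rewrite !big_nil => _; exists x => //; rewrite subrr scaler0.
rewrite !big_cons => hS; have hS' : \sum_(j <- s) a j <= S - a i.
  by rewrite lerBrDl.
have [z Kz ->] := IH _ hS'.
have s0 : 0 <= \sum_(j <- s) a j by rewrite sumr_ge0.
have S0 : a i <= S by apply: le_trans hS; rewrite lerDl.
have [S0'|Sn0] := eqVneq S 0.
  exists x => //; have -> : a i = 0 by apply/le_anti; rewrite a0 -S0' S0.
  by rewrite S0' subr0 !scale0r addr0.
have Spos : 0 < S by rewrite lt_def Sn0 (le_trans (a0 i)).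
exists ((a i / S) *: (x + y i) + (1 - a i / S) *: z).
  apply: convex_setP => //; first by rewrite divr_ge0// ltW.
  by rewrite ler_pdivrMr// mul1r.
apply/rowP => j; rewrite !mxE; have := divfK Sn0 (a i).
set t := a i / S => <-; ring.
Qed.

Lemma dot_mulmx (y : 'rV[R]_n) m (c : 'rV[R]_m) (Y : 'M[R]_(m, n)) :
  dot (c *m Y) y = (c *m (Y *m y^T)) ord0 ord0.
Proof. by rewrite dotE mulmxA. Qed.

(** Replaces the affine hull by the row space of a basis matrix [N]. The last clause, minimality of
    this space, is what produces independent points of [K]. *)
Lemma affine_dim_matrix K k : affine_dim K k ->
  exists N : 'M[R]_(k, n), [/\ \rank N = k,
    (forall y z, K y -> K z -> (y - z <= N)%MS) &
    forall x m (W : 'M[R]_(m, n)), K x ->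
      (forall y, K y -> (y - x <= W)%MS) -> (N <= W)%MS].
Proof.
move=> [x0 [V [dV KV]]].
have Ksub y : K y -> exists2 v, v \in V & y = x0 + v.
  move=> Ky; have : affine_hull K y.
    exists 1%N, (fun=> 1), (fun=> y); rewrite !big_ord1 scale1r; split => //.
  by rewrite KV => -[v vV <-]; exists v.
pose X := vbasis V.
have szX : \dim V = k by [].
pose N : 'M[R]_(k, n) := \matrix_(i < k) X`_i.
have inV m (c : 'M[R]_(1, m)) (i : 'I_m -> 'rV[R]_n) :
    (forall j, i j \in V) -> c *m (\matrix_j i j) \in V.
  move=> iV; rewrite mulmx_sum_row memv_suml// => j _.
  by rewrite rowK memvZ.
have VN v : v \in V -> (v <= N)%MS.
  move=> vV; rewrite (coord_vbasis vV); apply/submxP.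
  exists (\row_j coord X (cast_ord (esym dV) j) v).
  rewrite mulmx_sum_row (reindex (cast_ord dV)) /=; last first.
    by exists (cast_ord (esym dV)) => j _; rewrite ?cast_ordK ?cast_ordKV.
  by apply: eq_bigr => j _; rewrite rowK mxE cast_ordK.
have NV (j : 'I_k) : X`_j \in V.
  by apply: vbasis_mem; rewrite mem_nth// size_tuple dV.
exists N; split.
- apply/eqP; rewrite -/(row_free N) -kermx_eq0; apply/rowV0P => c /sub_kermxP.
  rewrite mulmx_sum_row (reindex (cast_ord dV)) /=; last first.
    by exists (cast_ord (esym dV)) => j _; rewrite ?cast_ordK ?cast_ordKV.
  move=> c0; have /freeP/(_ (fun j => c ord0 (cast_ord dV j))) := basis_free (vbasisP V).
  move=> h; apply/rowP => j; rewrite mxE -[j](cast_ordKV dV); apply: h.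
  by rewrite -[RHS]c0; apply: eq_bigr => i _; rewrite rowK.
- move=> y z /Ksub[v1 v1V ->] /Ksub[v2 v2V ->].
  by rewrite opprD addrACA subrr add0r VN// memvB.
- move=> x m W Kx KW; apply/row_subP => j; rewrite rowK.
  have [v vV xE] := Ksub _ Kx.
  have : affine_hull K (x0 + (v + X`_j)).
    by rewrite KV; exists (v + X`_j) => //; rewrite /= memvD.
  move=> [p [a [y [a1 Ky e]]]].
  have -> : X`_j = \sum_(i < p) a i *: (y i - x).
    under eq_bigr do rewrite scalerBr.
    rewrite sumrB -scaler_suml a1 scale1r -e addrA -xE.
    by rewrite addrAC subrr add0r.
  by rewrite summx_sub// => i _; rewrite scalemx_sub// KW.
Qed.

(** Greedy extension: if no point of [K] left the span of the [j] rows found so far, minimality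
    would bound the rank of [N] by [j < k]. *)
Lemma independent_rows K (x : 'rV[R]_n) k (N : 'M[R]_(k, n)) j :
  \rank N = k ->
  (forall m (W : 'M[R]_(m, n)),
     (forall y, K y -> (y - x <= W)%MS) -> (N <= W)%MS) ->
  (j <= k)%N -> exists Y : 'M[R]_(j, n), row_free Y /\ forall i, K (x + row i Y).
Proof.
move=> rN NW; elim: j => [|j IH] jk.
  by exists 0; split => [|[]//]; rewrite /row_free -leqn0 rank_leq_row.
have [Y [fY KY]] := IH (ltnW jk).
have [y Ky yY] : exists2 y, K y & ~~ (y - x <= Y)%MS.
  apply: contrapT => h; suff /mxrankS : (N <= Y)%MS.
    by rewrite rN (eqP fY) leqNgt jk.
  apply: NW => y Ky; apply: contrapT => /negP h'; apply: h.
  by exists y.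
exists (col_mx (y - x) Y); split; last first.
  move=> i; case: (@split_ordP 1 j i) => i' ->.
    have -> : row (lshift j i') (col_mx (y - x) Y) = y - x.
      by rewrite rowKu row_id.
    by rewrite addrC subrK.
  have -> : row (rshift 1 i') (col_mx (y - x) Y) = row i' Y by exact: rowKd.
  exact: KY.
rewrite /row_free eqn_leq rank_leq_row /=.
have : (\rank Y < \rank (col_mx (y - x) Y))%N.
  apply: rank_ltmx; rewrite ltmxE; apply/andP; split.
    by rewrite -addsmxE addsmxSr.
  apply: contra yY => h; apply: submx_trans h.
  by rewrite -addsmxE addsmxSl.
by rewrite (eqP fY).
Qed.

(** Read off from the rank normal form of the column [c]. It serves to turn a linear form into the
    first coordinate of a chart. *)
Lemma unit_adapt k (c : 'cV[R]_k.+1) : c != 0 ->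
  exists P : 'M[R]_k.+1, P \in unitmx /\ P *m c = delta_mx ord0 ord0.
Proof.
move=> c0.
have rc : \rank c = 1%N.
  by apply/eqP; rewrite eqn_leq rank_leq_col lt0n mxrank_eq0.
have := mulmx_ebase c; rewrite rc => e.
pose s := row_ebase c ord0 ord0.
have s0 : s != 0.
  have := row_ebase_unit c; rewrite unitmxE det_mx11 unitfE; exact.
exists (s^-1 *: invmx (col_ebase c)); split.
  by rewrite unitmxZ ?unitfE ?invr_eq0// unitmx_inv col_ebase_unit.
rewrite -scalemxAl -{2}e -!mulmxA mulKmx ?col_ebase_unit//.
apply/colP => i; rewrite !mxE big_ord1 -/s.
rewrite !mxE eqxx /=; case: i => [[|i] hi] /=.
  by rewrite mul1r mulVf.
by rewrite !mul0r mulr0.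
Qed.

(** The first coordinate is adapted to [w], so that half-spaces orthogonal to [w] become coordinate
    half-spaces; this is possible because [p - q] lies in the direction space and is not orthogonal
    to [w]. The base point is interior to a simplex spanned by [q] and [k.+1] further points of
    [K]. *)
Lemma body_param K k (w : 'rV[R]_n) p q : convex_body K -> affine_dim K k.+1 ->
  K p -> K q -> dot q w < dot p w ->
  exists x0 (M : 'M[R]_(k.+1, n)) rho B,
  [/\ row_free M /\ 0 < rho, 0 < B,
      forall a, `|a| <= rho -> K (param x0 M a),
      forall y, K y -> exists2 a, `|a| <= B & param x0 M a = y &
      forall a, dot (param x0 M a) w = dot x0 w + a ord0 ord0].
Proof.
move=> [_ cK compK] /affine_dim_matrix[N [rN KN NW]] Kp Kq pq.
have [Y [fY KY]] := independent_rows rN (fun m W => NW q m W Kq) (leqnn _).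
have YN : (Y <= N)%MS.
  apply/row_subP => i; have := KN _ _ (KY i) Kq.
  by rewrite addrC addKr.
have NY : (N <= Y)%MS by rewrite -(mxrank_leqif_sup YN) rN (eqP fY).
have KY' y : K y -> (y - q <= Y)%MS by move=> Ky; exact: submx_trans (KN _ _ Ky Kq) NY.
have [P [uP Pw]] : exists P : 'M[R]_k.+1, P \in unitmx /\
    P *m (Y *m w^T) = delta_mx ord0 ord0.
  apply: unit_adapt; apply/eqP => Yw0.
  have /submxP[c pE] := KY' _ Kp.
  have : dot (p - q) w = 0 by rewrite pE dot_mulmx Yw0 mulmx0 mxE.
  by rewrite dotDl dotNl => /eqP; rewrite subr_eq0 => /eqP e; rewrite e ltxx in pq.
pose M := P *m Y.
have fM : row_free M by rewrite /row_free mxrankMfree// mxrank_unit.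
(* Coefficients [m / 2] perturbed by at most [m / 2] stay between 0 and [m], so the [k.+1] of them
   sum to at most 1. *)
pose m : R := k.+1%:R^-1.
have m0 : 0 < m by rewrite invr_gt0.
pose bary : 'rV[R]_k.+1 := const_mx (m / 2).
pose x0 := q + bary *m Y.
have [C [C0 hC]] := mulmx_bound P.
have [C' [C'0 hC']] := mulmx_bound (pinvmx M).
have [r [r0 hr]] : exists r : R, 0 < r /\ forall y, K y -> `|y| <= r.
  have /ex_strict_bound_gt0[r r0 hr] := compact_bounded compK.
  by exists r; split => // y Ky; apply/ltW/hr.
exists x0, M, (m / 2 / C), (C' * (r + `|x0|)); split.
- by split => //; rewrite !divr_gt0.
- by rewrite mulr_gt0// ltr_pwDl.
- move=> a aC.
  have aP : `|a *m P| <= m / 2.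
    by apply: le_trans (hC a) _; rewrite mulrC -ler_pdivlMr.
  pose c i := (bary + a *m P) ord0 i.
  have c0 i : 0 <= c i <= m.
    have := le_trans (coord_le_norm _ i) aP; rewrite ler_norml => /andP[h1 h2].
    by rewrite /c mxE [bary _ _]mxE; apply/andP; split; lra.
  have [||z Kz e] := @convex_star_sum K q _ (index_enum 'I_k.+1) c (fun i => row i Y) 1 cK Kq _ KY.
  + by move=> i; have /andP[] := c0 i.
  + apply: (@le_trans _ _ (\sum_(i < k.+1) m)).
      by apply: ler_sum => i _; have /andP[] := c0 i.
    by rewrite sumr_const card_ord -[leLHS]mulr_natr mulVf.
  suff -> : param x0 M a = z by [].
  rewrite /param /x0 /M mulmxA -addrA -mulmxDl mulmx_sum_row.
  by rewrite [X in q + X]e scale1r addrC subrK.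
- move=> y Ky; exists ((y - x0) *m pinvmx M).
    apply: le_trans (hC' _) _; rewrite ler_pM2l// (le_trans (ler_normB _ _))//.
    by rewrite lerD2r hr.
  rewrite /param mulmxKpV ?subrKC//.
  have YM : (Y <= M)%MS by rewrite /M eqmxMfull ?row_full_unit.
  apply: submx_trans YM; rewrite /x0 opprD addrA addmx_sub ?KY'//.
  by rewrite eqmx_opp submxMl.
- move=> a; rewrite /param dotDl; congr (_ + _).
  by rewrite dot_mulmx /M -mulmxA Pw mxE (bigD1 ord0)//= mxE eqxx mulr1 big1
    ?addr0// => i i0; rewrite mxE (negbTE i0) mulr0.
Qed.

End AffineParametrization.

(** * Integrals over reflected sets and segments *)

Section HintAlgebra.
Variables (R : realType) (n k : nat).
Implicit Types (f g : 'rV[R]_n -> R) (D : set 'rV[R]_n).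
Local Notation cara := (caratheodory_type (@hausdorff_outer R n k)).
Local Notation mu := (hausdorff_measure R n k).

Lemma eq_hint f g D : (forall x, D x -> f x = g x) -> hint k f D = hint k g D.
Proof.
move=> fg; apply: (@eq_integral _ cara R mu D (fun x => (g x)%:E) (fun x => (f x)%:E)).
by move=> x /set_mem Dx; rewrite fg.
Qed.

Lemma hintD f g D : hmeasurable k D -> continuous f -> (forall x, 0 <= f x) ->
  continuous g -> (forall x, 0 <= g x) ->
  (hint k (fun x => f x + g x)%R D = hint k f D + hint k g D)%E.
Proof.
move=> mD cf f0 cg g0.
apply: (@ge0_integralD _ cara R mu D mD (fun x => (f x)%:E) (fun x => (g x)%:E)).
- by move=> x _; rewrite lee_fin.
- by apply/measurable_EFinP; exact: continuous_measurable_cara.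
- by move=> x _; rewrite lee_fin.
- by apply/measurable_EFinP; exact: continuous_measurable_cara.
Qed.

Lemma hintZ f (c : R) D : hmeasurable k D -> continuous f -> (forall x, 0 <= f x) ->
  0 <= c -> (hint k (fun x => c * f x)%R D = c%:E * hint k f D)%E.
Proof.
move=> mD cf f0 c0.
apply: (@ge0_integralZl_EFin _ cara R mu D mD (fun x => (f x)%:E) _ _ c c0).
- by move=> x _; rewrite lee_fin.
- by apply/measurable_EFinP; exact: continuous_measurable_cara.
Qed.

Lemma hint_cst (c : R) D : hmeasurable k D ->
  (hint k (fun=> c) D = c%:E * @hausdorff_outer R n k D)%E.
Proof. by move=> mD; exact: (@integral_cst _ cara R mu D mD c%:E). Qed.

End HintAlgebra.

Section Reflection.
Variables (R : realType) (n k : nat) (c : 'rV[R]_n).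
Local Notation cara := (caratheodory_type (@hausdorff_outer R n k)).
Local Notation H := (@hausdorff_outer R n k).
Local Notation mu := (hausdorff_measure R n k).
Let r (x : 'rV[R]_n) := c - x.

Let rK : involutive r. Proof. by move=> x; rewrite /r opprB addrC subrK. Qed.

Lemma hausdorff_outer_reflection A : H (r @^-1` A) = H A.
Proof.
rewrite (_ : r @^-1` A = r @` A).
  apply: (@hausdorff_outer_isometry R n k r r A) => // x y.
  by rewrite /r opprB addrC addrA subrK -enormN opprB.
apply/seteqP; split => [x Ax|_ [x Ax <-]] /=; first by exists (r x).
by rewrite rK.
Qed.

(** Caratheodory's condition involves only the outer measure, which the reflection preserves; the
    test set is reflected along. *)
Lemma measurable_reflection : measurable_fun [set: cara] (r : cara -> cara).
Proof.
move=> _ A mA; rewrite setTI.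
suff : (H : {outer_measure set 'rV[R]_n -> \bar R}).-caratheodory (r @^-1` A) by [].
move=> X; rewrite -[X in X = _]/(H X).
rewrite -[X in _ = (X + _)%E]/(H _) -[X in _ = (_ + X)%E]/(H _).
have eH Y : H (r @^-1` Y) = H Y by exact: hausdorff_outer_reflection.
have hX : H (r @^-1` X) = (H (r @^-1` X `&` A) + H (r @^-1` X `&` ~` A))%E.
  exact: mA.
transitivity (H (r @^-1` X)); first by rewrite eH.
rewrite hX; congr (_ + _)%E.
  rewrite -[LHS]eH; congr H; apply/seteqP; split => x [] /=; rewrite rK.
    by move=> ? ?; split.
  by move=> ? ?; split => //; rewrite rK.
rewrite -[LHS]eH; congr H; apply/seteqP; split => x [] /=; rewrite rK.
  by move=> ? ?; split.
by move=> ? ?; split => //; rewrite rK.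
Qed.

Lemma hint_reflection (h : 'rV[R]_n -> R) (S : set 'rV[R]_n) : continuous h ->
  (forall x, 0 <= h x) -> hmeasurable k S ->
  hint k (fun x => h (r x)) (r @^-1` S) = hint k h S.
Proof.
move=> ch h0 mS; rewrite /hint.
have mh : measurable_fun (S : set cara) (fun x : cara => (h x)%:E).
  by apply/measurable_EFinP; exact: continuous_measurable_cara.
have h0' : {in S, forall y : cara, (0 <= (h y)%:E)%E} by move=> y _; rewrite lee_fin.
have <- := @ge0_integral_pushforward _ _ cara cara R r measurable_reflection mu S
  (fun x => (h x)%:E) mS mh h0'.
refine (@eq_measure_integral _ cara R _ _ _ _ _) => A mA _.
exact: hausdorff_outer_reflection.
Unshelve. all: exact: measurable_reflection.
Qed.

End Reflection.

Section Segment.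
Variables (R : realType) (n k : nat) (u : 'rV[R]_n).
Hypothesis u1 : enorm u = 1.
Local Notation H := (@hausdorff_outer R n k).

(** Each [x] is paired with its mirror image [c - x]: both lie on the ray of [u], so their norms add
    up to [a + b]. No one-dimensional integral has to be computed. *)
Lemma hint_segment (S : set 'rV[R]_n) (a b : R) : hmeasurable k S -> 0 <= a -> a <= b ->
  S = [set s *: u | s in `[a, b]%classic] ->
  (2%:E * hint k (@enorm R n) S = (a + b)%:E * H S)%E.
Proof.
move=> mS a0 ab SE.
pose c := (a + b) *: u.
have enc : continuous (@enorm R n) by exact: enorm_continuous.
have cn : continuous (fun x : 'rV[R]_n => enorm (c - x)).
  move=> x; apply: (@continuous_comp _ _ _ (fun y : 'rV[R]_n => c - y) (@enorm R n)).
    apply: (@continuousB _ _ _ (fun=> c) id); first exact: cst_continuous.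
    by move=> A.
  exact: enorm_continuous.
have Sr x : S x -> S (c - x).
  rewrite SE => -[s /=]; rewrite in_itv/= => /andP[h1 h2] <-.
  exists (a + b - s); last by rewrite scalerBl.
  by rewrite /= in_itv/=; apply/andP; split; lra.
have rS : [set x | S (c - x)] = S.
  apply/seteqP; split => x /=; last exact: Sr.
  by move=> /Sr; rewrite opprB addrC subrK.
have e1 := hint_reflection c enc (@enorm_ge0 _ _) mS; rewrite [_ @^-1` _]rS in e1.
have -> : (2%:E * hint k (@enorm R n) S =
    hint k (@enorm R n) S + hint k (fun x => enorm (c - x)) S)%E.
  by rewrite [X in (_ + X)%E]e1 -mule2n -mule_natl.
rewrite -(hintD mS enc (@enorm_ge0 _ _) cn (fun x => enorm_ge0 _)) -(hint_cst _ mS).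
apply: eq_hint => x; rewrite SE => -[s /=]; rewrite in_itv/= => /andP[h1 h2] <-.
have s0 : 0 <= s by lra.
have abs0 : 0 <= a + b - s by lra.
by rewrite -scalerBl !enormZ u1 !mulr1 !ger0_norm// addrC subrK.
Qed.

End Segment.

(** * Inequality and equality cases *)

(** Where the norm vanishes, the power is dominated by the norm itself, as the argument is at most 1
    nearby; elsewhere the power function is differentiable. *)
Lemma enorm_powR_continuous (R : realType) n (p : R) : 1 <= p ->
  continuous (fun x : 'rV[R]_n => enorm x `^ p).
Proof.
move=> p1 x; have [x0|x0] := eqVneq (enorm x) 0.
  apply/(@cvgrPdist_lt _ _ _ _ (nbhs_filter x)) => e e0.
  have p0 : p != 0 by rewrite gt_eqF// (lt_le_trans _ p1).
  rewrite x0 powR0//.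
  have /(@cvgrPdist_lt _ _ _ _ (nbhs_filter x)) := @enorm_continuous R n x.
  have me0 : 0 < Num.min e 1 by rewrite lt_min e0/=.
  move=> /(_ _ me0); apply: filterS => y; rewrite x0 !sub0r !normrN.
  rewrite !ger0_norm ?powR_ge0 ?enorm_ge0// lt_min => /andP[ye y1].
  have [y0|y0] := eqVneq (enorm y) 0; first by rewrite y0 powR0.
  apply: le_lt_trans ye; apply: ge1r_powR => //.
  by rewrite lt_def y0 enorm_ge0 (ltW y1).
have ex0 : 0 < enorm x by rewrite lt_def x0 enorm_ge0.
apply: (@continuous_comp _ _ _ (@enorm R n) (fun t => t `^ p)).
  exact: enorm_continuous.
apply: differentiable_continuous; apply/derivable1_diffP.
by apply: derivable_powR; rewrite in_itv/= ex0.
Qed.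

Section CapBox.
Variables (R : realType) (n k : nat) (x0 : 'rV[R]_n) (M : 'M[R]_(k.+1, n)).
Variables (K : set 'rV[R]_n) (rho : R).
Local Notation phi := (param x0 M).
Hypotheses (rho0 : 0 < rho)
  (convK : forall x y t, K x -> K y -> 0 <= t -> t <= 1 ->
     K (t *: x + (1 - t) *: y))
  (innerK : forall a, `|a| <= rho -> K (phi a)).

(** [a] may be a boundary point, so it is first moved towards the inner ball; the shrunk point then
    has a whole cube around it inside [K]. *)
Lemma cap_box a (e : R) : K (phi a) -> 0 < e -> exists Q : wbox R k.+1, wfbox Q /\
  forall b, bset Q b -> K (phi b) /\ `|b ord0 ord0 - a ord0 ord0| < e.
Proof.
move=> Ka e0; pose a0 : R := a ord0 ord0; pose q : R := `|a0| + rho.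
have q0 : 0 < q by rewrite ltr_wpDl.
(* From [a] to a point of the box the first coordinate changes by at most [s * q], where [q] is
   [rho] plus the size of [a0]; this is at most [e / 2]. *)
pose s : R := Num.min (1 / 2) (e / (2 * q)).
have s0 : 0 < s by rewrite lt_min !divr_gt0// mulr_gt0.
have s12 : s <= 1 / 2 by rewrite ge_min lexx.
have sq : s * q <= e / 2.
  have -> : e / 2 = (e / (2 * q)) * q by field; rewrite gt_eqF.
  by rewrite ler_pM2r// ge_min lexx orbT.
have sr0 : 0 < s * rho by rewrite mulr_gt0.
have cb (b : 'rV[R]_k.+1) : (forall i, (1 - s) * a ord0 i - s * rho <= b ord0 i <
    (1 - s) * a ord0 i + s * rho) -> `|b - (1 - s) *: a| <= s * rho.
  move=> hb; apply: rV_norm_le => [|i]; first exact: ltW.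
  by rewrite !mxE ler_norml; have /andP[h1 h2] := hb i; apply/andP; split; lra.
exists (WBox (fun i => (1 - s) * a ord0 i - s * rho)
  (fun i => (1 - s) * a ord0 i + s * rho) 0); split.
  by apply/forallP => i /=; lra.
move=> b /cb hb; split.
  apply: (shrink_neighborhood convK innerK (a := a) (t := 1 - s)) => //.
  - by lra.
  - by lra.
  - by rewrite subKr.
have := le_trans (coord_le_norm (b - (1 - s) *: a) ord0) hb; rewrite !mxE -/a0.
have h1 : s * `|a0| = `|s * a0| by rewrite normrM (gtr0_norm s0).
move: sq; rewrite /q mulrDr h1 => sq; rewrite ler_norml => /andP[h2 h3].
have h4 : s * a0 <= `|s * a0| by exact: ler_norm.
have h5 : - (s * a0) <= `|s * a0| by rewrite -normrN ler_norm.
by rewrite ltr_norml; apply/andP; split; lra.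
Qed.

End CapBox.

Section Body.
Variables (R : realType) (n k : nat) (K : set 'rV[R]_n).
Hypotheses (cK : convex_body K) (dK : affine_dim K k.+1).
Local Notation hint := (@hint R n k.+1).

Lemma convex_body_hmeasurable : hmeasurable k.+1 K.
Proof.
have [_ _ compK] := cK; apply: closed_measurable_cara.
by apply: compact_closed => //; exact: norm_hausdorff.
Qed.

Lemma minkowski_comb_compact (u v : R) :
  compact (minkowski_comb u K v (opp_set K)).
Proof.
have [_ _ compK] := cK.
pose g (z : 'rV[R]_n * 'rV[R]_n) := u *: z.1 + v *: - z.2.
have -> : minkowski_comb u K v (opp_set K) = [set g z | z in K `*` K].
  apply/seteqP; split => [_ [x Kx [_ [y Ky <-] <-]]|_ [[x y] [/= Kx Ky] <-]].
    by exists (x, y).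
  by exists x => //; exists (- y) => //; exists y.
apply: continuous_compact; last exact: compact_setX.
apply: continuous_subspaceT => z; apply: (@cvgD _ _ _ _ (nbhs_filter z)).
  by apply: (@cvgZl_tmp _ _ _ _ (nbhs_filter z)); exact: cvg_fst.
by apply: (@cvgZl_tmp _ _ _ _ (nbhs_filter z)); apply: (@cvgN _ _ _ _ (nbhs_filter z)); exact: cvg_snd.
Qed.

Lemma minkowski_comb_hmeasurable (u v : R) :
  hmeasurable k.+1 (minkowski_comb u K v (opp_set K)).
Proof.
apply: closed_measurable_cara; apply: compact_closed; first exact: norm_hausdorff.
exact: minkowski_comb_compact.
Qed.

End Body.

Lemma dot_continuous (R : realType) n (w : 'rV[R]_n) : continuous (fun x => dot x w).
Proof.
have dotn (x : 'rV[R]_n) : `|dot x w| <= enorm x * enorm w.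
  rewrite ler_norml dot_le andbT lerNl -dotNl.
  by apply: le_trans (dot_le _ _) _; rewrite enormN.
move=> x; apply/(@cvgrPdist_lt _ _ _ _ (nbhs_filter x)) => e e0.
pose C := enorm w + 1; have C0 : 0 < C by rewrite ltr_wpDl ?enorm_ge0.
have /(@cvgrPdist_lt _ _ _ _ (nbhs_filter x)) : enorm (x - y) @[y --> x] --> (0 : R).
  rewrite -[X in _ --> X](@enorm0 R n) -(subrr x).
  apply: (@continuous_comp _ _ _ (fun y : 'rV[R]_n => x - y) (@enorm R n)).
    by apply: (@continuousB _ _ _ (fun=> x) id); [exact: cst_continuous|move=> A].
  exact: enorm_continuous.
have eC : 0 < e / C by rewrite divr_gt0.
move=> /(_ _ eC); apply: filterS => y.
rewrite sub0r normrN ger0_norm ?enorm_ge0// ltr_pdivlMr// => xy.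
rewrite -dotNl -dotDl; apply: le_lt_trans (dotn _) _; apply: le_lt_trans xy.
by rewrite ler_wpM2l ?enorm_ge0// lerDl.
Qed.

Section BodyInequality.
Variables (R : realType) (n k : nat) (K : set 'rV[R]_n).
Hypotheses (cK : convex_body K) (dK : affine_dim K k.+1).
Local Notation hint := (@hint R n k.+1).

Lemma hint_body_lty (f : 'rV[R]_n -> R) p q w : K p -> K q -> dot q w < dot p w ->
  continuous f -> (forall x, 0 <= f x) -> (hint f K < +oo)%E.
Proof.
move=> Kp Kq pq cf f0; have [K0 _ compK] := cK.
have [F _ fF] := compact_EVT_max K0 compK (continuous_subspaceT cf).
have [x0 [M [rho [B [[fM rho0] B0 innerK boundK _]]]]] := body_param cK dK Kp Kq pq.
have mK := convex_body_hmeasurable k cK.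
have hfF : forall x, K x -> f x <= f F by move=> x Kx; apply: fF; exact/mem_set.
apply: (le_lt_trans (hint_le_cst cf f0 mK hfF)).
by rewrite lte_mul_pinfty ?lee_fin// (body_measure_finite fM B0 boundK).
Qed.

Section Inequality.
Variables u v : R.
Hypotheses (u0 : 0 < u) (v0 : 0 < v) (uv1 : u + v = 1) (vu : v <= u).
Let L := minkowski_comb u K v (opp_set K).
Variables f h : 'rV[R]_n -> R.
Hypotheses (cf : continuous f) (ch : continuous h)
  (f0 : forall x, 0 <= f x) (h0 : forall x, 0 <= h x).
Hypothesis fh : forall x y, K x -> K y -> u * f x - v * f y <= h (u *: x + v *: - y).
Variables p q w : 'rV[R]_n.
Hypotheses (Kp : K p) (Kq : K q) (pq : dot q w < dot p w).

Lemma hint_body_defect (s0 s1 d : R) : 0 <= d -> s0 < dot p w -> dot q w < s1 ->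
  (forall x y, K x -> K y -> s0 <= dot x w -> dot y w <= s1 ->
    u * f x - v * f y + d <= h (u *: x + v *: - y)) ->
  exists2 eta : R, 0 < eta &
    ((u - v)%:E * hint f K + (d * eta)%:E <= hint h L)%E.
Proof.
move=> d0 ps qs fhd; have [K0 cvK compK] := cK.
have [z _ fF] := compact_EVT_max K0 compK (continuous_subspaceT cf).
have [x0 [M [rho [B [[fM rho0] B0 innerK boundK phiw]]]]] := body_param cK dK Kp Kq pq.
have mK := convex_body_hmeasurable k cK.
have mL := minkowski_comb_hmeasurable k cK u v.
have hfF : forall x, K x -> f x <= f z by move=> x Kx; apply: fF; exact/mem_set.
have convK x y t : K x -> K y -> 0 <= t -> t <= 1 -> K (t *: x + (1 - t) *: y).
  exact: convex_setP.
have [a _ pE] := boundK _ Kp; have [b _ qE] := boundK _ Kq.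
have Ka : K (param x0 M a) by rewrite pE.
have Kb : K (param x0 M b) by rewrite qE.
have ep : 0 < dot p w - s0 by rewrite subr_gt0.
have eq0 : 0 < s1 - dot q w by rewrite subr_gt0.
have [Qp [wQp hQp]] := cap_box rho0 convK innerK Ka ep.
have [Qm [wQm hQm]] := cap_box rho0 convK innerK Kb eq0.
have phia := phiw a; rewrite pE in phia.
have phib := phiw b; rewrite qE in phib.
apply: (@hint_core R n k x0 M fM K rho B rho0 B0 convK innerK boundK mK u v
  u0 v0 uv1 vu mL f h (f z) cf ch f0 h0 hfF fh (s0 - dot x0 w) (s1 - dot x0 w)
  d Qp Qm) => //.
- move=> a' b' Ka' Kb' h1 h2; apply: fhd => //; rewrite phiw.
    by rewrite -lerBlDl.
  by rewrite -lerBrDl.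
- move=> c /hQp[Kc]; rewrite ltr_norml => /andP[h1 h2]; split => //; lra.
- move=> c /hQm[Kc]; rewrite ltr_norml => /andP[h1 h2]; split => //; lra.
Qed.

Lemma hint_body_le : ((u - v)%:E * hint f K <= hint h L)%E.
Proof.
have hp : dot p w - 1 < dot p w by lra.
have hq : dot q w < dot q w + 1 by lra.
have fhd x y : K x -> K y -> dot p w - 1 <= dot x w -> dot y w <= dot q w + 1 ->
    u * f x - v * f y + 0 <= h (u *: x + v *: - y).
  by move=> Kx Ky _ _; rewrite addr0; exact: fh.
by have [eta _] := hint_body_defect (lexx 0) hp hq fhd; rewrite mul0r adde0.
Qed.

(** On the compact product of the two closed caps the strict pointwise inequality has a positive
    minimal defect. *)
Lemma hint_body_lt (s0 s1 : R) : s0 < dot p w -> dot q w < s1 ->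
  (forall x y, K x -> K y -> s0 <= dot x w -> dot y w <= s1 ->
    u * f x - v * f y < h (u *: x + v *: - y)) ->
  ((u - v)%:E * hint f K < hint h L)%E.
Proof.
move=> ps qs fhlt; have [_ _ compK] := cK.
pose T := ('rV[R]_n * 'rV[R]_n)%type.
pose D (z : T) : R := h (u *: z.1 + v *: - z.2) - (u * f z.1 - v * f z.2).
have cdot : continuous (fun x : 'rV[R]_n => dot x w) by exact: dot_continuous.
pose S1 := K `&` [set x | s0 <= dot x w].
pose S2 := K `&` [set x | dot x w <= s1].
have cS1 : compact S1.
  apply: compact_closedI => //.
  apply: (@preimage_closed _ _ (fun x : 'rV[R]_n => dot x w) [set t : R | s0 <= t]).
    by move=> x _; exact: cdot.
  exact: closed_ge.
have cS2 : compact S2.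
  apply: compact_closedI => //.
  apply: (@preimage_closed _ _ (fun x : 'rV[R]_n => dot x w) [set t : R | t <= s1]).
    by move=> x _; exact: cdot.
  exact: closed_le.
have cS : compact (S1 `*` S2) by exact: compact_setX.
have S0 : (S1 `*` S2) !=set0.
  by exists (p, q); split; split => //=; exact: ltW.
have cD : continuous D.
  move=> z; apply: (@cvgB _ _ _ _ (nbhs_filter z)).
    apply: (@continuous_comp _ _ _ (fun z : T => u *: z.1 + v *: - z.2) h); last exact: ch.
    apply: (@cvgD _ _ _ _ (nbhs_filter z)).
      by apply: (@cvgZl_tmp _ _ _ _ (nbhs_filter z)); exact: cvg_fst.
    by apply: (@cvgZl_tmp _ _ _ _ (nbhs_filter z)); apply: (@cvgN _ _ _ _ (nbhs_filter z)); exact: cvg_snd.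
  apply: (@cvgB _ _ _ _ (nbhs_filter z)).
    apply: (@cvgMl_tmp _ _ _ (nbhs_filter z)).
    by apply: (@continuous_comp _ _ _ (@fst _ _) f); [exact: cvg_fst|exact: cf].
  apply: (@cvgMl_tmp _ _ _ (nbhs_filter z)).
  by apply: (@continuous_comp _ _ _ (@snd _ _) f); [exact: cvg_snd|exact: cf].
have [c + cmin] := compact_EVT_min S0 cS (continuous_subspaceT cD).
rewrite inE => -[[Kc1 c1] [Kc2 c2]].
have Dc : 0 < D c by rewrite subr_gt0; exact: fhlt.
have fhd x y : K x -> K y -> s0 <= dot x w -> dot y w <= s1 ->
    u * f x - v * f y + D c <= h (u *: x + v *: - y).
  move=> Kx Ky h1 h2; have := cmin (x, y).
  rewrite inE => /(_ (conj (conj Kx h1) (conj Ky h2))).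
  by rewrite [X in _ <= X]/D /= lerBrDl.
have [eta eta0 etaE] := hint_body_defect (ltW Dc) ps qs fhd.
apply: lt_le_trans etaE; rewrite lteDl ?lte_fin ?mulr_gt0//.
(* Adding a positive amount gives strictness only for a finite integral. *)
have fin : hint f K \is a fin_num.
  by rewrite ge0_fin_numE ?(hint_body_lty Kp Kq pq cf f0)// hint_ge0.
by rewrite fin_numM.
Qed.

End Inequality.
End BodyInequality.

(** * The inequality and its strict cases for [0 < lambda <= 1 / 2] *)

Section Half.
Variables (R : realType) (n k : nat) (K : set 'rV[R]_n).
Hypotheses (cK : convex_body K) (dK : affine_dim K k.+1).
Variable lambda : R.
Hypotheses (l0 : 0 < lambda) (l12 : lambda <= 1 / 2).
Local Notation hint := (@hint R n k.+1).
Local Notation L := (minkowski_comb (1 - lambda) K lambda (opp_set K)).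
Local Notation mu := (1 - 2 * lambda).

Lemma two_points : exists p q, [/\ K p, K q & p != q].
Proof.
have [[x Kx] _ _] := cK; have [N [rN _ NW]] := affine_dim_matrix dK.
have [y [Ky yx]] : exists y, K y /\ y != x.
  apply: contrapT => h; have : (N <= (0 : 'M[R]_(1, n)))%MS.
    apply: (NW x) => // y Ky; suff -> : y = x by rewrite subrr sub0mx.
    by apply/eqP; apply: contrapT => yx; apply: h; exists y; split => //; exact/negP.
  by move=> /mxrankS; rewrite rN mxrank0.
by exists y, x.
Qed.

Lemma two_points_dot : exists p q w, [/\ K p, K q & dot q w < dot p w].
Proof.
have [p [q [Kp Kq pq]]] := two_points.
exists p, q, (p - q); split => //; rewrite -subr_gt0 -dotNl -dotDl -sqr_enorm.
by rewrite exprn_gt0// lt_def enorm_ge0 enorm_eq0 subr_eq0 pq.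
Qed.

Section Exponent.
Variable p : R.
Hypothesis p1 : 1 <= p.
Local Notation N := (fun x : 'rV[R]_n => enorm x `^ p).
(** The factor of the pointwise bound is absorbed into [f], which then has the form required by the
    comparison; the remaining power of [mu] is the difference of the two weights. *)
Let f x := mu `^ (p - 1) * N x.

Let cN : continuous N. Proof. exact: enorm_powR_continuous. Qed.
Let N0 x : 0 <= N x. Proof. exact: powR_ge0. Qed.
Let cf : continuous f.
Proof.
by move=> x; apply: (@cvgMl_tmp _ _ _ (nbhs_filter x)); exact: cN.
Qed.
Let f0 x : 0 <= f x. Proof. by rewrite mulr_ge0 ?powR_ge0. Qed.
Let u0 : 0 < 1 - lambda. Proof. by move: l0 l12; lra. Qed.
Let uv1 : 1 - lambda + lambda = 1. Proof. by rewrite subrK. Qed.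
Let vu : lambda <= 1 - lambda. Proof. by move: l0 l12; lra. Qed.
Let mu0 : 0 <= mu. Proof. by move: l0 l12; lra. Qed.

Let fE x y : (1 - lambda) * f x - lambda * f y =
  mu `^ (p - 1) * ((1 - lambda) * N x - lambda * N y).
Proof. by rewrite /f; ring. Qed.

Let fh x y : K x -> K y ->
  (1 - lambda) * f x - lambda * f y <= N ((1 - lambda) *: x + lambda *: - y).
Proof. by move=> _ _; rewrite fE; exact: enorm_powR_defect. Qed.

Let hintfE : ((mu `^ p)%:E * hint N K = (1 - lambda - lambda)%:E * hint f K)%E.
Proof.
rewrite (hintZ (convex_body_hmeasurable k cK) cN N0 (powR_ge0 _ _)) muleA -EFinM.
have -> : 1 - lambda - lambda = mu by ring.
by rewrite mulr_powRB1// (lt_le_trans _ p1).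
Qed.

Lemma hint_minkowski_le : ((mu `^ p)%:E * hint N K <= hint N L)%E.
Proof.
have [x [y [w [Kx Ky xy]]]] := two_points_dot.
rewrite hintfE.
exact: (hint_body_le cK dK u0 l0 uv1 vu cf cN f0 N0 fh Kx Ky xy).
Qed.

Lemma hint_minkowski_lt x y w (s0 s1 : R) : K x -> K y -> dot y w < dot x w ->
  s0 < dot x w -> dot y w < s1 ->
  (forall x y, K x -> K y -> s0 <= dot x w -> dot y w <= s1 ->
    mu `^ (p - 1) * ((1 - lambda) * N x - lambda * N y) <
    N ((1 - lambda) *: x + lambda *: - y)) ->
  ((mu `^ p)%:E * hint N K < hint N L)%E.
Proof.
move=> Kx Ky xy xs ys lt; rewrite hintfE.
apply: (hint_body_lt cK dK u0 l0 uv1 vu cf cN f0 N0 fh Kx Ky xy xs ys).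
by move=> x' y' Kx' Ky' h1 h2; rewrite fE; exact: lt.
Qed.

(** The pointwise bound is strict for any two distinct points, so disjoint caps suffice; the
    thresholds lie on different sides of the midpoint [m]. *)
Lemma hint_minkowski_lt_powR : 1 < p -> ((mu `^ p)%:E * hint N K < hint N L)%E.
Proof.
move=> p1'; have [x [y [w [Kx Ky xy]]]] := two_points_dot.
pose m := (dot x w + dot y w) / 2.
have h1 : (m + dot x w) / 2 < dot x w by rewrite /m; lra.
have h2 : dot y w < (m + dot y w) / 2 by rewrite /m; lra.
apply: (hint_minkowski_lt Kx Ky xy h1 h2) => x' y' _ _ h3 h4.
apply: enorm_powR_defect_lt => //; apply/eqP => e; move: h3 h4; rewrite e /m; lra.
Qed.

End Exponent.

Local Notation N := (fun x : 'rV[R]_n => enorm x `^ 1).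

(** Halving the two values gives caps that stay strictly on their sides of the hyperplane orthogonal
    to [w]. *)
Lemma hint_minkowski_lt_sign x y w : K x -> K y -> 0 < dot x w -> dot y w < 0 ->
  ((mu `^ 1)%:E * hint N K < hint N L)%E.
Proof.
move=> Kx Ky xw yw.
have xy : dot y w < dot x w by exact: lt_trans xw.
have h1 : dot x w / 2 < dot x w by lra.
have h2 : dot y w < dot y w / 2 by lra.
apply: (hint_minkowski_lt (lexx 1) Kx Ky xy h1 h2) => x' y' _ _ h3 h4.
rewrite subrr powRr0 mul1r !powRr1 ?enorm_ge0//.
by apply: (@enorm_reflection_defect_lt _ _ _ l0 l12 x' y' w); lra.
Qed.

(** A nonzero [x] in [K] and a [y] off its line are separated by the hyperplane orthogonal to the
    difference of their unit vectors, by the strict Cauchy-Schwarz inequality. *)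
Lemma hint_minkowski_lt_nonline :
  ~ (exists u : 'rV[R]_n, enorm u = 1 /\ K `<=` [set` <[u]>%VS]) ->
  ((mu `^ 1)%:E * hint N K < hint N L)%E.
Proof.
move=> nl; have [x [Kx x0]] : exists x, K x /\ x != 0.
  have [x [y [Kx Ky xy]]] := two_points; have [x0|] := eqVneq x 0; last by exists x.
  by exists y; split => //; rewrite -x0 eq_sym.
have ex0 : 0 < enorm x by rewrite lt_def enorm_ge0 enorm_eq0 x0.
have [y [Ky yx]] : exists y, K y /\ y \notin <[x]>%VS.
  apply: contrapT => h; apply: nl; exists ((enorm x)^-1 *: x); split.
    by rewrite enormZ gtr0_norm ?invr_gt0// mulVf// gt_eqF.
  move=> y Ky /=; have /vlineP[c ->] : y \in <[x]>%VS.
    by apply: contrapT => yx; apply: h; exists y; split => //; exact/negP.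
  apply/vlineP; exists (c * enorm x).
  by rewrite scalerA mulfK// gt_eqF.
have y0 : y != 0 by apply: contraNneq yx => ->; rewrite mem0v.
have ey0 : 0 < enorm y by rewrite lt_def enorm_ge0 enorm_eq0 y0.
have cs : dot x y < enorm x * enorm y.
  rewrite lt_def dot_le andbT; apply: contraNneq yx => e.
  have := cauchy_schwarz_defect x y; rewrite e subrr mulr0 => /eqP.
  rewrite sqrf_eq0 enorm_eq0 subr_eq0 => /eqP h.
  apply/vlineP; exists (enorm y / enorm x).
  by rewrite mulrC -scalerA h scalerA mulVf ?scale1r// gt_eqF.
pose w := (enorm x)^-1 *: x - (enorm y)^-1 *: y.
apply: (@hint_minkowski_lt_sign x y w Kx Ky).
  rewrite /w dotDr dotNr !dotZr -sqr_enorm expr2 mulKf ?gt_eqF// subr_gt0.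
  by rewrite mulrC ltr_pdivrMr.
rewrite /w dotDr dotNr !dotZr -sqr_enorm expr2 mulKf ?gt_eqF// subr_lt0.
by rewrite mulrC ltr_pdivrMr// dotC mulrC.
Qed.

End Half.

(** * Bodies on a line through the origin, [p = 1] *)

Section Line.
Variables (R : realType) (n k : nat) (K : set 'rV[R]_n).
Hypotheses (cK : convex_body K) (dK : affine_dim K k.+1).
Variable lambda : R.
Hypotheses (l0 : 0 < lambda) (l12 : lambda <= 1 / 2).
Local Notation hint := (@hint R n k.+1).
Local Notation H := (@hausdorff_outer R n k.+1).
Local Notation L := (minkowski_comb (1 - lambda) K lambda (opp_set K)).
Local Notation mu := (1 - 2 * lambda).
Local Notation N := (fun x : 'rV[R]_n => enorm x `^ 1).

Definition usegment (u : 'rV[R]_n) (a b : R) : set 'rV[R]_n :=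
  [set s *: u | s in `[a, b]%classic].

Lemma usegmentN u a b : usegment (- u) a b = usegment u (- b) (- a).
Proof.
apply/seteqP; split => [_ [s /= + <-]|_ [s /= + <-]];
    rewrite in_itv/= => /andP[h1 h2]; exists (- s).
- by rewrite /= in_itv/= !lerN2 h1 h2.
- by rewrite scalerN scaleNr.
- by rewrite /= in_itv/= lerNr h2 lerNl h1.
- by rewrite scalerN scaleNr opprK.
Qed.

Lemma body_usegment u : enorm u = 1 -> K `<=` [set` <[u]>%VS] ->
  exists a b, a < b /\ K = usegment u a b.
Proof.
move=> u1 Ku; have [K0 cvK compK] := cK.
have duu : dot u u = 1 by rewrite -sqr_enorm u1 expr1n.
have KE x : K x -> x = dot x u *: u.
  by move=> /Ku /= /vlineP[c ->]; rewrite dotZl duu mulr1.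
have cdot : continuous (fun x : 'rV[R]_n => dot x u) by exact: dot_continuous.
have [xa + amin] := compact_EVT_min K0 compK (continuous_subspaceT cdot).
have [xb + bmax] := compact_EVT_max K0 compK (continuous_subspaceT cdot).
rewrite !inE => Kb Ka; pose a := dot xa u; pose b := dot xb u.
have ab x : K x -> a <= dot x u <= b.
  by move=> Kx; rewrite amin ?bmax//; exact/mem_set.
have lt_ab : a < b.
  have [x [y [Kx Ky xy]]] := two_points cK dK.
  rewrite lt_neqAle; have /andP[h1 h2] := ab _ Kb; rewrite h1 andbT.
  apply/eqP => e; move/eqP: xy; apply; rewrite (KE _ Kx) (KE _ Ky).
  have /andP[h3 h4] := ab _ Kx; have /andP[h5 h6] := ab _ Ky.
  by congr (_ *: _); apply/eqP; rewrite eq_le; apply/andP; split; lra.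
exists a, b; split => //; apply/seteqP; split => [x Kx|_ [s /= + <-]].
  by exists (dot x u); [rewrite /= in_itv/= ab|rewrite -KE].
rewrite in_itv/= => /andP[as' sb]; have ba : 0 < b - a by rewrite subr_gt0.
pose t := (b - s) / (b - a).
have t0 : 0 <= t by rewrite divr_ge0 ?subr_ge0// ltW.
have t1 : t <= 1 by rewrite ler_pdivrMr// mul1r lerD2l lerN2.
have := convex_setP cvK Ka Kb t0 t1; rewrite (KE _ Ka) (KE _ Kb) -/a -/b.
rewrite !scalerA -scalerDl; congr (K (_ *: _)).
by rewrite /t; field; rewrite gt_eqF.
Qed.

Section Segment.
Variables (u : 'rV[R]_n) (a b : R).
Hypotheses (u1 : enorm u = 1) (ab : a < b) (Kab : K = usegment u a b).
Let lo : R := (1 - lambda) * a - lambda * b.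
Let hi : R := (1 - lambda) * b - lambda * a.

Lemma minkowski_usegment : L = usegment u lo hi.
Proof.
have u0 : 0 < 1 - lambda by move: l0 l12; lra.
apply/seteqP; split => [_ [x + [_ [y + <-] <-]]|_ [s /= + <-]].
  rewrite {1}Kab => -[s /= + <-]; rewrite in_itv/= => /andP[h1 h2].
  rewrite {1}Kab => -[t /= + <-]; rewrite in_itv/= => /andP[h3 h4].
  exists ((1 - lambda) * s - lambda * t); last first.
    by rewrite scalerN !scalerA scalerBl.
  rewrite /= in_itv/= /lo /hi lerB ?ler_pM2l//=.
  by rewrite lerB ?ler_pM2l.
rewrite in_itv/= /lo /hi => /andP[h1 h2].
pose t := (s - lo) / (b - a).
have ba : 0 < b - a by rewrite subr_gt0.
have t0 : 0 <= t by rewrite divr_ge0 ?subr_ge0// ltW.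
have t1 : t <= 1 by rewrite ler_pdivrMr// mul1r /lo; lra.
have tba : t * (b - a) = s - lo by rewrite /t divfK// gt_eqF.
have tba0 : 0 <= t * (b - a) by rewrite mulr_ge0// ltW.
have tba1 : t * (b - a) <= b - a by rewrite ler_piMl// ltW.
exists ((a + t * (b - a)) *: u).
  rewrite Kab; exists (a + t * (b - a)) => //=.
  by rewrite in_itv/=; apply/andP; split; lra.
exists (- ((b - t * (b - a)) *: u)).
  exists ((b - t * (b - a)) *: u) => //.
  rewrite Kab; exists (b - t * (b - a)) => //=.
  by rewrite in_itv/=; apply/andP; split; lra.
rewrite scalerN !scalerA -scalerBl; congr (_ *: _).
have -> : (1 - lambda) * (a + t * (b - a)) - lambda * (b - t * (b - a)) =
  lo + t * (b - a) by rewrite /lo; ring.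
by rewrite tba; ring.
Qed.

Lemma lt_lo_hi : lo < hi.
Proof.
rewrite -subr_gt0; have -> : hi - lo = b - a by rewrite /hi /lo; ring.
by rewrite subr_gt0.
Qed.

(** The affine hull of a nondegenerate segment contains the whole line, so a relative neighbourhood
    of the origin extends to both sides of it. *)
Lemma relint_usegment c d : c < d -> relint (usegment u c d) 0 -> c < 0 < d.
Proof.
move=> cd [_ /nbhs_ballP[e /= e0 eS]].
pose S := usegment u c d.
have hull s : affine_hull S (s *: u).
  pose t := (d - s) / (d - c).
  have dc : d - c != 0 by rewrite subr_eq0 gt_eqF.
  exists 2%N, (fun i => if i == ord0 then t else 1 - t),
    (fun i => if i == ord0 then c *: u else d *: u); split.
  - by rewrite !big_ord_recl big_ord0 /= addr0 subrKC.
  - move=> i; case: ifP => _; [exists c|exists d] => //=.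
      by rewrite in_itv/= lexx ltW.
    by rewrite in_itv/= lexx ltW.
  - rewrite !big_ord_recl big_ord0 /= addr0 !scalerA -scalerDl; congr (_ *: _).
    by rewrite /t; field.
have near (s : R) : `|s| < e -> c <= s <= d.
  move=> se; have /eS/(_ (hull s))[r /= + ru] : ball (0 : 'rV[R]_n) e (s *: u).
    rewrite -ball_normE /= sub0r normrN; apply: le_lt_trans (mxnorm_le_enorm _) _.
    by rewrite enormZ u1 mulr1.
  rewrite in_itv/=; suff -> : r = s by [].
  apply/eqP; rewrite -subr_eq0 -normr_eq0 -[`|_|]mulr1 -u1 -enormZ scalerBl ru.
  by rewrite subrr enorm0.
have e2 : `|e / 2| < e by rewrite gtr0_norm ?divr_gt0//; lra.
have e2' : `|- (e / 2)| < e by rewrite normrN.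
have /andP[h1 h2] := near _ e2; have /andP[h3 h4] := near _ e2'.
by apply/andP; split; lra.
Qed.

Lemma usegment_relint c d : c < 0 < d -> relint (usegment u c d) 0.
Proof.
move=> /andP[c0 d0]; split.
  by exists 0; rewrite ?scale0r//= in_itv/= !ltW.
pose e := Num.min (- c) d; have e0 : 0 < e by rewrite lt_min oppr_gt0 c0.
have /(@cvgrPdist_lt _ _ _ _ (nbhs_filter _))/(_ _ e0) := @enorm_continuous R n 0.
apply: filterS => y; rewrite enorm0 sub0r normrN ger0_norm ?enorm_ge0// => ye.
move=> [m [c' [x [_ xS yE]]]].
have [s yu] : exists s, y = s *: u.
  rewrite {}yE {ye}.
  exists (\sum_(i < m) c' i * dot (x i) u); rewrite scaler_suml.
  apply: eq_bigr => i _; have [r _ <-] := xS i.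
  by rewrite dotZl -sqr_enorm u1 expr1n mulr1 scalerA.
exists s => //=; move: ye; rewrite yu enormZ u1 mulr1 lt_min => /andP[h1 h2].
have h3 := ler_norm s; have h4 := ler_norm (- s); rewrite normrN in h4.
by rewrite in_itv/=; apply/andP; split; lra.
Qed.

(* The pointwise bound [(1 - lambda) |x| - lambda |y|] is negative for [x] near
   [a u] and [y] near [b u], hence not attained there. *)
Lemma hint_minkowski_lt_line_ge0 : 0 <= a -> lo < 0 ->
  ((mu `^ 1)%:E * hint N K < hint N L)%E.
Proof.
move=> a0 lo0.
have duu : dot u u = 1 by rewrite -sqr_enorm u1 expr1n.
have Ka : K (a *: u) by rewrite Kab; exists a => //=; rewrite in_itv/= lexx ltW.
have Kb : K (b *: u) by rewrite Kab; exists b => //=; rewrite in_itv/= lexx ltW.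
have da : dot (a *: u) (- u) = - a by rewrite dotNr dotZl duu mulr1.
have db : dot (b *: u) (- u) = - b by rewrite dotNr dotZl duu mulr1.
have h1 : dot (b *: u) (- u) < dot (a *: u) (- u) by rewrite da db ltrN2.
(* The margin [lo / 2] works because [s <= a - lo / 2] and [t >= b + lo / 2] give [(1 - lambda) * s
   - lambda * t <= lo / 2 < 0]. *)
have h2 : - a + lo / 2 < dot (a *: u) (- u) by rewrite da; lra.
have h3 : dot (b *: u) (- u) < - b - lo / 2 by rewrite db; lra.
apply: (hint_minkowski_lt cK dK l0 l12 (lexx 1) Ka Kb h1 h2 h3) => x y.
rewrite {1 2}Kab => -[s /= + <-]; rewrite in_itv/= => /andP[as' sb].
move=> -[t /= + <-]; rewrite in_itv/= => /andP[at' tb].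
rewrite !dotNr !dotZl duu !mulr1 => h4 h5.
rewrite subrr powRr0 mul1r !powRr1 ?enorm_ge0//.
rewrite scalerN !scalerA -scalerBl !enormZ u1 !mulr1.
have s0 : 0 <= s by exact: le_trans as'.
have t0 : 0 <= t by exact: le_trans at'.
rewrite (ger0_norm s0) (ger0_norm t0).
have u0 : 0 <= 1 - lambda by move: l0 l12; lra.
have h6 : (1 - lambda) * s <= (1 - lambda) * (a - lo / 2).
  by rewrite ler_wpM2l//; lra.
have h7 : lambda * (b + lo / 2) <= lambda * t.
  by rewrite ler_wpM2l ?(ltW l0)//; lra.
have loE : lo = (1 - lambda) * a - lambda * b by [].
have r0 : (1 - lambda) * s - lambda * t < 0.
  by move: h6 h7; rewrite mulrBr mulrDr loE; lra.
by rewrite ltr0_norm//; lra.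
Qed.

(** As [lo = mu * a - lambda * (b - a)], the hypothesis forces [a >= 0], so the midpoint formula
    applies to both segments; their measures agree by translation, and [lo + hi = mu * (a + b)]. *)
Lemma hint_minkowski_line_eq : 0 <= lo -> hint N L = ((mu `^ 1)%:E * hint N K)%E.
Proof.
move=> lo0.
have u0 : 0 <= 1 - 2 * lambda by move: l0 l12; lra.
have a0 : 0 <= a.
  rewrite leNgt; apply/negP => an.
  have lb : 0 < lambda * (b - a) by rewrite mulr_gt0 ?subr_gt0.
  have : 0 < (1 - 2 * lambda) * a by move: lo0; rewrite /lo; lra.
  by rewrite ltNge nmulr_lle0// u0.
have mK := convex_body_hmeasurable k cK.
have mL := minkowski_comb_hmeasurable k cK (1 - lambda) lambda.
have eN D : hint N D = hint (@enorm R n) D.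
  by apply: eq_hint => x _; rewrite powRr1 ?enorm_ge0.
have HE : H L = H K.
  have hl : hi = lo + b - a by rewrite /hi /lo; ring.
  rewrite minkowski_usegment Kab; move: (lo) (hi) hl => l h ->; pose c := (l - a) *: u.
  have -> : usegment u l (l + b - a) = [set c + x | x in usegment u a b].
    apply/seteqP; split => [_ [s /= + <-]|_ [_ [s /= + <-] <-]]; rewrite in_itv/= => /andP[h1 h2].
      exists ((s - l + a) *: u); last by rewrite -scalerDl; congr (_ *: _); ring.
      exists (s - l + a) => //=; rewrite in_itv/=.
      by apply/andP; split; lra.
    exists (l - a + s); last by rewrite scalerDl.
    by rewrite /= in_itv/=; apply/andP; split; lra.
  apply: (@hausdorff_outer_isometry R n k.+1 _ (fun x => x - c)).
  - by move=> x y; rewrite opprD addrACA subrr add0r.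
  - by move=> x; rewrite addrC addKr.
  - by move=> x; rewrite addrC subrK.
have sK := hint_segment u1 mK a0 (ltW ab) Kab.
have sL := hint_segment u1 mL lo0 (ltW lt_lo_hi) minkowski_usegment.
rewrite !eN powRr1//.
have : (2%:E * hint (@enorm R n) L = 2%:E * (mu%:E * hint (@enorm R n) K))%E.
  rewrite sL HE muleCA sK muleA -EFinM; congr (_%:E * _)%E.
  by rewrite /lo /hi; ring.
move=> /(congr1 (fun z => (2^-1)%:E * z)%E); rewrite !muleA -!EFinM.
by rewrite -[(2^-1 * 2 * _)%R]mulrA !(mulVf, mul1r, mulKf)// !mul1e.
Qed.

End Segment.
End Line.

Section HalfRange.
Variables (R : realType) (n k : nat).
Local Notation hint := (@hint R n k.+1).

Section LineEquality.
Variable K : set 'rV[R]_n.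
Hypotheses (cK : convex_body K) (dK : affine_dim K k.+1).
Variable lambda : R.
Hypotheses (l0 : 0 < lambda) (l12 : lambda <= 1 / 2).
Local Notation L := (minkowski_comb (1 - lambda) K lambda (opp_set K)).
Local Notation mu := (1 - 2 * lambda).
Local Notation N := (fun x : 'rV[R]_n => enorm x `^ 1).
Variables (u : 'rV[R]_n) (a b : R).
Hypotheses (u1 : enorm u = 1) (ab : a < b) (Kab : K = usegment u a b).

Let uN1 : enorm (- u) = 1. Proof. by rewrite enormN. Qed.
Let abN : - b < - a. Proof. by rewrite ltrN2. Qed.
Let KabN : K = usegment (- u) (- b) (- a).
Proof. by rewrite usegmentN !opprK. Qed.
Let loN : (1 - lambda) * - b - lambda * - a = - ((1 - lambda) * b - lambda * a).
Proof. by ring. Qed.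

(** If [K] lies on one side of the origin, [u] may be replaced by [- u] to make its coordinates
    nonnegative; otherwise the two endpoints have opposite signs. *)
Lemma hint_minkowski_lt_line :
  (1 - lambda) * a - lambda * b < 0 < (1 - lambda) * b - lambda * a ->
  ((mu `^ 1)%:E * hint N K < hint N L)%E.
Proof.
move=> /andP[lo0 hi0]; have [a0|a0] := leP 0 a.
  exact: (hint_minkowski_lt_line_ge0 cK dK l0 l12 u1 ab Kab a0 lo0).
have [b0|b0] := leP b 0.
  have hN : (1 - lambda) * - b - lambda * - a < 0 by rewrite loN oppr_lt0.
  apply: (hint_minkowski_lt_line_ge0 cK dK l0 l12 uN1 abN KabN) => //.
  by rewrite oppr_ge0.
have duu : dot u u = 1 by rewrite -sqr_enorm u1 expr1n.
apply: (@hint_minkowski_lt_sign _ _ _ _ cK dK _ l0 l12 (b *: u) (a *: u) u).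
- by rewrite Kab; exists b => //=; rewrite in_itv/= lexx ltW.
- by rewrite Kab; exists a => //=; rewrite in_itv/= lexx ltW.
- by rewrite dotZl duu mulr1.
- by rewrite dotZl duu mulr1.
Qed.

Lemma hint_minkowski_eq_line :
  ~ (1 - lambda) * a - lambda * b < 0 < (1 - lambda) * b - lambda * a ->
  hint N L = ((mu `^ 1)%:E * hint N K)%E.
Proof.
move=> /negP; rewrite negb_and -!leNgt => /orP[h|h].
  exact: (hint_minkowski_line_eq k cK l0 l12 u1 ab Kab h).
apply: (hint_minkowski_line_eq k cK l0 l12 uN1 abN KabN).
by rewrite loN oppr_ge0.
Qed.

End LineEquality.

Theorem hint_minkowski_half (K : set 'rV[R]_n) (p lambda : R) :
  convex_body K -> affine_dim K k.+1 -> 1 <= p -> 0 <= lambda <= 1 / 2 ->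
  let L := minkowski_comb (1 - lambda) K lambda (opp_set K) in
  let lhs := hint (fun x => enorm x `^ p) L in
  let rhs := ((`|2 * lambda - 1| `^ p)%:E * hint (fun x => (enorm x `^ p)%R) K)%E in
  (rhs <= lhs)%E /\
  (lhs = rhs <->
    lambda = 0 \/
    (p = 1 /\
     exists u : 'rV[R]_n,
       [/\ enorm u = 1, K `<=` [set` <[u]>%VS] & ~ relint L 0])).
Proof.
move=> cK dK p1 /andP[l0' l12] L lhs rhs.
have [l0|ln0] := eqVneq lambda 0.
  have LK : L = K.
    rewrite /L l0 subr0; apply/seteqP; split => [_ [x Kx [y _ <-]]|x Kx].
      by rewrite scale1r scale0r addr0.
    exists x => //; exists (- x); first by exists x.
    by rewrite scale1r scale0r addr0.
  have -> : lhs = rhs.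
    by rewrite /rhs /lhs LK l0 mulr0 sub0r normrN1 powR1 mul1e.
  by split => //; split => // _; left.
have l0 : 0 < lambda by rewrite lt_def ln0.
have muE : `|2 * lambda - 1| = 1 - 2 * lambda.
  by rewrite ler0_norm ?opprB//; move: l12; lra.
rewrite /rhs muE; split; first exact: (hint_minkowski_le cK dK l0 l12 p1).
split; last first.
  move=> [/eqP|[p1E [u [u1 Ku nL]]]]; first by rewrite (negbTE ln0).
  have [a [b [ab Kab]]] := body_usegment cK dK u1 Ku.
  rewrite /lhs p1E; apply: (hint_minkowski_eq_line cK l0 l12 u1 ab Kab) => h; apply: nL.
  by rewrite /L (minkowski_usegment l0 l12 ab Kab); exact: usegment_relint.
move=> e; right.
have nlt : ~ ((((1 - 2 * lambda) `^ p)%:E * hint (fun x => (enorm x `^ p)%R) K < lhs)%E).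
  by rewrite e ltxx.
have p1E : p = 1.
  apply/eqP; rewrite eq_le p1 andbT leNgt; apply/negP => p1'.
  by apply: nlt; exact: (hint_minkowski_lt_powR cK dK l0 l12 p1 p1').
rewrite /lhs p1E in nlt; split => //.
have [[u [u1 Ku]]|nl] := pselect (exists u : 'rV[R]_n, enorm u = 1 /\ K `<=` [set` <[u]>%VS]).
  exists u; split => // rL; apply: nlt.
  have [a [b [ab Kab]]] := body_usegment cK dK u1 Ku.
  apply: (hint_minkowski_lt_line cK dK l0 l12 u1 ab Kab).
  apply: (relint_usegment u1 (lt_lo_hi lambda ab)).
  by rewrite -(minkowski_usegment l0 l12 ab Kab).
by case: nlt; exact: (hint_minkowski_lt_nonline cK dK l0 l12 nl).
Qed.

End HalfRange.

Section Opposite.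
Variables (R : realType) (n : nat) (K : set 'rV[R]_n).

Lemma opp_setE : opp_set K = (fun x => 0 - x) @^-1` K.
Proof.
apply/seteqP; split => [_ [x Kx <-]|x] /=; first by rewrite sub0r opprK.
by rewrite sub0r => Kx; exists (- x) => //; rewrite opprK.
Qed.

Lemma opp_setK : opp_set (opp_set K) = K.
Proof.
apply/seteqP; split => [_ [_ [x Kx <-] <-]|x Kx]; first by rewrite opprK.
by exists (- x); [exists x|rewrite opprK].
Qed.

Lemma convex_body_opp : convex_body K -> convex_body (opp_set K).
Proof.
move=> [[x Kx] cvK compK]; split; first by exists (- x), x.
  move=> y z t; rewrite !inE => -[y' Ky <-] [z' Kz <-].
  exists (t%:num *: y' + (1 - t%:num) *: z'); last by rewrite opprD -!scalerN.
  exact: convex_setP.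
apply: continuous_compact => //; apply: continuous_subspaceT.
exact: oppr_continuous.
Qed.

Lemma affine_dim_opp k : affine_dim K k -> affine_dim (opp_set K) k.
Proof.
move=> [x [V [dV KV]]]; exists (- x), V; split => //.
have hN (A : set 'rV[R]_n) y : affine_hull A y -> affine_hull (opp_set A) (- y).
  move=> [m [a [z [a1 Az ->]]]]; exists m, a, (fun i => - z i); split => //.
    by move=> i; exists (z i).
  by rewrite -sumrN; apply: eq_bigr => i _; rewrite scalerN.
apply/seteqP; split => [y /hN|_ [v vV <-]].
  rewrite opp_setK KV => -[v vV e]; exists (- v); first by rewrite /= memvN.
  by rewrite -opprD e opprK.
have : affine_hull K (x + - v) by rewrite KV; exists (- v) => //=; rewrite memvN.
by move=> /hN; rewrite opprD opprK.
Qed.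

Lemma hint_opp k (h : 'rV[R]_n -> R) : continuous h -> (forall x, 0 <= h x) ->
  (forall x, h (- x) = h x) -> hmeasurable k K ->
  hint k h (opp_set K) = hint k h K.
Proof.
move=> ch h0 hN mK; rewrite opp_setE -[RHS](hint_reflection 0 ch h0 mK).
by apply: eq_hint => x _; rewrite sub0r hN.
Qed.

(** Exchanges [lambda] with [1 - lambda] at the price of passing to [-K], over which an even
    integrand has the same integral. *)
Lemma minkowski_comb_opp (s t : R) :
  minkowski_comb s K t (opp_set K) =
  minkowski_comb t (opp_set K) s (opp_set (opp_set K)).
Proof.
rewrite opp_setK; apply/seteqP; split => [_ [x Kx [y Ky <-]]|_ [y Ky [x Kx <-]]].
  by exists y => //; exists x => //; rewrite addrC.
by exists x => //; exists y => //; rewrite addrC.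
Qed.

End Opposite.

Theorem corollary1p10 (R : realType) (n k : nat) (K : set 'rV[R]_n)
    (p lambda : R) :
  convex_body K -> affine_dim K k -> (1 <= k)%N ->
  1 <= p -> 0 <= lambda <= 1 ->
  let L := minkowski_comb (1 - lambda) K lambda (opp_set K) in
  let lhs := (\int[hausdorff_measure R n k]_(x in L) (enorm x `^ p)%:E)%E in
  let rhs := ((`|2 * lambda - 1| `^ p)%:E *
              \int[hausdorff_measure R n k]_(x in K) (enorm x `^ p)%:E)%E in
  (rhs <= lhs)%E /\
  (lhs = rhs <->
    (lambda = 0 \/ lambda = 1) \/
    (p = 1 /\
     exists u : 'rV[R]_n,
       [/\ enorm u = 1, K `<=` [set` <[u]>%VS] & ~ relint L 0])).
Proof.
case: k => // k cK dK _ p1 /andP[l0 l1] L lhs rhs.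
have [l12|l12] := leP lambda (1 / 2).
  have l012 : 0 <= lambda <= 1 / 2 by rewrite l0.
  have [h1 h2] := hint_minkowski_half cK dK p1 l012.
  split; first exact: h1.
  apply: (iff_trans h2); split => [[->|h]|[[->|l1E]|h]].
  - by left; left.
  - by right.
  - by left.
  - by exfalso; move: l12; rewrite l1E; lra.
  - by right.
have l012 : 0 <= 1 - lambda <= 1 / 2 by move: l1 l12; lra.
have [h1 h2] := hint_minkowski_half (convex_body_opp cK) (affine_dim_opp dK) p1 l012.
have LE : minkowski_comb (1 - (1 - lambda)) (opp_set K) (1 - lambda)
    (opp_set (opp_set K)) = L.
  by rewrite subKr -minkowski_comb_opp.
have hE : hint k.+1 (fun x => enorm x `^ p) (opp_set K) =
    hint k.+1 (fun x => enorm x `^ p) K.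
  apply: hint_opp => [|x|x|].
  - exact: enorm_powR_continuous.
  - exact: powR_ge0.
  - by rewrite enormN.
  - exact: convex_body_hmeasurable.
have mE : `|2 * (1 - lambda) - 1| = `|2 * lambda - 1|.
  by rewrite -normrN; congr `|_|; ring.
rewrite LE hE mE in h1 h2; split; first exact: h1.
apply: (iff_trans h2); split => [[l1E|[p1E [u [u1 Ku nL]]]]|[[l0E|->]|[p1E [u [u1 Ku nL]]]]].
- by left; right; move: l1E; lra.
- right; split => //; exists u; split => // x Kx /=.
  by rewrite -[x]opprK memvN; apply: (Ku (- x)); exists x.
- by exfalso; move: l12; rewrite l0E; lra.
- by left; rewrite subrr.
- right; split => //; exists u; split => // _ [x Kx <-] /=.
  by rewrite memvN; exact: Ku.
Qed.
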